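(* Fix $d=1$, $\Sigma=1$ and let $n\geq 3$. Suppose $h\in C_b^{n-2}(\mathbb{R})$ and $g\in C_P^{n-2}(\mathbb{R})$, where $P\in\mathcal{F}_*$. Let $f$ be the solution (given in the context) of the standard normal Stein equation with test function $h(g(\cdot))$. Then, for all $w\in\mathbb{R}$, \begin{align*}|f^{(n)}(w)|&\leq h_{n-2}\Big[3\alpha+P_1(w)+P_2(w)+\beta_2\big(\mathbb{E}P_1(Z)+|w|\mathbb{E}|ZP_1(Z)|+(1+|w|)P_1(w)\big)\\ &\quad+\gamma_2\big(\mathbb{E}P_2(\delta_2Z)P_2(\delta_2w)+\mathbb{E}|ZP_2(\delta_2 Z)||wP_2(\delta_2w)|\big)\Big]. \end{align*}
   Context: $Z\sim N(0,1)$. The Stein equation is $f''(w)-wf'(w)=h(g(w))-\mathbb{E}h(g(Z))$, and the solution considered is $$f(w)=-\int_{0}^{\infty}\big[\mathbb{E}h(g(\mathrm{e}^{-s}w+\sqrt{1-\mathrm{e}^{-2s}}\,Z))-\mathbb{E}h(g(Z))\big]\,\mathrm{d}s.$$ $\|u\|$ is the supremum norm. $h\in C_b^m(\mathbb{R})$ means that $h^{(m-1)}$ exists and is absolutely continuous, with derivatives up to $m$-th order bounded. For a given non-negative function $P$ on $\mathbb R$, $g\in C_P^m(\mathbb{R})$ means that the $m$-th order derivative of $g:\mathbb R\to\mathbb R$ exists and $|g^{(k)}(w)|^{m/k}\le P(w)$ for all $w\in\mathbb R$ and $k=1,\ldots,m$. $h_m:=\sum_{k=1}^m{m\brace k}\|h^{(k)}\|$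 with ${m\brace k}$ the Stirling numbers of the second kind. $P\in\mathcal F_*$ (case $d=1$, $\Sigma=1$) means that $P(w)=\alpha+P_1(w)+P_2(w)$, where $\alpha$ is a non-negative constant, and: (i) $P_1,P_2$ are non-negative, non-decreasing functions, in the sense that $P_i(w)\leq P_i(aw)$, $i=1,2$, for any $w\in\mathbb{R}$ and $a>1$; (ii) there exist non-negative constants $\beta_k,\gamma_k,\delta_k$ such that, for any $w_1,\ldots,w_k\in\mathbb{R}$, $P_1(w_1+\cdots+w_k)\leq\beta_k\sum_{j=1}^kP_1(w_j)$ and $P_2(w_1+\cdots+w_k)\leq\gamma_k\prod_{j=1}^kP_2(\delta_kw_j)$; (iii) the expectations $\mathbb{E}P_1(Z)$ and $\mathbb{E}P_2(Z)$ exist; (iii)' the expectations $\mathbb{E}|ZP_1(Z)|$ and $\mathbb{E}|ZP_2(Z)|$ exist. *)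

(* Defs.v *)
From HB Require Import structures.
From mathcomp Require Import all_boot all_order all_algebra.
From mathcomp Require Import all_classical all_reals all_analysis.
Set Implicit Arguments.
Unset Strict Implicit.
Unset Printing Implicit Defensive.
Import Order.TTheory GRing.Theory Num.Theory.
Import numFieldNormedType.Exports.
Local Open Scope ring_scope.
Local Open Scope classical_set_scope.

Fixpoint stirling2 (m k : nat) : nat :=
  match m, k with
  | 0, 0 => 1
  | 0, _.+1 => 0
  | _.+1, 0 => 0
  | m'.+1, k'.+1 => (k'.+1 * stirling2 m' k'.+1 + stirling2 m' k')%N
  end.

(* Absolute continuity on every compact interval. *)
Definition abs_continuous (R : realType) (u : R -> R) : Prop :=
  forall a b : R, a <= b -> forall e : R, 0 < e ->
  exists2 d : R, 0 < d &
    forall (N : nat) (x y : 'I_N -> R),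
      (forall i, [/\ a <= x i, x i <= y i & y i <= b]) ->
      trivIset setT (fun i => [set` `]x i, y i[]) ->
      \sum_(i < N) (y i - x i) < d ->
      \sum_(i < N) `|u (y i) - u (x i)| < e.

(* [u^`(k)] is a total function, with an irrelevant value where the derivative
   does not exist.  The order-m derivative of a function of class [Cb] exists in
   general only almost everywhere, so bounds and suprema range over the points
   where it exists, that is, where [u^`(k.-1)] is derivable (k >= 1). *)
Definition Cb (R : realType) (m : nat) (h : R -> R) : Prop :=
  [/\ forall (k : nat) (x : R), (k < m.-1)%N -> derivable (h^`(k)) x 1,
      abs_continuous (h^`(m.-1)) &
      forall k : nat, (1 <= k <= m)%N ->
        exists M : R, forall x : R,
          derivable (h^`(k.-1)) x 1 -> `|h^`(k) x| <= M].

Definition deriv_supnorm (R : realType) (h : R -> R) (k : nat) : R :=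
  sup [set `|h^`(k) x| | x in [set x : R | derivable (h^`(k.-1)) x 1]].

Definition hnorm (R : realType) (h : R -> R) (m : nat) : R :=
  \sum_(1 <= k < m.+1) (stirling2 m k)%:R * deriv_supnorm h k.

Definition CP (R : realType) (P : R -> R) (m : nat) (g : R -> R) : Prop :=
  (forall (k : nat) (w : R), (k < m)%N -> derivable (g^`(k)) w 1) /\
  (forall (k : nat) (w : R), (1 <= k <= m)%N ->
     `|g^`(k) w| `^ (m%:R / k%:R) <= P w).

(* The class F_* for d = 1 and Sigma = 1, Z being standard normal, together with
   its data.  A zero-fold instance of [Fstar_P1_sum] would force P1 0 = 0 and is
   excluded. *)
Record Fstar (R : realType) (d : measure_display) (T : measurableType d)
    (Pr : probability T R) (Z : {RV Pr >-> R}) (P : R -> R) (alpha : R)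
    (P1 P2 : R -> R) (beta gamma delta : nat -> R) : Prop := {
  Fstar_P : forall w, P w = alpha + P1 w + P2 w;
  Fstar_alpha_ge0 : 0 <= alpha;
  Fstar_P1_ge0 : forall w, 0 <= P1 w;
  Fstar_P2_ge0 : forall w, 0 <= P2 w;
  Fstar_P1_nondecr : forall w a, 1 < a -> P1 w <= P1 (a * w);
  Fstar_P2_nondecr : forall w a, 1 < a -> P2 w <= P2 (a * w);
  Fstar_beta_ge0 : forall k, (1 <= k)%N -> 0 <= beta k;
  Fstar_gamma_ge0 : forall k, (1 <= k)%N -> 0 <= gamma k;
  Fstar_delta_ge0 : forall k, (1 <= k)%N -> 0 <= delta k;
  Fstar_P1_sum : forall k (w : 'I_k -> R), (1 <= k)%N ->
    P1 (\sum_(j < k) w j) <= beta k * \sum_(j < k) P1 (w j);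
  Fstar_P2_sum : forall k (w : 'I_k -> R), (1 <= k)%N ->
    P2 (\sum_(j < k) w j) <= gamma k * \prod_(j < k) P2 (delta k * w j);
  Fstar_EP1 : Pr.-integrable setT (fun x => (P1 (Z x))%:E);
  Fstar_EP2 : Pr.-integrable setT (fun x => (P2 (Z x))%:E);
  Fstar_EZP1 : Pr.-integrable setT (fun x => (`|Z x * P1 (Z x)|)%:E);
  Fstar_EZP2 : Pr.-integrable setT (fun x => (`|Z x * P2 (Z x)|)%:E)
}.

Definition stein_solution (R : realType) (d : measure_display)
    (T : measurableType d) (Pr : probability T R) (Z : {RV Pr >-> R})
    (phi : R -> R) (w : R) : R :=
  - fine (\int[lebesgue_measure]_(s in `]0%R : R, +oo[)
      ('E_Pr[fun x => phi (expR (- s) * w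
                           + Num.sqrt (1 - expR (- (2 * s))) * Z x)%R]
       - 'E_Pr[fun x => phi (Z x)]))%E.

(* Main.v *)
(* Put phi = h o g and m = n - 2, and let ou s phi be the Ornstein-Uhlenbeck
   average E phi(e^-s w + sqrt(1 - e^-2s) Z), so that f is minus the integral of
   ou s phi - E phi(Z) over s > 0.  Each differentiation of ou in w releases a
   factor e^-s, so the derivatives of phi up to chi = phi^(m-1) pass under the
   integral.  By the Bell polynomial form of the chain rule, chi has at every x
   the pointwise Lipschitz constant h_m P(x), the number of monomials of B_(m,k)
   being a Stirling number.  Hence chi' = psi almost everywhere for some
   measurable psi with |psi| <= h_m P, and with Gaussian integration by parts
   f^(m) and f^(m+1) are
     u(w) = - int e^-ms E psi(e^-s w + sqrt(1 - e^-2s) Z) ds,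
     v(w) = - int e^-(m+1)s / sqrt(1 - e^-2s) E Z psi(e^-s w + sqrt(1 - e^-2s) Z) ds.
   Differentiating the Stein equation suggests, and Gaussian integration by parts
   and the fundamental theorem of calculus in s prove, that v - chi is everywhere
   differentiable with derivative m u + w v.  So f^(n) exists wherever chi' does,
   and |f^(n)| <= |m u + w v| + h_m P.  Split psi at the level A = h_m alpha: the
   part bounded by A contributes at most A to m u + w v by a maximum principle,
   and the rest is dominated through the inequalities defining F_*. *)

Require Import Defs.
From HB Require Import structures.
From mathcomp Require Import all_boot all_order all_algebra.
From mathcomp Require Import all_classical all_reals all_analysis.
From mathcomp Require Import measurable_realfun ring lra.
Set Implicit Arguments.
Unset Strict Implicit.
Unset Printing Implicit Defensive.
Import Order.TTheory GRing.Theory Num.Theory.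
Import numFieldNormedType.Exports.
Local Open Scope classical_set_scope.
Local Open Scope ring_scope.

(** * Absolutely continuous functions *)

Section interval_lists.
Context {R : realType}.
Implicit Types (f : R -> R) (a b : R) (s t : seq (R * R)) (p q : R * R).

(** Two obstacles shape the proof. First, regularity: the derivative of [h] of order m - 1 is only
    absolutely continuous and psi only measurable, so averages of psi cannot be differentiated under
    the integral. Gaussian integration by parts rewrites them as averages of chi, or of an
    antiderivative of chi, against a polynomial in Z, and these can be. Second, growth:
    integrability and monotonicity along rays give only P(x) = O(exp(c x^2)) for every c > 1/2,
    which just misses Gaussian integrability. For fixed s the contraction by sqrt(1 - e^-2s) < 1
    repairs this; as s tends to infinity the boundedness of Mehler's kernel takes over. The maximum
    principle is there because separate bounds of m u and w v for the level A would leave a multiple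
    of A |w|, whereas alpha must come with a constant factor. Of the 3 alpha, one comes from this
    principle, one from h_m P, and one is slack. Since E P2(delta_2 Z) and E |Z P2(delta_2 Z)| may
    be infinite, the inequality is proved in the extended reals. *)

Definition apart p q := (p.2 <= q.1) || (q.2 <= p.1).

Definition nonoverlapping a b s :=
  all (fun p => [&& a <= p.1, p.1 <= p.2 & p.2 <= b]) s && pairwise apart s.

Lemma nonoverlappingW a b x y s : a <= x -> y <= b ->
  nonoverlapping x y s -> nonoverlapping a b s.
Proof.
move=> ax yb /andP[/allP h hs]; rewrite /nonoverlapping hs andbT.
by apply/allP => p /h /and3P[? ? ?]; apply/and3P; split; lra.
Qed.

Definition total_length s := \sum_(p <- s) (p.2 - p.1).

Definition total_increment f s := \sum_(p <- s) `|f p.2 - f p.1|.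

(** Lists take the place of the indexed families of [abs_continuous] so that families of
    subintervals can be refined and concatenated. *)
Definition ac_on a b f := forall e : R, 0 < e -> exists2 d, 0 < d &
  forall s, nonoverlapping a b s -> total_length s < d -> total_increment f s < e.

Lemma abs_continuous_ac_on f a b : abs_continuous f -> a <= b -> ac_on a b f.
Proof.
move=> acf ab e e0; have [d d0 H] := acf a b ab e e0.
exists d => // s /andP[/allP sab sp] sd.
have := H (size s) (fun i => (nth (0, 0) s i).1) (fun i => (nth (0, 0) s i).2).
have big (F : R * R -> R) : \sum_(i < size s) F (nth (0, 0) s i) = \sum_(p <- s) F p.
  by rewrite (big_nth (0, 0)) big_mkord.
rewrite (big (fun p => p.2 - p.1)) (big (fun p => `|f p.2 - f p.1|)); apply => //.
- by move=> i; have /and3P[] := sab _ (mem_nth (0, 0) (ltn_ord i)).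
- apply/trivIsetP => i j _ _ ij; apply/seteqP; split => // z [zi zj].
  move/set_mem: zi; rewrite /= in_itv/= => /andP[zi1 zi2].
  move/set_mem: zj; rewrite /= in_itv/= => /andP[zj1 zj2].
  wlog ltij : i j ij zi1 zi2 zj1 zj2 / (i < j)%N.
    move=> W; move: (ij); rewrite neq_ltn => /orP[ij'|ij']; first exact: (W i j).
    by apply: (W j i) => //; rewrite eq_sym.
  have /(pairwiseP (0, 0)) /(_ i j (ltn_ord i) (ltn_ord j) ltij) := sp.
  by move=> /orP[?|?]; lra.
Qed.

Definition steps a (l : seq R) := pairmap (fun x y => (x, y)) a l.

Lemma steps_nonoverlapping a b l : path <%O a l -> last a l = b ->
  nonoverlapping a b (steps a l).
Proof.
rewrite /nonoverlapping; elim: l a => [|x l ih] a /=; first by [].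
move=> /andP[ax xl] lb.
have /andP[/allP h1 h2] := ih _ xl lb.
have xb : x <= b.
  by rewrite -lb; apply: (@itv_partition_le _ _ _ _ l); split => //=.
rewrite lexx (ltW ax) xb h2 /= andbT; apply/andP; split; apply/allP => p ps.
  by have /and3P[xp -> ->] := h1 _ ps; rewrite (le_trans (ltW ax)).
by rewrite /apart /=; have /and3P[-> _ _] := h1 _ ps.
Qed.

Lemma steps_length a b l : last a l = b -> total_length (steps a l) = b - a.
Proof.
rewrite /total_length; elim: l a => [|x l ih] a /=.
  by move=> ->; rewrite big_nil subrr.
by move=> lb; rewrite big_cons ih//=; ring.
Qed.

Lemma steps_increment f a b l : itv_partition a b l ->
  total_increment f (steps a l) = variation a b f l.
Proof.
move=> abl; rewrite variation_zip// /total_increment.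
elim: l a {abl} => [|x l ih] a /=; first by rewrite !big_nil.
by rewrite !big_cons ih.
Qed.

Lemma nonoverlapping_cat a b s t : nonoverlapping a b (s ++ t) =
  [&& nonoverlapping a b s, nonoverlapping a b t & allrel apart s t].
Proof.
rewrite /nonoverlapping all_cat pairwise_cat.
by case: all; case: all; case: pairwise; case: pairwise; case: allrel.
Qed.

(** Let [d] answer the tolerance 1. Partitions of an interval shorter than [d] have variation below
    1, and finitely many intervals of length [d / 2] cover [[a, b]]; the induction is on their
    number, by additivity of the total variation. *)
Lemma ac_on_bounded_variation a b f : a <= b -> ac_on a b f ->
  bounded_variation a b f.
Proof.
move=> ab acf; have [d d0 H] := acf 1 ltr01.
suff W n x y : a <= x -> x <= y -> y <= b -> y - x < n%:R * (d / 2) ->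
    bounded_variation x y f.
  have [n nab] : exists n : nat, b - a < n%:R * (d / 2).
    exists (Num.bound ((b - a) / (d / 2))).
    rewrite -ltr_pdivrMr ?divr_gt0//.
    by apply/archi_boundP/divr_ge0; lra.
  exact: W nab.
elim: n x y => [|n ih] x y ax xy yb.
  by rewrite mul0r => ?; exfalso; lra.
rewrite -natr1 mulrDl mul1r => yxn.
have [yx|xdy] := ltP y (x + d / 2).
  exists 1 => _ [l [xyl ly] <-].
  rewrite -steps_increment//; apply/ltW/H.
    by apply: nonoverlappingW (steps_nonoverlapping xyl (eqP ly)).
  by rewrite (steps_length (eqP ly)); lra.
apply/bounded_variationP => //.
have xd : x <= x + d / 2 by lra.
rewrite (total_variationD f xd xdy) fin_numD; apply/andP; split.
- apply/bounded_variationP => //; exists 1 => _ [l [xyl ly] <-].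
  rewrite -steps_increment//; apply/ltW/H.
    by apply: nonoverlappingW (steps_nonoverlapping xyl (eqP ly)) => //; lra.
  by rewrite (steps_length (eqP ly)); lra.
- by apply/bounded_variationP => //; apply: ih => //; lra.
Qed.

Definition variation_fun a f x := fine (total_variation a x f).

Lemma variation_funB a b f x y : bounded_variation a b f ->
  a <= x -> x <= y -> y <= b ->
  variation_fun a f y - variation_fun a f x = fine (total_variation x y f).
Proof.
move=> bv ax xy yb; rewrite /variation_fun (total_variationD f ax xy) fineD; first by rewrite addrAC subrr add0r.
- apply/bounded_variationP => //; apply: bounded_variationl bv => //.
  exact: le_trans yb.
- apply/bounded_variationP => //; apply: (@bounded_variationr _ a _ y) => //.
  by apply: bounded_variationl bv => //; exact: le_trans xy.
Qed.

(** Each interval of [s] is replaced by a partition of it that is nearly optimal for the variation,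
    the error being halved at each step of the induction. The third clause keeps the refinements of
    different intervals apart. *)
Lemma refine_variation a b f s (e : R) : bounded_variation a b f ->
  nonoverlapping a b s -> 0 < e ->
  exists t, [/\ nonoverlapping a b t, total_length t = total_length s,
    (forall q, q \in t -> exists2 p, p \in s & p.1 <= q.1 /\ q.2 <= p.2) &
    \sum_(p <- s) fine (total_variation p.1 p.2 f) <= total_increment f t + e].
Proof.
move=> bv; elim: s e => [|p s ih] e ps e0.
  by exists [::]; split => //; rewrite /total_increment !big_nil add0r ltW.
move: ps; rewrite -cat1s nonoverlapping_cat => /and3P[].
rewrite {1}/nonoverlapping /= !andbT => /and3P[ap pp pb] os /allrelP ps.
have e20 : 0 < e / 2 by rewrite divr_gt0.
have [t [ot lt st vt]] := ih _ os e20.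
have pbv : bounded_variation p.1 p.2 f.
  apply: (@bounded_variationr _ a) => //; apply: bounded_variationl bv => //.
  exact: le_trans pp.
have [l [pl pll] lv] : exists2 l, itv_partition p.1 p.2 l &
    fine (total_variation p.1 p.2 f) <= variation p.1 p.2 f l + e / 2.
  have /(bounded_variationP _ pp) fin := pbv.
  have [_ [_ [l pl <-] <-] H] := ub_ereal_sup_adherent e20 fin.
  exists l => //.
  move: H; rewrite -[ereal_sup _](fineK fin) -EFinB lte_fin; lra.
have ol := steps_nonoverlapping pl (eqP pll).
exists (steps p.1 l ++ t); split.
- rewrite nonoverlapping_cat ot /=.
  apply/andP; split=> //.
    exact: nonoverlappingW ol.
  apply/allrelP => q r /= qp rt.
  have [r' r's [r1 r2]] := st _ rt.
  have := ps p r' (mem_head _ _) r's.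
  move: ol => /andP[/allP /(_ _ qp) /and3P[q1 q2 q3] _].
  by rewrite /apart => /orP[?|?]; apply/orP; [left|right]; lra.
- by rewrite /total_length big_cat big_cons/= -!/(total_length _) (steps_length (eqP pll)) lt.
- move=> q; rewrite mem_cat => /orP[qp|qt].
    exists p; first by rewrite mem_head.
    by move: ol => /andP[/allP /(_ _ qp) /and3P[q1 q2 q3] _].
  have [r rs rq] := st _ qt; exists r => //.
  by rewrite inE rs orbT.
- rewrite big_cons /total_increment big_cat/= -!/(total_increment _ _).
  by rewrite (@steps_increment f p.1 p.2)//; lra.
Qed.

(** Take [d] for [e / 2] and a refinement of error [e / 4], which has the same total length: the
    increments of the variation function then add up to less than [e / 2 + e / 4]. *)
Lemma ac_on_variation_fun a b f : a <= b -> ac_on a b f ->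
  ac_on a b (variation_fun a f).
Proof.
move=> ab acf e e0; have bv := ac_on_bounded_variation ab acf.
have e20 : 0 < e / 2 by rewrite divr_gt0.
have [d d0 H] := acf _ e20.
exists d => // s os sd.
have e40 : 0 < e / 4 by rewrite divr_gt0.
have [t [ot lt _ vt]] := refine_variation bv os e40.
have := H _ ot; rewrite lt => /(_ sd) Ht.
have -> : total_increment (variation_fun a f) s =
    \sum_(p <- s) fine (total_variation p.1 p.2 f).
  rewrite /total_increment !big_seq; apply: eq_bigr => p ps.
  move: os => /andP[/allP /(_ _ ps) /and3P[ap pp pb] _].
  rewrite (variation_funB bv) ?ger0_norm//.
  by rewrite fine_ge0// total_variation_ge0.
lra.
Qed.

End interval_lists.

(** The clamped values are given by cases, so that each of the nine combinations is linear
    arithmetic. *)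
Lemma clamp_contraction {R : realType} (a b x y cx cy : R) : a < b -> x <= y ->
  [\/ x <= a /\ cx = a, a <= x <= b /\ cx = x | b <= x /\ cx = b] ->
  [\/ y <= a /\ cy = a, a <= y <= b /\ cy = y | b <= y /\ cy = b] ->
  cx <= cy /\ cy - cx <= y - x.
Proof.
move=> ab xy; case=> [[? ->]|[/andP[? ?] ->]|[? ->]];
  by case=> [[? ->]|[/andP[? ?] ->]|[? ->]]; split; lra.
Qed.

Section monotone_absolutely_continuous.
Context {R : realType}.
Variables (M : R -> R) (a b : R).
Hypotheses (ab : a < b) (ndM : {homo M : x y / x <= y}).
Hypotheses (Ma : forall x, x <= a -> M x = M a) (Mb : forall x, b <= x -> M x = M b).
Hypothesis acM : ac_on a b M.
Notation mu := (@lebesgue_measure R).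

(** A single interval in the definition of absolute continuity gives this on [[a, b]]; constancy of
    [M] outside extends it to the whole line. It yields the right continuity required of a
    cumulative function. *)
Let close (e : R) : 0 < e -> exists2 d : R, 0 < d & forall x y : R, x <= y -> y - x < d ->
  M y - M x < e.
Proof.
move=> e0; have [d d0 H] := acM e0; exists d => // x y xy yxd.
pose cl z := Num.max a (Num.min b z).
have clM z : M (cl z) = M z.
  rewrite /cl; have [zb|bz] := leP b z.
    by rewrite max_r ?Mb// ltW.
  by have [az|za] := leP a z => //; rewrite [RHS]Ma// ltW.
have clab z : a <= cl z /\ cl z <= b.
  by rewrite /cl le_max lexx ge_max (ltW ab) ge_min lexx.
have clxy : cl x <= cl y /\ cl y - cl x <= y - x.
  have spec z : [\/ z <= a /\ cl z = a, a <= z <= b /\ cl z = z | b <= z /\ cl z = b].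
    rewrite /cl; have [zb|bz] := leP b z; first by rewrite (max_r (ltW ab)); apply: Or33.
    have [az|za] := leP a z; first by apply: Or32; rewrite (ltW bz).
    by apply: Or31; rewrite (ltW za).
  exact: (clamp_contraction ab xy (spec x) (spec y)).
have := H [:: (cl x, cl y)].
rewrite /nonoverlapping /total_length /total_increment !big_seq1/= !andbT.
rewrite (clab x).1 (clab y).2 clxy.1 !clM => /(_ isT) H'.
apply: le_lt_trans (H' _); first exact: ler_norm.
by apply: le_lt_trans yxd; exact: clxy.2.
Qed.

Let rcM : right_continuous M.
Proof.
move=> x; apply/cvgrPdist_lt => e e0.
have [d d0 H] := close e0.
near=> y.
have xy : x < y by near: y; exact: nbhs_right_gt.
rewrite distrC ger0_norm ?subr_ge0 ?ndM ?ltW//; apply: H; first exact: ltW.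
rewrite ltrBlDl; near: y; apply: nbhs_right_lt; lra.
Unshelve. all: by end_near. Qed.

HB.instance Definition _ := isCumulative.Build R _ _ M ndM rcM.

Let lM := lebesgue_stieltjes_measure M.

Let lM_itv x y : x <= y -> lM `]x, y] = (M y - M x)%:E.
Proof.
move=> xy; rewrite /lM /lebesgue_stieltjes_measure /measure_extension/=.
by rewrite measurable_mu_extE/= ?wlength_itv_bnd//; exact: is_ocitv.
Qed.

Let mD : measurable (`]a, b] : set (measurableTypeR R)).
Proof. exact: measurable_itv. Qed.

Let nu := mrestr lM mD.

Let nu_fin : fin_num_fun nu.
Proof.
apply: lty_fin_num_fun.
have h : nu setT = lM `]a, b] by rewrite /nu /mrestr; congr (lM _); exact: setTI.
by move: h; rewrite lM_itv ?ltW// => h; apply: le_lt_trans (ltry (M b - M a)); rewrite -h.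
Qed.

HB.instance Definition _ := Measure.on nu.
HB.instance Definition _ := Measure_isFinite.Build _ _ _ nu nu_fin.

(** An open set is a disjoint union of countably many open intervals; after intersection with []a,
    b]] the measure [nu] of each is at most an increment of [M]. Absolute continuity bounds all
    finite partial sums, hence the series. *)
Let nu_small (e : R) : 0 < e -> exists2 d : R, 0 < d & forall U, open U ->
  (mu U < d%:E)%E -> (nu U <= e%:E)%E.
Proof.
move=> e0; have [d d0 H] := acM e0; exists d => // U oU Ud.
pose I := open_disjoint_itv oU.
have oI n : open (I n) by exact: open_disjoint_itv_open.
have iI n : is_interval (I n) by exact: open_disjoint_itv_is_interval.
have tI : trivIset setT I by exact: open_disjoint_itv_trivIset.
have UI : U = \bigcup_n I n by exact: open_disjoint_itv_bigcup.
pose J n := I n `&` `]a, b].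
have mI n : measurable (I n : set (measurableTypeR R)) by exact: open_measurable.
(* The ends of the component [J n]. An empty component gets the degenerate interval at [a], which
   adds no length, no increment and no overlap. *)
pose p n := if pselect (J n !=set0) then (inf (J n), sup (J n)) else (a, a).
have J1 n x y : J n x -> J n y -> x <= y -> `[x, y] `<=` J n.
  move=> [Ix]; rewrite /= in_itv/= => /andP[ax xb] [Iy]; rewrite /= in_itv/= => /andP[ay yb] xy.
  move=> z; rewrite /= in_itv/= => /andP[xz zy]; split.
    by apply: (iI n x y) => //; apply/andP; split.
  by rewrite /= in_itv/= (lt_le_trans ax xz) (le_trans zy yb).
have Jb n x : J n x -> a < x /\ x <= b.
  by move=> [_]; rewrite /= in_itv/= => /andP[].
have hi n : has_inf (J n) \/ ~ (J n !=set0).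
  have [?|?] := pselect (J n !=set0); [left; split => //|by right].
  by exists a => x /Jb[? _]; exact: ltW.
have hs n : has_sup (J n) \/ ~ (J n !=set0).
  have [?|?] := pselect (J n !=set0); [left; split => //|by right].
  by exists b => x /Jb[].
have p_ok n : [/\ a <= (p n).1, (p n).1 <= (p n).2, (p n).2 <= b,
    J n `<=` `](p n).1, (p n).2] & `](p n).1, (p n).2[ `<=` J n].
  rewrite /p; case: pselect => /= Jn0; last first.
    rewrite lexx ltW//; split => //.
      by move=> x Jx; exfalso; apply: Jn0; exists x.
    by rewrite set_itvoo0.
  have [hiJ|//] := hi n; have [hsJ|//] := hs n.
  have [z Jz] := Jn0.
  have infz : inf (J n) <= z by apply: ge_inf => //; exact: hiJ.2.
  have supz : z <= sup (J n) by apply: ub_le_sup => //; exact: hsJ.2.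
  split.
  - by apply: lb_le_inf => // x /Jb[? _]; exact: ltW.
  - exact: le_trans supz.
  - by apply: ge_sup => // x /Jb[].
  - move=> x Jx; rewrite /= in_itv/=; apply/andP; split; last first.
      by apply: ub_le_sup => //; exact: hsJ.2.
    have [ax _] := Jb _ _ Jx.
    (* The infimum is not attained: [I n] is open and [a] is excluded, so [J n] also contains a
       point to the left of [x]. *)
    have [e1 /= e10 Ie1] : exists2 r : R, 0 < r & ball x r `<=` I n.
      by have := oI n; rewrite openE => /(_ x Jx.1) /nbhs_ballP[r /= ? ?]; exists r.
    pose r := Num.min (e1 / 2) ((x - a) / 2).
    have r0 : 0 < r by rewrite lt_min !divr_gt0// subr_gt0.
    have re : r <= e1 / 2 by rewrite ge_min lexx.
    have rx : r <= (x - a) / 2 by rewrite ge_min lexx orbT.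
    have : J n (x - r).
      split; first by apply: Ie1; rewrite /ball/= opprB addrCA subrr addr0 gtr0_norm; lra.
      by rewrite /= in_itv/=; have [_ ?] := Jb _ _ Jx; apply/andP; split; lra.
    by move=> Jxr; apply: (@le_lt_trans _ _ (x - r)); [apply: ge_inf => //; exact: hiJ.2|lra].
  - move=> x; rewrite /= in_itv/= => /andP[ix xs].
    have [y Jy yx] := inf_lt Jn0 ix.
    have [y' Jy' y'x] := sup_gt Jn0 xs.
    by apply: (J1 n y y') => //=; rewrite ?in_itv/=; [lra|apply/andP; split; lra].
have nuI n : (nu (I n) <= (M (p n).2 - M (p n).1)%:E)%E.
  have [h1 h2 h3 h4 h5] := p_ok n.
  rewrite -lM_itv// /nu /mrestr; apply: le_measure => //; rewrite ?inE.
  - exact: measurableI.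
  - exact: measurable_itv.
have muI n : (((p n).2 - (p n).1)%:E <= mu (I n))%E.
  have [h1 h2 h3 h4 h5] := p_ok n.
  have : (mu `](p n).1, (p n).2[ <= mu (I n))%E.
    apply: (@le_measure _ _ _ mu); rewrite ?inE//.
    by move=> x /h5[].
  apply: le_trans; rewrite lebesgue_measure_itv/= lte_fin.
  have [//|ge] := ltP; rewrite lee_fin; lra.
have p_deg n : (p n).1 = (p n).2 -> (p n).1 = a /\ (p n).2 = a.
  have [_ _ _ h4 _] := p_ok n => e1.
  have [[z /h4]|Jn0] := pselect (J n !=set0).
    by rewrite /= in_itv/= => /andP[z1 z2]; exfalso; lra.
  by rewrite /p; case: pselect.
have apart_p n m : n != m -> apart (p n) (p m).
  move=> nm; rewrite /apart; have [//|l1] := leP (p n).2 (p m).1.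
  rewrite /= leNgt; apply/negP => l2.
  have [h1 h2 h3 h4 h5] := p_ok n; have [k1 k2 k3 k4 k5] := p_ok m.
  have [e1|e1] := eqVneq (p n).1 (p n).2.
    by have [? ?] := p_deg n e1; lra.
  have [e2|e2] := eqVneq (p m).1 (p m).2.
    by have [? ?] := p_deg m e2; lra.
  have n12 : (p n).1 < (p n).2 by rewrite lt_neqAle e1.
  have m12 : (p m).1 < (p m).2 by rewrite lt_neqAle e2.
  pose lo := Num.max (p n).1 (p m).1; pose hi' := Num.min (p n).2 (p m).2.
  have lohi : lo < hi' by rewrite lt_min !gt_max n12 m12 l1 l2.
  have lo1 : (p n).1 <= lo by rewrite le_max lexx.
  have lo2 : (p m).1 <= lo by rewrite le_max lexx orbT.
  have hi1 : hi' <= (p n).2 by rewrite ge_min lexx.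
  have hi2 : hi' <= (p m).2 by rewrite ge_min lexx orbT.
  have [Iz1 _] : J n ((lo + hi') / 2).
    by apply: h5; rewrite /= in_itv/=; apply/andP; split; lra.
  have [Iz2 _] : J m ((lo + hi') / 2).
    by apply: k5; rewrite /= in_itv/=; apply/andP; split; lra.
  by move/trivIsetP: tI => /(_ n m Logic.I Logic.I nm) /seteqP[+ _] => /(_ _ (conj Iz1 Iz2)).
have nuU : (nu U = \sum_(n <oo) nu (I n))%E.
  rewrite [in LHS]UI measure_semi_bigcup//.
  by apply: bigcupT_measurable.
rewrite nuU; apply: lime_le; first exact: is_cvg_nneseries.
apply: nearW => N.
have muN : (\sum_(0 <= n < N) mu (I n) <= mu U)%E.
  rewrite UI measure_semi_bigcup//; last exact: bigcupT_measurable.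
  exact: nneseries_lim_ge.
have := H [seq p n | n <- iota 0 N].
have -> : nonoverlapping a b [seq p n | n <- iota 0 N].
  rewrite /nonoverlapping; apply/andP; split.
    by apply/allP => _ /mapP[n _ ->]; have [-> -> ->] := p_ok n.
  rewrite pairwise_map; apply: (@sub_in_pairwise _ predT ltn).
  - by move=> n m _ _ /= nm; apply: apart_p; rewrite ltn_eqF.
  - by apply/allP.
  - by rewrite -sorted_pairwise ?iota_ltn_sorted//; exact: ltn_trans.
move=> /(_ isT) H1; apply: (@le_trans _ _ (\sum_(0 <= n < N) (M (p n).2 - M (p n).1)%:E)%E).
  by apply: lee_sum => n _; exact: nuI.
rewrite sumEFin lee_fin; apply: (@le_trans _ _ (total_increment M [seq p n | n <- iota 0 N])).
  rewrite /total_increment big_map /index_iota subn0.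
  by apply: ler_sum => n _; exact: ler_norm.
apply/ltW/H1; rewrite -lte_fin; apply: le_lt_trans Ud; apply: le_trans muN.
rewrite /total_length big_map -sumEFin /index_iota subn0.
by apply: lee_sum => n _; exact: muI.
Qed.

(** Outer regularity encloses a Lebesgue null set in an open set of small measure, to which
    [nu_small] applies. *)
Let nu_dominated : nu `<< mu.
Proof.
apply/null_content_dominatesP => A mA muA0.
apply/eqP; rewrite eq_le measure_ge0 andbT; apply/lee_addgt0Pr => e e0.
rewrite add0e; have [d d0 H] := nu_small e0.
have [U [oU AU Ud]] : exists U, [/\ open U, A `<=` U & (mu (U `\` A) < d%:E)%E].
  by apply: lebesgue_regularity_outer => //; rewrite muA0.
apply: le_trans (H U oU _).
  by apply: le_measure; rewrite ?inE//; exact: open_measurable.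
rewrite (@measureDI _ _ _ mu U A)//; last exact: open_measurable.
rewrite setIidr// [X in (_ + X < _)%E]muA0 adde0 //.
Qed.

(** The density is the Radon-Nikodym derivative of the Lebesgue-Stieltjes measure of [M] restricted
    to []a, b]]. *)
Lemma monotone_ac_density : exists2 g : R -> R,
  mu.-integrable setT (EFin \o g) &
  forall x y, a <= x -> x <= y -> y <= b -> M y - M x = \int[mu]_(t in `[x, y]) g t.
Proof.
have dom : charge_of_finite_measure nu `<< mu by exact: nu_dominated.
pose f := Radon_Nikodym (charge_of_finite_measure nu) mu.
have ff x : f x \is a fin_num by exact: Radon_Nikodym_fin_num.
have fE : EFin \o (fine \o f) = f by apply/funext => x /=; rewrite fineK.
exists (fine \o f).
  by rewrite fE; exact: Radon_Nikodym_integrable.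
move=> x y ax xy yb; rewrite -Rintegral_itv_obnd_cbnd; last first.
  rewrite fE; apply: (integrableS measurableT) => //.
  exact: Radon_Nikodym_integrable.
rewrite /Rintegral.
have := @Radon_Nikodym_integral _ _ _ (charge_of_finite_measure nu) mu `]x, y] dom (measurable_itv _).
rewrite [X in X = _ -> _](_ : _ = lM `]x, y]); last first.
  rewrite /charge_of_finite_measure /= /nu /mrestr setIidl//.
  by move=> z; rewrite /= !in_itv/= => /andP[? ?]; apply/andP; split; lra.
rewrite [lM _]lM_itv// => h.
have -> : (\int[mu]_(x0 in `]x, y]) ((fine \o f) x0)%:E)%E = (\int[mu]_(x0 in `]x, y]) f x0)%E.
  by apply: eq_integral => z _ /=; rewrite fineK.
by rewrite -h.
Qed.

End monotone_absolutely_continuous.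

Section absolutely_continuous_ftc.
Context {R : realType}.
Implicit Types (f g : R -> R) (a b : R).
Notation mu := (@lebesgue_measure R).

Definition clamp a b z : R := Num.max a (Num.min b z).

Lemma clampP a b z : a < b ->
  [\/ z <= a /\ clamp a b z = a, a <= z <= b /\ clamp a b z = z | b <= z /\ clamp a b z = b].
Proof.
move=> ab; rewrite /clamp.
have [zb|bz] := leP b z; first by rewrite (max_r (ltW ab)); apply: Or33.
have [az|za] := leP a z; first by apply: Or32; rewrite (ltW bz).
by apply: Or31; rewrite (ltW za).
Qed.

Lemma clamp_id a b z : a < b -> a <= z -> z <= b -> clamp a b z = z.
Proof.
move=> ab az zb; have [[za ->]|[_ ->]//|[bz ->]] := clampP z ab.
  by apply/eqP; rewrite eq_le az za.
by apply/eqP; rewrite eq_le bz zb.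
Qed.

(** Jordan decomposition: the variation function [T] and [T - f] are nondecreasing and absolutely
    continuous, and the density of [f] is the difference of theirs. Clamping makes both constant
    outside [[a, b]]. *)
Lemma ac_density f a b : a < b -> ac_on a b f -> exists2 g : R -> R,
  mu.-integrable setT (EFin \o g) &
  forall x y, a <= x -> x <= y -> y <= b -> f y - f x = \int[mu]_(t in `[x, y]) g t.
Proof.
move=> ab acf; pose T := variation_fun a f.
have bv := ac_on_bounded_variation (ltW ab) acf.
have acT := ac_on_variation_fun (ltW ab) acf.
have incT x y : a <= x -> x <= y -> y <= b -> `|f y - f x| <= T y - T x.
  move=> ax xy yb; rewrite (variation_funB bv)// -lee_fin fineK.
    exact: total_variation_ge.
  apply/bounded_variationP => //; apply: (@bounded_variationr _ a _ y) => //.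
  by apply: bounded_variationl bv => //; exact: le_trans xy.
pose M1 z := T (clamp a b z); pose M2 z := T (clamp a b z) - f (clamp a b z).
have clE x y : x <= y -> [/\ a <= clamp a b x, clamp a b x <= clamp a b y & clamp a b y <= b].
  move=> xy; have [-> _] := clamp_contraction ab xy (clampP x ab) (clampP y ab).
  by split => //; rewrite /clamp ?le_max ?lexx// ge_max (ltW ab) ge_min lexx.
have cla x : x <= a -> clamp a b x = a.
  by move=> xa; have [[? ->]|[/andP[? ?] ->]|[? ->]] := clampP x ab; lra.
have clb x : b <= x -> clamp a b x = b.
  by move=> xa; have [[? ->]|[/andP[? ?] ->]|[? ->]] := clampP x ab; lra.
have ac1 : ac_on a b M1.
  move=> e e0; have [d d0 H] := acT e e0; exists d => // s os sd.
  apply: le_lt_trans (H s os sd); rewrite /total_increment big_seq [leRHS]big_seq.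
  apply: ler_sum => p ps; move/andP : os => [/allP /(_ _ ps) /and3P[? ? ?] _].
  by rewrite /M1 !clamp_id//; lra.
have ac2 : ac_on a b M2.
  move=> e e0; have e20 : 0 < e / 2 by rewrite divr_gt0.
  have [d d0 H] := acT _ e20; have [d' d'0 H'] := acf _ e20.
  exists (Num.min d d'); first by rewrite lt_min d0.
  move=> s os; rewrite lt_min => /andP[sd sd'].
  have := ltrD (H s os sd) (H' s os sd'); rewrite -splitr; apply: le_lt_trans.
  rewrite /total_increment -big_split/= big_seq [leRHS]big_seq.
  apply: ler_sum => p ps; move/andP : os => [/allP /(_ _ ps) /and3P[? ? ?] _].
  rewrite /M2 !clamp_id//; try lra.
  rewrite (_ : T p.2 - _ - _ = (T p.2 - T p.1) - (f p.2 - f p.1)); last by ring.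
  exact: ler_normB.
have nd1 : {homo M1 : x y / x <= y}.
  move=> x y /clE[? ? ?]; rewrite /M1 -subr_ge0.
  by apply: le_trans (incT _ _ _ _ _).
have nd2 : {homo M2 : x y / x <= y}.
  move=> x y /clE[h1 h2 h3]; rewrite /M2.
  by have := incT _ _ h1 h2 h3; have := ler_norm (f (clamp a b y) - f (clamp a b x)); lra.
have [g1 ig1 G1] : exists2 g : R -> R, mu.-integrable setT (EFin \o g) &
    forall x y, a <= x -> x <= y -> y <= b -> M1 y - M1 x = \int[mu]_(t in `[x, y]) g t.
  apply: (monotone_ac_density ab nd1) => // x ?; rewrite /M1.
    by rewrite !cla.
  by rewrite !clb.
have [g2 ig2 G2] : exists2 g : R -> R, mu.-integrable setT (EFin \o g) &
    forall x y, a <= x -> x <= y -> y <= b -> M2 y - M2 x = \int[mu]_(t in `[x, y]) g t.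
  apply: (monotone_ac_density ab nd2) => // x ?; rewrite /M2.
    by rewrite !cla.
  by rewrite !clb.
exists (g1 \- g2).
  rewrite (_ : EFin \o _ = (EFin \o g1) \- (EFin \o g2))%E; last first.
    by apply/funext => x /=; rewrite EFinB.
  exact: integrableB.
move=> x y ax xy yb; rewrite RintegralB//; last 2 first.
- exact: (integrableS measurableT).
- exact: (integrableS measurableT).
rewrite -G1// -G2// /M1 /M2 !clamp_id//; lra.
Qed.

Lemma ac_density_derivable f a b : a < b -> ac_on a b f -> exists g : R -> R, [/\
  mu.-integrable setT (EFin \o g),
  forall x y, a <= x -> x <= y -> y <= b -> f y - f x = \int[mu]_(t in `[x, y]) g t &
  {ae mu, forall x, x \in `]a, b[%R -> is_derive x 1 f (g x)}].
Proof.
move=> ab /(ac_density ab)[g ig gE]; exists g; split => //.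
have igy (y : R) : mu.-integrable [set` Interval (BLeft a) (BRight y)] (EFin \o g).
  exact: (integrableS measurableT).
have lg : locally_integrable setT g by apply: open_integrable_locally => //; exact: openT.
have := FTC1 igy lg; apply: (@filterS _ _ (ae_filter_ringOfSetsType mu)) => x H; rewrite in_itv/= => /andP[ax xb].
have [|dF FE] := H; first by rewrite /= lte_fin.
pose F := (fun x : R => \int[mu]_(t in [set` `[a, x]]) g t).
have feq : \forall y \near (x : R), f a + F y = f y.
  near=> y; rewrite /F /= -gE//.
  - by rewrite addrC subrK.
  - by apply/ltW; near: y; exact: lt_nbhsr.
  - by apply/ltW; near: y; exact: lt_nbhsl.
move: dF FE feq; rewrite -/F; clearbody F; move=> dF FE feq.
have dF1 : is_derive (x : R) 1 F (g x).
  by split; [exact: dF|rewrite -FE; exact/esym/derive1E].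
apply: (near_eq_is_derive feq).
have := is_deriveD (is_derive_cst (f a) (x : R) 1) dF1.
by rewrite add0r.
Unshelve. all: by end_near. Qed.

Lemma abs_continuous_ae_derivable f : abs_continuous f ->
  {ae mu, forall x, derivable f x 1}.
Proof.
move=> acf.
have H (n : nat) : {ae mu, forall x, x \in `]- n.+1%:R, n.+1%:R[%R -> derivable f x 1}.
  have nn : - n.+1%:R < n.+1%:R :> R by rewrite gtrN.
  have [g [_ _]] := ac_density_derivable nn (abs_continuous_ac_on acf (ltW nn)).
  by apply: (@filterS _ _ (ae_filter_ringOfSetsType mu)) => x xg /xg.
have := @negligible_bigcup _ _ _ mu _ H; apply: negligibleS => x /= nd.
have [n xn] : exists n : nat, `|x| < n.+1%:R.
  exists (Num.bound x); apply: lt_trans (_ : (Num.bound x)%:R < _) => //.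
    have := archi_boundP (normr_ge0 x).
    by rewrite -[X in _ -> X < _]ger0_norm// /Num.bound normr_id.
  by rewrite ltr_nat.
exists n => //= h; apply: nd; apply: h; rewrite in_itv/=.
by move: xn; rewrite ltr_norml.
Qed.

(** Almost everywhere [eta] equals the density of [f] by uniqueness of the derivative. The two end
    points are set aside, since the density is known to be the derivative only inside the
    interval. *)
Lemma abs_continuous_ftc f (eta : R -> R) a b : abs_continuous f ->
  measurable_fun setT eta -> {ae mu, forall x : R, is_derive x 1 f (eta x)} ->
  a <= b -> mu.-integrable `[a, b] (EFin \o eta) /\
  f b - f a = \int[mu]_(t in `[a, b]) eta t.
Proof.
move=> acf meta deta; rewrite le_eqVlt => /predU1P[<-|ab].
  rewrite set_itv1 subrr Rintegral_set1; split => //.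
  apply/integrableP; split; first exact/measurable_EFinP/measurable_funTS.
  by rewrite integral_set1 ltry.
have [g [ig gE dg]] := ac_density_derivable ab (abs_continuous_ac_on acf (ltW ab)).
have igab : mu.-integrable `[a, b] (EFin \o g) by exact: (integrableS measurableT).
have ae_g_eta : ae_eq mu `[a, b]%classic (EFin \o g) (EFin \o eta).
  have nab : {ae mu, forall x : R, x <> a /\ x <> b}.
    exists [set a; b]; split => //.
    - exact: measurableU.
    - by apply: countable_lebesgue_measure0; apply: finite_set_countable; exact: finite_set2.
    - by move=> x /= /not_andP[] /contrapT; [left|right].
  apply: (@filterS3 _ _ (ae_filter_ringOfSetsType mu) _ _ _ _ _ nab dg deta).
  move=> x [xa xb] gx ex; rewrite /= in_itv/= => /andP[ax bx]; congr EFin.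
  have xab : x \in `]a, b[%R.
    by rewrite in_itv/= !lt_neqAle ax bx !andbT; apply/andP; split; apply/eqP => // /esym.
  have [_ <-] := gx xab; have [_ <-] := ex; done.
have mea : measurable_fun `[a, b] (EFin \o eta).
  exact/measurable_EFinP/measurable_funTS.
split.
  apply/integrableP; split => //; have /integrableP[mg] := igab.
  apply: le_lt_trans; rewrite le_eqVlt; apply/orP; left; apply/eqP.
  apply: ae_eq_integral => //.
  - exact: measurableT_comp.
  - exact: measurableT_comp.
  - move: ae_g_eta; apply: (@filterS _ _ (ae_filter_ringOfSetsType mu)).
    by move=> x H /H ->.
rewrite (gE a b)//; last exact: ltW.
congr fine; apply: ae_eq_integral => //.
exact: (measurable_int mu).
Qed.

Lemma lipschitz_abs_continuous f :
  (forall a b, a <= b -> exists L : R, forall x y, a <= x -> x <= y -> y <= b ->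
    `|f y - f x| <= L * (y - x)) -> abs_continuous f.
Proof.
move=> H a b ab e e0; have [L HL] := H a b ab.
pose K := Num.max L 1; have K0 : 0 < K by rewrite lt_max ltr01 orbT.
exists (e / K); first by rewrite divr_gt0.
move=> N x y xy _ sxy.
apply: (@le_lt_trans _ _ (\sum_(i < N) K * (y i - x i))).
  apply: ler_sum => i _; have [ax xyi yb] := xy i.
  apply: (le_trans (HL _ _ ax xyi yb)).
  by rewrite ler_wpM2r ?subr_ge0// le_max lexx.
by rewrite -mulr_sumr mulrC -ltr_pdivlMr.
Qed.

(* Real induction: the set of [x] with [w a <= w y] for [y <= x] is closed
   under limits by continuity and open to the right by hypothesis. *)
Lemma local_right_decrease (w : R -> R) a b : a <= b ->
  {within `[a, b], continuous w} ->
  (forall x, a <= x -> x < b -> w x <= w a ->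
     \forall y \near x^'+, w y <= w x) ->
  w b <= w a.
Proof.
move=> ab cw H.
pose S := [set x | x \in `[a, b]%R /\ forall y, a <= y -> y <= x -> w y <= w a].
have Sa : S a.
  split; first by rewrite /= in_itv/= lexx.
  by move=> y ay ya; have -> : y = a by apply/eqP; rewrite eq_le ay ya.
have ubS : ubound S b by move=> x [+ _]; rewrite in_itv/= => /andP[].
have hsS : has_sup S by split; [exists a|exists b].
set c := sup S.
have ac : a <= c by apply: ub_le_sup => //; exists b.
have cb : c <= b by apply: ge_sup => //; exists a.
have below y : a <= y -> y < c -> w y <= w a.
  move=> ay yc; have [z [zab zS] yz] := sup_gt (ex_intro _ a Sa) yc.
  by apply: zS => //; exact: ltW.
have wc : w c <= w a.
  have [->//|ca] := eqVneq c a.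
  have {}ca : a < c by rewrite lt_neqAle eq_sym ca.
  rewrite leNgt; apply/negP => wac.
  have cwc : w y @[y --> c^'-] --> w c.
    have [cb'|cb'] := eqVneq c b.
      have /(continuous_within_itvP _ _)[|_ _] := cw; first by rewrite -cb'.
      by rewrite cb'.
    have {}cb' : c < b by rewrite lt_neqAle cb' cb.
    have : {for c, continuous w}.
      have /(continuous_within_itvP _ _)[|+ _ _] := cw; first exact: lt_trans cb'.
      by apply; rewrite in_itv/= ca cb'.
    exact: cvg_at_left_filter.
  have : \forall y \near c^'-, w a < w y by apply: (cvgr_gt _ cwc).
  move=> near_gt; near c^'- => y.
  have : w a < w y by near: y.
  apply/negP; rewrite -leNgt; apply: below; last by near: y; exact: nbhs_left_lt.
  by apply/ltW; near: y; exact: nbhs_left_gt.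
have Sc : S c.
  split; first by rewrite in_itv/= ac cb.
  move=> y ay; rewrite le_eqVlt => /predU1P[->//|yc]; exact: below.
have [->//|cb'] := eqVneq b c.
have {}cb' : c < b by rewrite lt_neqAle eq_sym cb' cb.
have near_le := H c ac cb' wc.
have : exists2 d : R, 0 < d & forall y, c < y -> y < c + d -> w y <= w c.
  have [d /= d0 Hd] := near_le; exists d => // y cy ycd.
  by apply: Hd => //=; rewrite distrC gtr0_norm ?subr_gt0//; lra.
move=> [d d0 Hd]; pose z := Num.min b (c + d / 2).
have cz : c < z by rewrite lt_min cb' ltrDl divr_gt0.
have zb : z <= b by rewrite ge_min lexx.
have zd : z <= c + d / 2 by rewrite ge_min lexx orbT.
suff Sz : S z.
  have : z <= c by apply: ub_le_sup => //; exists b.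
  by rewrite leNgt cz.
split; first by rewrite in_itv/= (le_trans ac (ltW cz)) zb.
move=> y ay yz; have [yc|cy] := leP y c; first exact: Sc.2.
by apply: le_trans wc; apply: Hd => //; lra.
Unshelve. all: by end_near. Qed.

End absolutely_continuous_ftc.

(** * Derivatives of composites *)

Section pointwise_lipschitz.
Context {R : realType}.
Implicit Types (f g h : R -> R) (x K d : R).

(** A bound for the upper limit of [|f y - f x| / |y - x|] as [y] tends to [x]. Unlike a bound on
    the derivative it makes sense at every point, also where [h] has no derivative of top order. *)
Definition plip f x K := forall e : R, 0 < e ->
  \forall y \near x, `|f y - f x| <= (K + e) * `|y - x|.

Lemma plip_le f x K K' : K <= K' -> plip f x K -> plip f x K'.
Proof.
move=> KK H e e0; apply: filterS (H e e0) => y /le_trans; apply.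
by rewrite ler_wpM2r// lerD2r.
Qed.

Lemma plip_continuous f x K : 0 <= K -> plip f x K -> {for x, continuous f}.
Proof.
move=> K0 H; apply/cvgrPdist_le => e e0.
have K1 : 0 < K + 1 by lra.
near=> y.
have h : `|f y - f x| <= (K + 1) * `|y - x| by near: y; exact: H.
rewrite distrC (le_trans h)// mulrC -ler_pdivlMr// distrC.
by near: y; apply: cvgr_dist_le => //; rewrite divr_gt0.
Unshelve. all: by end_near. Qed.

Lemma is_derive_near f x d : is_derive x 1 f d -> forall e : R, 0 < e ->
  \forall y \near x, `|f y - f x - d * (y - x)| <= e * `|y - x|.
Proof.
move=> [df dE] e e0.
have : (fun k : R => k^-1 *: (f (k + x) - f x)) @ 0^' --> d.
  rewrite -dE; move: df => /cvg_ex[l]; rewrite /derive => dl.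
  have -> : (fun k : R => k^-1 *: (f (k + x) - f x)) = (fun k : R => k^-1 *: ((f \o shift x) (k *: 1) - f x)).
    by apply/funext => k /=; rewrite scaler1.
  by move: dl => /[dup] dl0 /(cvg_lim (@Rhausdorff R)) ->.
move=> /cvgrPdist_le /(_ e e0) [r /= r0 Hr].
exists r => //= y yr; have [->|yx] := eqVneq y x.
  by rewrite !subrr mulr0 subrr normr0 mulr0.
have yx0 : y - x != 0 by rewrite subr_eq0.
have := Hr (y - x); rewrite /= sub0r normrN distrC => /(_ yr yx0).
rewrite subrK -(ler_pM2r (_ : 0 < `|y - x|)) ?normr_gt0// -normrM distrC.
apply: le_trans; rewrite -normrN le_eqVlt; apply/orP; left; apply/eqP; congr `|_|.
by rewrite /GRing.scale/=; field.
Qed.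

Lemma plip_derive f x d : is_derive x 1 f d -> plip f x `|d|.
Proof.
move=> df e e0; apply: filterS (is_derive_near df e0) => y H.
rewrite mulrDl -normrM -[f y - f x](subrK (d * (y - x))).
by rewrite (le_trans (ler_normD _ _))// addrC lerD2l.
Qed.

Lemma derive_le_plip f x d K : is_derive x 1 f d -> plip f x K -> `|d| <= K.
Proof.
move=> df pf; apply/ler_addgt0Pr => e e0.
have e20 : 0 < e / 2 by rewrite divr_gt0.
near x^'+ => y.
have xy : x < y by near: y; exact: nbhs_right_gt.
have yx0 : 0 < `|y - x| by rewrite normr_gt0 subr_eq0 gt_eqF.
rewrite -(ler_pM2r yx0) -normrM.
have h1 : `|f y - f x - d * (y - x)| <= e / 2 * `|y - x|.
  by near: y; apply: cvg_at_right_filter (is_derive_near df e20); exact: cvg_id.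
have h2 : `|f y - f x| <= (K + e / 2) * `|y - x|.
  by near: y; apply: cvg_at_right_filter (pf _ e20); exact: cvg_id.
have := ler_normB (f y - f x) (f y - f x - d * (y - x)).
by rewrite opprB addrC subrK => h; lra.
Unshelve. all: by end_near. Qed.

Lemma plipD f g x K L : plip f x K -> plip g x L -> plip (fun y => f y + g y) x (K + L).
Proof.
move=> pf pg e e0; have e20 : 0 < e / 2 by rewrite divr_gt0.
apply: filterS2 (pf _ e20) (pg _ e20) => y h1 h2.
rewrite (_ : _ - _ = (f y - f x) + (g y - g x)); last by ring.
by rewrite (le_trans (ler_normD _ _))//; lra.
Qed.

Lemma plip_sum n (F : 'I_n -> R -> R) x (K : 'I_n -> R) :
  (forall i, plip (F i) x (K i)) -> plip (fun y => \sum_(i < n) F i y) x (\sum_(i < n) K i).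
Proof.
elim: n F K => [|n ih] F K H.
  move=> e e0; near=> y; rewrite !big_ord0 subrr normr0 add0r.
  by rewrite mulr_ge0// ltW.
rewrite big_ord_recr /=.
rewrite (_ : (fun _ => _) = (fun y => \sum_(i < n) F (widen_ord (leqnSn n) i) y + F ord_max y)).
  by apply: plipD; [exact: ih|exact: H].
by apply/funext => y; rewrite big_ord_recr.
Unshelve. all: by end_near. Qed.

Lemma plipM f g x K L : 0 <= K -> 0 <= L -> plip f x K -> plip g x L ->
  plip (fun y => f y * g y) x (K * `|g x| + `|f x| * L).
Proof.
move=> K0 L0 pf pg e e0.
have cg := plip_continuous L0 pg.
pose c := K + 1 + `|g x| + `|f x|.
have c0 : 0 < c.
  by rewrite /c -addrA; have := normr_ge0 (g x); have := normr_ge0 (f x); lra.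
(* The condition [d <= 1] absorbs the quadratic error [d ^ 2], and [2 * c] bounds the total
   coefficient of [d] that appears below. *)
pose d := Num.min 1 (e / (2 * c)).
have d0 : 0 < d by rewrite lt_min ltr01 divr_gt0// mulr_gt0.
have d1 : d <= 1 by rewrite ge_min lexx.
have dc : d * (2 * c) <= e by rewrite -ler_pdivlMr ?mulr_gt0// ge_min lexx orbT.
near=> y.
have h1 : `|f y - f x| <= (K + d) * `|y - x| by near: y; exact: pf.
have h2 : `|g y - g x| <= (L + d) * `|y - x| by near: y; exact: pg.
have h3 : `|g y - g x| <= d.
  by rewrite distrC; near: y; apply: cvgr_dist_le.
rewrite (_ : _ - _ = (f y - f x) * g y + f x * (g y - g x)); last by ring.
rewrite (le_trans (ler_normD _ _))// !normrM.
have gy : `|g y| <= `|g x| + d.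
  by rewrite -(subrK (g x) (g y)) (le_trans (ler_normD _ _))// addrC lerD2l.
have Y0 := normr_ge0 (y - x).
apply: (@le_trans _ _ ((K + d) * `|y - x| * (`|g x| + d) + `|f x| * ((L + d) * `|y - x|))).
  by apply: lerD; [apply: ler_pM|apply: ler_wpM2l].
rewrite [leLHS](_ : _ = ((K + d) * (`|g x| + d) + `|f x| * (L + d)) * `|y - x|); last by ring.
rewrite ler_wpM2r// [leLHS](_ : _ = K * `|g x| + `|f x| * L + d * (K + d + `|g x| + `|f x|)); last by ring.
rewrite lerD2l (le_trans _ dc)// ler_wpM2l ?ltW// /c.
by have := normr_ge0 (g x); have := normr_ge0 (f x); lra.
Unshelve. all: by end_near. Qed.

Lemma plip_comp h g x K L : 0 <= L -> (forall u v, `|h u - h v| <= L * `|u - v|) ->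
  plip g x K -> plip (h \o g) x (L * K).
Proof.
move=> L0 hL pg e e0.
have L1 : 0 < L + 1 by lra.
have eL : 0 < e / (L + 1) by rewrite divr_gt0.
apply: filterS (pg _ eL) => y H /=; apply: (le_trans (hL _ _)).
apply: (le_trans (ler_wpM2l L0 H)); rewrite mulrA ler_wpM2r// mulrDr lerD2l.
by rewrite mulrA ler_pdivrMr// mulrC ler_wpM2l ?ltW//; lra.
Qed.

(** Real induction replaces the mean value theorem: after subtraction of a linear function of slope
    [K + d], slightly above [K], both [f] and [- f] decrease locally to the right. The slack
    satisfies [d * (b - a) <= e]. *)
Lemma plip_lipschitz f K a b : 0 <= K -> a <= b ->
  (forall x, a <= x -> x <= b -> plip f x K) -> `|f b - f a| <= K * (b - a).
Proof.
move=> K0 ab H; apply/ler_addgt0Pr => e e0.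
pose d := e / (b - a + 1).
have ba1 : 0 < b - a + 1 by lra.
have d0 : 0 < d by rewrite divr_gt0.
have de : d * (b - a) <= e by rewrite /d mulrAC ler_pdivrMr// ler_wpM2l ?ltW//; lra.
have cf : {within `[a, b], continuous f}.
  apply: continuous_in_subspaceT => x; rewrite inE/= in_itv/= => /andP[ax xb].
  exact: plip_continuous (H x ax xb).
have cl : {within `[a, b], continuous (fun y : R => (K + d) * y)}.
  apply: continuous_subspaceT => y.
  by apply: cvgM; [exact: cvg_cst|exact: cvg_id].
have main s : `|s| = 1 -> s * f b - (K + d) * b <= s * f a - (K + d) * a.
  move=> s1; apply: (@local_right_decrease _ (fun y => s * f y - (K + d) * y)) => //.
    move=> y; apply: cvgB; last exact: cl.
    by apply: cvgM; [exact: cvg_cst|exact: cf].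
  move=> x ax xb _; near=> y.
  have xy : x < y by near: y; exact: nbhs_right_gt.
  have h : `|f y - f x| <= (K + d) * `|y - x|.
    near: y; apply: cvg_at_right_filter (H x ax (ltW xb) _ d0); exact: cvg_id.
  have := ler_norm (s * (f y - f x)); rewrite normrM s1 mul1r.
  by move: h; rewrite [`|y - x|]ger0_norm ?subr_ge0 ?(ltW xy)//; lra.
have := main 1 (normr1 _); have := main (-1); rewrite normrN normr1 => /(_ erefl).
by rewrite ler_norml => h1 h2; apply/andP; split; lra.
Unshelve. all: by end_near. Qed.

End pointwise_lipschitz.

(** The Leibniz rule for a monomial given by the orders of its factors: one summand per factor, in
    which that order is raised by one. *)
Fixpoint incr_one (l : seq nat) : seq (seq nat) :=
  if l is i :: l' then (i.+1 :: l') :: map (cons i) (incr_one l') else [::].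

(* The monomials of the partial Bell polynomial B_(k,j), counted with
   multiplicity; a monomial lists the orders of the derivatives of its factors. *)
Fixpoint bell (k j : nat) : seq (seq nat) :=
  match k with
  | 0 => if j is 0 then [:: [::]] else [::]
  | k'.+1 => flatten (map incr_one (bell k' j)) ++
             (if j is j'.+1 then map (cons 1%N) (bell k' j') else [::])
  end.

Lemma size_incr_one l : size (incr_one l) = size l.
Proof. by elim: l => [|i l ih] //=; rewrite size_map ih. Qed.

Lemma incr_oneP l l' : l' \in incr_one l ->
  size l' = size l /\ sumn l' = (sumn l).+1.
Proof.
elim: l l' => [|i l ih] l' //=; rewrite inE => /predU1P[->|/mapP[l'' /ih[s1 s2] ->]] //=.
by rewrite s1 s2 addnS.
Qed.

Lemma incr_one_gt0 l l' : l' \in incr_one l -> all (leq 1) l -> all (leq 1) l'.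
Proof.
elim: l l' => [|i l ih] l' //=; rewrite inE => /predU1P[->|/mapP[l'' /ih h ->]] /= /andP[i0 l0].
  by rewrite l0.
by rewrite i0 h.
Qed.

Lemma bellP k j l : l \in bell k j -> [/\ size l = j, sumn l = k & all (leq 1) l].
Proof.
elim: k j l => [|k ih] [|j] l //=; first by rewrite inE => /eqP ->.
- rewrite cats0 => /flattenP[s /mapP[l' /ih[h1 h2 h3] ->] ll].
  have [s1 s2] := incr_oneP ll; split; [by rewrite s1|by rewrite s2 h2|].
  exact: incr_one_gt0 h3.
- rewrite mem_cat => /orP[/flattenP[s /mapP[l' /ih[h1 h2 h3] ->] ll]|/mapP[l' /ih[h1 h2 h3] ->]].
    have [s1 s2] := incr_oneP ll; split; [by rewrite s1|by rewrite s2 h2|].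
    exact: incr_one_gt0 h3.
  by split => //=; rewrite ?h1 ?h2.
Qed.

Lemma size_flatten_incr_one k j :
  size (flatten (map incr_one (bell k j))) = (j * size (bell k j))%N.
Proof.
rewrite size_flatten /shape -map_comp sumnE big_map big_seq.
under eq_bigr => l /bellP[li _ _] do rewrite /= size_incr_one li.
by rewrite -big_seq big_const_seq count_predT iter_addn_0 mulnC.
Qed.

(** Both sides obey the same recurrence: a monomial of B_(k,j) has [j] factors and so [j] summands
    in its derivative, and differentiating the outer function adds one factor of order 1. *)
Lemma size_bell k j : size (bell k j) = stirling2 k j.
Proof.
elim: k j => [|k ih] [|j] //=; rewrite size_cat size_flatten_incr_one ih.
  by rewrite mul0n.
by rewrite size_map ih.
Qed.

Lemma stirling2_small k j : (k < j)%N -> stirling2 k j = 0%N.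
Proof.
elim: k j => [|k ih] [|j] //= kj.
by rewrite !ih ?muln0// (ltn_trans _ kj).
Qed.

Section faa_di_bruno.
Context {R : realType}.
Variables (m : nat) (hd gd : nat -> R -> R) (L : nat -> R).
Hypothesis m0 : (0 < m)%N.
Hypothesis hd_derive : forall j y, (j.+1 < m)%N -> is_derive y (1 : R) (hd j) (hd j.+1 y).
Hypothesis gd_derive : forall i y, (i < m)%N -> is_derive y (1 : R) (gd i) (gd i.+1 y).
Hypothesis L0 : forall j, 0 <= L j.
Hypothesis hd_lipschitz : forall j u v, (j < m)%N -> `|hd j u - hd j v| <= L j.+1 * `|u - v|.
Hypothesis hd_bound : forall j u, (0 < j < m)%N -> `|hd j u| <= L j.

Definition monomial (l : seq nat) x := \prod_(i <- l) gd i x.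

Definition bell_fun (s : seq (seq nat)) x := \sum_(l <- s) monomial l x.

(** Faa di Bruno's formula for the derivative of order [k] of [hd 0 \o gd 0], the outer and inner
    derivatives being kept as abstract families. *)
Definition comp_derive k x := \sum_(j < k.+1) hd j (gd 0 x) * bell_fun (bell k j) x.

Lemma monomial_derive l x : all (fun i => (i < m)%N) l ->
  is_derive x (1 : R) (monomial l) (bell_fun (incr_one l) x).
Proof.
rewrite /bell_fun; elim: l => [|i l ih] /=.
  move=> _; rewrite big_nil (_ : monomial _ = cst 1); first exact: is_derive_cst.
  by apply/funext => y; rewrite /monomial big_nil.
move=> /andP[im lm]; rewrite big_cons big_map.
rewrite (_ : monomial _ = gd i \* monomial l); last first.
  by apply/funext => y; rewrite /monomial big_cons.
have h1 := gd_derive x im; have h2 := ih lm.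
apply: is_derive_eq; rewrite /GRing.scale/= addrC /monomial big_cons; congr (_ + _).
  by rewrite mulrC.
by rewrite big_distrr/=; apply: eq_bigr => l' _; rewrite big_cons.
Qed.

Lemma bell_fun_derive s x : all (all (fun i => (i < m)%N)) s ->
  is_derive x (1 : R) (bell_fun s) (bell_fun (flatten (map incr_one s)) x).
Proof.
rewrite /bell_fun; elim: s => [|l s ih] /=.
  move=> _; rewrite big_nil (_ : (fun _ => _) = cst 0); first exact: is_derive_cst.
  by apply/funext => y; rewrite big_nil.
move=> /andP[lm sm]; rewrite big_cat/=.
rewrite (_ : (fun _ => _) = monomial l \+ (fun y => \sum_(l0 <- s) monomial l0 y)); last first.
  by apply/funext => y; rewrite big_cons.
by have h1 := monomial_derive x lm; have h2 := ih sm; exact: is_deriveD.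
Qed.

Lemma bell_lt k j : (k < m)%N -> all (all (fun i => (i < m)%N)) (bell k j).
Proof.
move=> km; apply/allP => l /bellP[_ lk _]; apply/allP => i il.
apply: leq_ltn_trans km; rewrite -lk; elim: l il {lk} => //= a l ih.
rewrite inE => /predU1P[->|/ih]; first exact: leq_addr.
by move=> h; exact: leq_trans (leq_addl _ _).
Qed.

Lemma bell_funS k j x : bell_fun (bell k.+1 j) x =
  bell_fun (flatten (map incr_one (bell k j))) x +
  (if j is j'.+1 then gd 1 x * bell_fun (bell k j') x else 0).
Proof.
rewrite /bell_fun /= big_cat/=; congr (_ + _); case: j => [|j]; first by rewrite big_nil.
rewrite big_map big_distrr/=; apply: eq_bigr => l _.
by rewrite /monomial big_cons.
Qed.

Lemma comp_derive_is_derive k x : (k.+1 < m)%N ->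
  is_derive x (1 : R) (comp_derive k) (comp_derive k.+1 x).
Proof.
move=> km; pose D (j : 'I_k.+1) := hd j.+1 (gd 0 x) * gd 1 x * bell_fun (bell k j) x +
  hd j (gd 0 x) * bell_fun (flatten (map incr_one (bell k j))) x.
have -> : comp_derive k.+1 x = \sum_j D j.
  rewrite /comp_derive /D big_split/= addrC.
  under eq_bigr do rewrite bell_funS mulrDr.
  rewrite big_split/=; congr (_ + _).
    (* There are no monomials in B_(k,k+1), so the term of index k + 1 in the Leibniz part
       vanishes. *)
    rewrite big_ord_recr/= [X in _ + X](_ : _ = 0) ?addr0//.
    rewrite (_ : bell k k.+1 = [::]); first by rewrite /bell_fun big_nil mulr0.
    by apply/nilP; rewrite /nilp size_bell stirling2_small.
  rewrite big_ord_recl mulr0 add0r; apply: eq_bigr => j _ /=.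
  by rewrite /bump/= add1n mulrA.
rewrite (_ : comp_derive k = \sum_(j < k.+1) (fun y => hd j (gd 0 y) * bell_fun (bell k j) y)); last first.
  by apply/funext => y; rewrite fct_sumE.
apply: is_derive_sum => j.
have jm : (j.+1 < m)%N by apply: leq_ltn_trans km; exact: ltn_ord.
have h0 := hd_derive (gd 0 x) jm; have h1 := gd_derive x m0.
have h2 : is_derive x (1 : R) (hd j \o gd 0) (hd j.+1 (gd 0 x) * gd 1 x) by exact: is_derive1_comp.
have h3 := bell_fun_derive x (bell_lt j (ltn_trans (ltnSn k) km)).
rewrite (_ : (fun _ => _) = (hd j \o gd 0) \* bell_fun (bell k j))//.
apply: is_derive_eq; rewrite /D /GRing.scale/= addrC; congr (_ + _).
by rewrite mulrC.
Qed.

Lemma comp_derive_derivable x : derivable (hd m.-1) (gd 0 x) 1 ->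
  derivable (comp_derive m.-1) x 1.
Proof.
move=> hm; rewrite (_ : comp_derive _ = \sum_(j < m.-1.+1) ((hd j \o gd 0) \* bell_fun (bell m.-1 j))); last first.
  by apply/funext => y; rewrite fct_sumE.
apply: derivable_sum => j.
have mm : (m.-1 < m)%N by rewrite prednK.
have h3 := bell_fun_derive x (bell_lt j mm).
have h1 := gd_derive x m0.
(* Only the outer factor of index [m.-1] relies on the hypothesis at [gd 0 x]; the others are
   differentiable everywhere. *)
have [d h0] : exists d, is_derive (gd 0 x) (1 : R) (hd j) d.
  have [jm|jm] := ltnP j.+1 m; first by exists (hd j.+1 (gd 0 x)); exact: hd_derive.
  have -> : (j : nat) = m.-1.
    have := ltn_ord j; rewrite ltnS; move: (j : nat) jm => i mi im.
    by apply/eqP; rewrite eqn_leq im -subn1 leq_subLR add1n.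
  by exists ('D_1 (hd m.-1) (gd 0 x)); exact: derivableP.
by have h2 := is_derive1_comp h0 h1; have [] := is_deriveM h2 h3.
Qed.

Variables (x t : R).
Hypothesis t0 : 0 <= t.
Hypothesis gd_bound : forall i, (1 <= i <= m)%N -> `|gd i x| <= t ^+ i.

(** Homogeneity: the orders in each monomial add up to [k], so the bounds [t ^+ i] on the factors
    multiply to [t ^+ k]. *)
Lemma bell_fun_bound k (s : seq (seq nat)) : (k <= m)%N ->
  (forall l, l \in s -> sumn l = k /\ all (leq 1) l) ->
  `|bell_fun s x| <= (size s)%:R * t ^+ k.
Proof.
move=> km H; rewrite /bell_fun; apply: (le_trans (ler_norm_sum _ _ _)).
apply: (@le_trans _ _ (\sum_(l <- s) t ^+ k)); last first.
  by rewrite big_const_seq count_predT iter_addr addr0 mulr_natl.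
rewrite big_seq [leRHS]big_seq; apply: ler_sum => l /H[lk l1].
rewrite /monomial -lk; move: km; rewrite -lk {lk H}.
elim: l l1 => [|i l ih] /=; first by rewrite big_nil normr1 expr0.
move=> /andP[i1 l1] il; rewrite big_cons normrM exprD ler_pM//.
  by apply: gd_bound; rewrite i1 (leq_trans _ il)// leq_addr.
by apply: ih => //; rewrite (leq_trans _ il)// leq_addl.
Qed.

Lemma comp_derive_bound k : (0 < k < m)%N ->
  `|comp_derive k x| <= \sum_(j < k.+1) L j * (stirling2 k j)%:R * t ^+ k.
Proof.
move=> /andP[k0 km]; apply: le_trans (ler_norm_sum _ _ _) _; apply: ler_sum => j _.
have bB : `|bell_fun (bell k j) x| <= (stirling2 k j)%:R * t ^+ k.
  by rewrite -size_bell; apply: bell_fun_bound; [exact: ltnW|move=> l /bellP[]].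
(* For [j = 0] no bound on [hd 0] is available, but as [k > 0] the Stirling number is 0 and the Bell
   sum vanishes. *)
rewrite normrM -mulrA; have [j0|j0] := posnP j.
  move: bB; rewrite j0; case: k k0 {km} j j0 => // k _ j j0.
  have -> : stirling2 k.+1 0 = 0%N by [].
  by rewrite mulr0n mul0r normr_le0 => /eqP ->; rewrite normr0 !mulr0.
apply: ler_pM => //; apply: hd_bound; rewrite j0 /=.
by apply: leq_ltn_trans km; rewrite -ltnS.
Qed.

(** The outer function of index [m.-1] is only Lipschitz, so the product and chain rules are used
    for pointwise Lipschitz constants. With [k = m.-1] the terms regroup by S(m, j+1) = S(k, j) +
    (j+1) S(k, j+1). *)
Lemma comp_derive_plip : plip (comp_derive m.-1) x
  (\sum_(1 <= k < m.+1) (stirling2 m k)%:R * L k * t ^+ m).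
Proof.
set k := m.-1; have km : k.+1 = m by rewrite prednK.
pose B' j := bell_fun (flatten (map incr_one (bell k j))) x.
have pB j : plip (bell_fun (bell k j)) x `|B' j|.
  by apply: plip_derive; apply: bell_fun_derive; apply: bell_lt; rewrite -km.
have pg : plip (gd 0) x `|gd 1 x| by apply: plip_derive; exact: gd_derive.
have pT (j : 'I_k.+1) : plip (fun y => hd j (gd 0 y) * bell_fun (bell k j) y) x
    (L j.+1 * `|gd 1 x| * `|bell_fun (bell k j) x| + `|hd j (gd 0 x)| * `|B' j|).
  apply: plipM (pB j) => //; first by rewrite mulr_ge0.
  by apply: (plip_comp (h := hd j)) => // u v; apply: hd_lipschitz; rewrite -km ltn_ord.
apply: plip_le (plip_sum pT).
have bB j : `|bell_fun (bell k j) x| <= (stirling2 k j)%:R * t ^+ k.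
  rewrite -size_bell; apply: bell_fun_bound; first by rewrite -km.
  by move=> l /bellP[].
have bB' j : `|B' j| <= (j * stirling2 k j)%:R * t ^+ m.
  rewrite -size_bell -size_flatten_incr_one.
  apply: bell_fun_bound => // l /flattenP[s /mapP[l' /bellP[h1 h2 h3] ->] ll].
  have [_ ->] := incr_oneP ll; rewrite h2; split => //.
  exact: incr_one_gt0 h3.
apply: (@le_trans _ _ (\sum_(j < k.+1) (L j.+1 * (stirling2 k j)%:R * t ^+ m) +
    \sum_(j < k.+1) (L j * (j * stirling2 k j)%:R * t ^+ m))).
  rewrite big_split/=; apply: lerD; apply: ler_sum => j _.
    rewrite -!mulrA ler_wpM2l// (_ : t ^+ m = t * t ^+ k) 1?mulrCA; last by rewrite -exprS km.
    apply: ler_pM => //.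
    by rewrite -[leRHS]expr1; apply: gd_bound; rewrite -km.
  case: j => -[|j] jk /=; first by have := bB' 0%N; rewrite mul0n !mul0r !mulr0 mul0r normr_le0 => /eqP ->; rewrite normr0 mulr0.
  rewrite -mulrA ler_pM// hd_bound//= -km //.
rewrite -big_split/= big_add1/= big_mkord -km.
rewrite [X in _ <= X](_ : _ = \sum_(j < k.+1) (L j.+1 * (stirling2 k j)%:R * t ^+ k.+1) +
   \sum_(j < k.+1) (L j.+1 * (j.+1 * stirling2 k j.+1)%:R * t ^+ k.+1)); last first.
  rewrite -big_split/=; apply: eq_bigr => j _.
  by rewrite natrD; ring.
rewrite big_split/= lerD2l big_ord_recl/= mul0n mulr0 mul0r add0r.
rewrite [leRHS]big_ord_recr/= stirling2_small// muln0 mulr0 mul0r addr0.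
by apply: ler_sum => j _; rewrite /bump add1n.
Qed.

End faa_di_bruno.

(** * Locally Lipschitz functions *)

Section local_lipschitz.
Context {R : realType}.
Implicit Types (f g : R -> R) (a b : R).
Notation mu := (@lebesgue_measure R).

Definition llip f := forall a b, a <= b -> exists L : R, forall x y,
  a <= x -> x <= y -> y <= b -> `|f y - f x| <= L * (y - x).

Lemma llip_ge0 f : llip f -> forall a b, a <= b -> exists2 L : R, 0 <= L &
  forall x y, a <= x -> x <= b -> a <= y -> y <= b -> `|f y - f x| <= L * `|y - x|.
Proof.
move=> H a b ab; have [L HL] := H a b ab.
exists `|L| => // x y ax xb ay yb.
wlog xy : x y ax xb ay yb / x <= y.
  move=> W; have [xy|/ltW yx] := leP x y; first exact: W.
  by rewrite distrC [`|y - x|]distrC; exact: W.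
rewrite [`|y - x|]ger0_norm ?subr_ge0// (le_trans (HL _ _ ax xy yb))//.
by rewrite ler_wpM2r ?subr_ge0// ler_norm.
Qed.

Lemma llip_bounded f : llip f -> forall a b, a <= b -> exists2 M : R, 0 <= M &
  forall x, a <= x -> x <= b -> `|f x| <= M.
Proof.
move=> H a b ab; have [L L0 HL] := llip_ge0 H ab.
exists (`|f a| + L * (b - a)); first by rewrite addr_ge0// mulr_ge0// subr_ge0.
move=> x ax xb; rewrite -[f x](subrK (f a)) (le_trans (ler_normD _ _))// addrC lerD2l.
rewrite (le_trans (HL a x _ _ _ _))// ler_wpM2l// ger0_norm ?subr_ge0// lerD2r//.
Qed.

Lemma llip_continuous f : llip f -> continuous f.
Proof.
move=> H x; have x1 : x - 1 <= x + 1 by lra.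
have [L L0 HL] := llip_ge0 H x1.
apply: (@plip_continuous _ _ _ L) => // e e0; near=> y.
have : `|x - y| < 1 by near: y; apply: cvgr_dist_lt.
rewrite ltr_norml => /andP[h1 h2].
by rewrite (le_trans (HL x y _ _ _ _)) ?ler_wpM2r//; lra.
Unshelve. all: by end_near. Qed.

Lemma llip_ac f : llip f -> abs_continuous f.
Proof. exact: lipschitz_abs_continuous. Qed.

Lemma llipD f g : llip f -> llip g -> llip (f \+ g).
Proof.
move=> Hf Hg a b ab; have [L HL] := Hf a b ab; have [M HM] := Hg a b ab.
exists (L + M) => x y ax xy yb /=.
rewrite (_ : _ - _ = (f y - f x) + (g y - g x)); last by ring.
by rewrite (le_trans (ler_normD _ _))// mulrDl lerD ?HL ?HM.
Qed.

Lemma llipM f g : llip f -> llip g -> llip (f \* g).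
Proof.
move=> Hf Hg a b ab; have [L L0 HL] := llip_ge0 Hf ab; have [M M0 HM] := llip_ge0 Hg ab.
have [F F0 HF] := llip_bounded Hf ab; have [G G0 HG] := llip_bounded Hg ab.
exists (L * G + F * M) => x y ax xy yb /=.
have xb := le_trans xy yb; have ay := le_trans ax xy.
rewrite (_ : _ - _ = (f y - f x) * g y + f x * (g y - g x)); last by ring.
rewrite (le_trans (ler_normD _ _))// !normrM mulrDl -(ger0_norm (_ : 0 <= y - x)) ?subr_ge0//.
rewrite [L * G * _]mulrAC -[F * M * _]mulrA.
by apply: lerD; apply: ler_pM => //; [exact: HL|exact: HG|exact: HF|exact: HM].
Qed.

Lemma llip_cst (c : R) : llip (cst c).
Proof. by move=> a b ab; exists 0 => x y *; rewrite /= subrr normr0 mul0r. Qed.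

Lemma llip_affine f (c s : R) : 0 < s -> llip f -> llip (fun z => f (c + s * z)).
Proof.
move=> s0 H a b ab.
have ab' : c + s * a <= c + s * b by rewrite lerD2l ler_pM2l.
have [L HL] := H _ _ ab'; exists (L * s) => x y ax xy yb.
rewrite (le_trans (HL _ _ _ _ _))// ?lerD2l ?ler_pM2l//.
by rewrite le_eqVlt; apply/orP; left; apply/eqP; ring.
Qed.

Lemma llip_id : llip (@idfun R).
Proof.
by move=> a b ab; exists 1 => x y ax xy yb /=; rewrite mul1r ger0_norm ?subr_ge0.
Qed.

Lemma continuous_llip f (df : R -> R) : (forall x, is_derive x (1 : R) f (df x)) ->
  continuous df -> llip f.
Proof.
move=> H cdf a b ab.
have [|c _ HM] := @EVT_max _ (fun x => `|df x|) a b ab.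
  by apply: continuous_subspaceT => x; apply: continuous_comp; [exact: cdf|exact: norm_continuous].
exists `|df c| => x y ax xy yb; apply: plip_lipschitz => //.
move=> z xz zy; apply: plip_le (plip_derive (H z)).
by apply: HM; rewrite in_itv/= (le_trans ax xz) (le_trans zy yb).
Qed.

Lemma is_derive_continuous f (df : R -> R) : (forall x, is_derive x (1 : R) f (df x)) ->
  continuous f.
Proof.
by move=> H x; apply: differentiable_continuous; apply/derivable1_diffP; have [] := H x.
Qed.

(** [eta] is the upper limit of the difference quotients of increment [1 / (n + 1)], truncated to
    [[- Q, Q]]. The upper limit is measurable and equals the derivative where that exists; the
    truncation gives the bound everywhere and leaves existing derivatives unchanged. *)
Lemma llip_measurable_derivative f (Q : R -> R) : llip f ->
  measurable_fun setT Q -> (forall x, 0 <= Q x) ->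
  (forall x d, is_derive x (1 : R) f d -> `|d| <= Q x) ->
  exists eta : R -> R, [/\ measurable_fun setT eta, forall x, `|eta x| <= Q x &
    {ae mu, forall x, is_derive x (1 : R) f (eta x)}].
Proof.
move=> lf mQ Q0 fQ.
pose q n x : R := n.+1%:R * (f (x + n.+1%:R^-1) - f x).
have qb x : bounded_fun (fun n => q n x).
  have x1 : x <= x + 1 by lra.
  have [L L0 HL] := llip_ge0 lf x1.
  exists L; split; first exact: num_real.
  move=> L' LL' n _; apply: le_trans (ltW LL').
  have n0 : (0 : R) < n.+1%:R by rewrite ltr0n.
  have n1 : n.+1%:R^-1 <= 1 :> R by rewrite invf_le1// ler1n.
  have ni : (0 : R) <= n.+1%:R^-1 by rewrite invr_ge0.
  rewrite /q normrM gtr0_norm// mulrC -ler_pdivlMr// (le_trans (HL _ _ _ _ _ _)) ?lerDl ?lerD2l//.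
  by rewrite addrAC subrr add0r ger0_norm.
pose e0 x := limn_sup (fun n => q n x).
have me0 : measurable_fun setT e0.
  apply: measurable_fun_limn_sup.
  - by move=> x _; exact: bounded_fun_has_ubound.
  - by move=> x _; exact: bounded_fun_has_lbound.
  - move=> n; apply: measurable_funM => //; apply: measurable_funB; last first.
      exact: continuous_measurable_fun (llip_continuous lf).
    apply: continuous_measurable_fun => /= x.
    rewrite /continuous_at /=.
    apply: (@continuous_comp _ _ _ (fun x : R => x + n.+1%:R^-1) f).
      by apply: cvgD; [exact: cvg_id|exact: cvg_cst].
    exact: llip_continuous.
exists (fun x => Num.max (- Q x) (Num.min (Q x) (e0 x))); split.
- apply: measurable_maxr; first exact: measurableT_comp.
  exact: measurable_minr.
- move=> x; rewrite ler_norml le_max lexx/= ge_max ge_min lexx andbT /=.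
  by have := Q0 x; lra.
- have := abs_continuous_ae_derivable (llip_ac lf).
  apply: (@filterS _ _ (ae_filter_ringOfSetsType mu)) => /= x dfx.
  move: (x : R) dfx => {}x dfx.
  have [d dd] : exists d, is_derive (x : R) (1 : R) f d.
    by exists ('D_1 f x); exact: derivableP.
  suff -> : e0 x = d.
    have := fQ _ _ dd; rewrite ler_norml => /andP[d1 d2].
    by rewrite min_r// max_r.
  rewrite /e0; suff qd : (fun n => q n x) @ \oo --> d.
    by rewrite cvg_limn_supE; [exact/cvg_lim|apply/cvg_ex; exists d].
  apply/cvgrPdist_le => e e0'.
  have [r /= r0 Hr] := is_derive_near dd e0'.
  near=> n.
  have n0 : (0 : R) < n.+1%:R by rewrite ltr0n.
  have hr : n.+1%:R^-1 < r by near: n; exact: near_infty_natSinv_lt (PosNum r0).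
  have h0 : (0 : R) < n.+1%:R^-1 by rewrite invr_gt0.
  rewrite /q -[n.+1%:R in X in `|X|]invrK; move: (n.+1%:R^-1) hr h0 => h hr h0.
  have := Hr (x + h); rewrite /= opprD addrA subrr add0r normrN (gtr0_norm h0).
  move=> /(_ hr); rewrite (_ : x + h - x = h); last by ring.
  rewrite (gtr0_norm h0) distrC => H; rewrite -(ler_pM2r h0); apply: le_trans H.
  rewrite -[X in _ * X <= _](gtr0_norm h0) -normrM invrK le_eqVlt.
  apply/orP; left; apply/eqP; congr `|_|.
  by rewrite mulrBl mulrAC mulVf ?mul1r// gt_eqF.
Unshelve. all: by end_near. Qed.

End local_lipschitz.

(** * The Gaussian measure and affine changes of variables *)

Section gaussian.
Context {R : realType}.
Implicit Types (f g : R -> R).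
Notation mu := (@lebesgue_measure R).
Notation N := (@normal_prob R 0 1).
Local Open Scope ereal_scope.

Definition gdens (x : R) : R := normal_pdf 0 1 x.

(** The normal density is a version of the Radon-Nikodym derivative of the Gaussian measure. *)
Lemma ge0_integral_gauss (f : R -> \bar R) : measurable_fun setT f ->
  (forall x, 0 <= f x) -> \int[N]_x f x = \int[mu]_x (f x * (gdens x)%:E).
Proof.
move=> mf f0.
rewrite -(@Radon_Nikodym_SigmaFinite.change_of_variables _ _ _ N mu (normal_prob_dominates 0 1) f setT)//.
apply: ae_eq_integral => //.
- apply: emeasurable_funM => //.
  by apply: measurable_int; apply: Radon_Nikodym_SigmaFinite.f_integrable; exact: normal_prob_dominates.
- apply: emeasurable_funM => //; apply/measurable_EFinP; exact: measurable_normal_pdf.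
- apply: ae_eqe_mul2l; apply: integral_ae_eq => //.
  + by apply: Radon_Nikodym_SigmaFinite.f_integrable; exact: normal_prob_dominates.
  + by apply/measurable_EFinP; exact: measurable_normal_pdf.
  + by move=> E _ mE; rewrite -Radon_Nikodym_SigmaFinite.f_integral//; exact: normal_prob_dominates.
Qed.

(** [s] times the image of Lebesgue measure under the affine map agrees with Lebesgue measure on
    half-open intervals, hence everywhere. *)
Lemma integral_affine (f : R -> \bar R) (c s : R) : (0 < s)%R -> measurable_fun setT f ->
  (forall x, 0 <= f x) -> \int[mu]_z f (c + s * z)%R = s^-1%:E * \int[mu]_y f y.
Proof.
move=> s0 mf f0.
pose aff : measurableTypeR R -> measurableTypeR R := (fun z : R => (c + s * z)%R).
have maff : measurable_fun [set: measurableTypeR R] aff.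
  by apply: measurable_funD => //; exact: measurable_funM.
pose nu := mscale (NngNum (ltW s0)) (pushforward mu aff).
have munu A : measurable A -> mu A = nu maff A.
  apply: lebesgue_measure_unique => _ [[a b] _ <-].
  change (mu `]a, b] = s%:E * mu (aff @^-1` `]a, b])).
  have -> : aff @^-1` `]a, b] = `]((a - c) / s)%R, ((b - c) / s)%R]%classic.
    apply/seteqP; split => z; rewrite /= !in_itv/= /aff.
      by rewrite ltr_pdivrMr// ler_pdivlMr// ltrBlDl lerBrDl mulrC.
    by rewrite ltr_pdivrMr// ler_pdivlMr// ltrBlDl lerBrDl mulrC.
  rewrite !lebesgue_measure_itv/= !lte_fin ltr_pM2r ?invr_gt0// ltrD2r.
  case: ifPn => ab; last by rewrite mule0.
  by rewrite -!EFinB -EFinM -mulrBl mulrC divfK ?gt_eqF// opprB addrA subrK.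
have -> : \int[mu]_y f y = \int[nu maff]_y f y.
  by apply: eq_measure_integral => A mA _; exact: munu.
rewrite /nu ge0_integral_mscale//= ge0_integral_pushforward//.
by rewrite preimage_setT muleA -EFinM mulVf ?gt_eqF// mul1e.
Qed.

(** Density of the law of [c + s * Z] with respect to that of [Z], so that an affine substitution
    becomes a change of weight. *)
Definition shift_density (c s y : R) : R :=
  (s^-1 * expR (y ^+ 2 / 2 - ((y - c) / s) ^+ 2 / 2))%R.

Lemma shift_density_ge0 c s y : (0 < s)%R -> (0 <= shift_density c s y)%R.
Proof. by move=> s0; rewrite mulr_ge0 ?expR_ge0// invr_ge0 ltW. Qed.

Lemma gdensE x : gdens x = (normal_peak 1 * expR (- (x ^+ 2 / 2)))%R.
Proof.
rewrite /gdens normal_pdfE ?oner_eq0// /normal_fun subr0 expr1n mulNr.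
by rewrite -mulr_natl mulr1.
Qed.

Lemma measurable_shift_density c s : measurable_fun setT (shift_density c s).
Proof.
apply: measurable_funM => //; apply: measurableT_comp => //.
apply: measurable_funB; apply: measurable_funM => //.
by apply: measurable_funX; apply: measurable_funM => //; exact: measurable_funB.
Qed.

Lemma ge0_integral_gauss_affine (f : R -> \bar R) (c s : R) : (0 < s)%R ->
  measurable_fun setT f -> (forall x, 0 <= f x) ->
  \int[N]_z f (c + s * z)%R = \int[N]_y (f y * (shift_density c s y)%:E).
Proof.
move=> s0 mf f0.
have maff : measurable_fun setT (fun z : R => (c + s * z)%R).
  by apply: measurable_funD => //; exact: measurable_funM.
have mg : measurable_fun setT (EFin \o gdens) by apply/measurable_EFinP; exact: measurable_normal_pdf.
have ms := measurable_shift_density c s.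
rewrite !ge0_integral_gauss//; last 3 first.
- by apply: emeasurable_funM => //; exact/measurable_EFinP.
- by move=> x; rewrite mule_ge0// lee_fin shift_density_ge0.
- exact: measurableT_comp.
pose h y := f y * (gdens ((y - c) / s)%R)%:E.
rewrite (_ : \int[mu]_x _ = \int[mu]_z h (c + s * z)%R); last first.
  apply: eq_integral => z _; rewrite /h; congr (_ * _%:E); congr gdens.
  by rewrite addrAC subrr add0r mulrC mulKf// gt_eqF.
rewrite integral_affine//; last 2 first.
- apply: emeasurable_funM => //; apply/measurable_EFinP.
  apply: measurableT_comp; first exact: measurable_normal_pdf.
  by apply: measurable_funM => //; exact: measurable_funB.
- by move=> x; rewrite mule_ge0// lee_fin normal_pdf_ge0.
rewrite -ge0_integralZl//; last 3 first.
- apply: emeasurable_funM => //; apply/measurable_EFinP.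
  apply: measurableT_comp; first exact: measurable_normal_pdf.
  by apply: measurable_funM => //; exact: measurable_funB.
- by move=> x _; rewrite mule_ge0// lee_fin normal_pdf_ge0.
- by rewrite lee_fin invr_ge0 ltW.
apply: eq_integral => y _; rewrite /h muleCA -!muleA -!EFinM; congr (_ * _%:E).
rewrite !gdensE /shift_density mulrCA -mulrA [RHS]mulrCA; congr (_ * _)%R.
rewrite -[RHS]mulrA -expRD; congr (_ * expR _)%R; ring.
Qed.

End gaussian.

(** * Gaussian expectations *)

Section gaussian_expectation.
Context {R : realType}.
Implicit Types (f g h : R -> R) (w rho sigma c : R).
Notation mu := (@lebesgue_measure R).
Notation N := (@normal_prob R 0 1).

Definition gint f := N.-integrable setT (EFin \o f).
Definition gE f := \int[N]_z f z.

Lemma gint_measurable f : gint f -> measurable_fun setT f.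
Proof. by move=> /integrableP[/measurable_EFinP]. Qed.

Lemma le_gint f g : measurable_fun setT f -> (forall z, `|f z| <= g z) -> gint g -> gint f.
Proof.
move=> mf fg; apply: le_integrable => //; first exact/measurable_EFinP.
by move=> z _ /=; rewrite lee_fin (le_trans (fg z))// ler_norm.
Qed.

Lemma gint_cst c : gint (cst c).
Proof. exact: finite_measure_integrable_cst. Qed.

Lemma gintD f g : gint f -> gint g -> gint (fun z => f z + g z).
Proof.
move=> hf hg; rewrite /gint (_ : EFin \o _ = (EFin \o f) \+ (EFin \o g))%E.
  exact: integrableD.
by apply/funext => z /=; rewrite EFinD.
Qed.

Lemma gintB f g : gint f -> gint g -> gint (fun z => f z - g z).
Proof.
move=> hf hg; rewrite /gint (_ : EFin \o _ = (EFin \o f) \- (EFin \o g))%E.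
  exact: integrableB.
by apply/funext => z /=; rewrite EFinB.
Qed.

Lemma gintZ c f : gint f -> gint (fun z => c * f z).
Proof.
move=> hf; rewrite /gint (_ : EFin \o _ = (fun z => c%:E * (EFin \o f) z))%E.
  exact: integrableZl.
by apply/funext => z /=; rewrite EFinM.
Qed.

Lemma gint_norm f : gint f -> gint (fun z => `|f z|).
Proof. by move=> hf; exact: integrable_norm. Qed.

Lemma gED f g : gint f -> gint g -> gE (fun z => f z + g z) = gE f + gE g.
Proof. by move=> hf hg; rewrite /gE RintegralD. Qed.

Lemma gEB f g : gint f -> gint g -> gE (fun z => f z - g z) = gE f - gE g.
Proof. by move=> hf hg; rewrite /gE RintegralB. Qed.

Lemma gEZ c f : gint f -> gE (fun z => c * f z) = c * gE f.
Proof. by move=> hf; rewrite /gE RintegralZl. Qed.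

Lemma gE_cst c : gE (cst c) = c.
Proof.
rewrite /gE Rintegral_cst// -[RHS]mulr1; congr (_ * _).
by transitivity (fine (1%:E : \bar R)) => //; congr fine; exact: (probability_setT N).
Qed.

Lemma le_gE f g : gint f -> gint g -> (forall z, f z <= g z) -> gE f <= gE g.
Proof. by move=> hf hg fg; rewrite /gE; apply: le_Rintegral. Qed.

Lemma gE_ge0 f : (forall z, 0 <= f z) -> 0 <= gE f.
Proof. by move=> f0; apply: Rintegral_ge0. Qed.

Lemma le_norm_gE f : gint f -> `|gE f| <= gE (fun z => `|f z|).
Proof. by move=> hf; apply: le_normr_Rintegral. Qed.

Lemma gE_EFin f : gint f -> (\int[N]_z (f z)%:E)%E = (gE f)%:E.
Proof. by move=> hf; rewrite /gE /Rintegral fineK//; exact: integrable_fin_num. Qed.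

(** Mehler's kernel: when [rho ^+ 2 + sigma ^+ 2 = 1] the exponent is [w ^+ 2 / 2] minus a
    nonnegative term, so the density is bounded in [y]. Integrability of [f] thus passes to its
    affine substitutes with no condition on growth. *)
Lemma shift_densityE w rho sigma y : 0 < sigma -> rho ^+ 2 + sigma ^+ 2 = 1 ->
  shift_density (rho * w) sigma y =
  sigma^-1 * (expR (w ^+ 2 / 2) * expR (- (((rho * y - w) / sigma) ^+ 2 / 2))).
Proof.
move=> s0 rs; rewrite /shift_density -expRD; congr (_ * expR _).
have s1 : sigma ^+ 2 != 0 by rewrite expf_neq0// gt_eqF.
have key : (y - rho * w) ^+ 2 = (rho * y - w) ^+ 2 + sigma ^+ 2 * (y ^+ 2 - w ^+ 2).
  by rewrite -[sigma ^+ 2](addKr (rho ^+ 2)) rs; ring.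
by rewrite !expr_div_n key; field; rewrite gt_eqF.
Qed.

Section affine.
Variables (w rho sigma : R).
Hypotheses (sigma0 : 0 < sigma) (rs : rho ^+ 2 + sigma ^+ 2 = 1).

Let aff z := rho * w + sigma * z.
Let kappa := shift_density (rho * w) sigma.

Let maff : measurable_fun setT aff.
Proof. by apply: measurable_funD => //; exact: measurable_funM. Qed.

Lemma shift_density_le y : kappa y <= sigma^-1 * expR (w ^+ 2 / 2).
Proof.
rewrite /kappa shift_densityE// ler_pM2l ?invr_gt0// ler_piMr ?expR_ge0//.
by rewrite -[leRHS]expR0 ler_expR oppr_le0 mulr_ge0// sqr_ge0.
Qed.

Lemma gint_affine f : gint f -> gint (f \o aff).
Proof.
move=> hf; have mf := gint_measurable hf.
apply/integrableP; split; first by apply/measurable_EFinP; exact: measurableT_comp.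
have mnf : measurable_fun setT (fun x : R => `|(f x)%:E|%E).
  by apply: measurableT_comp => //; exact/measurable_EFinP.
have := ge0_integral_gauss_affine (rho * w) sigma0 mnf (fun x => abse_ge0 _).
rewrite /= => ->.
apply: (@le_lt_trans _ _ (\int[N]_y ((sigma^-1 * expR (w ^+ 2 / 2))%:E * `|(f y)%:E|))%E).
  apply: ge0_le_integral => //.
  - by move=> y _; rewrite mule_ge0// lee_fin shift_density_ge0.
  - by apply: emeasurable_funM => //; apply/measurable_EFinP; exact: measurable_shift_density.
  - by apply: emeasurable_funM => //.
  - move=> y _; rewrite muleC lee_wpmul2r// lee_fin; exact: shift_density_le.
rewrite ge0_integralZl//.
  by rewrite lte_mul_pinfty// ?lee_fin ?mulr_ge0 ?expR_ge0 ?invr_ge0 ?ltW//; have /integrableP[] := hf.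
by rewrite lee_fin mulr_ge0 ?expR_ge0 ?invr_ge0 ?ltW.
Qed.

Lemma gint_shift_density f : gint f -> gint (fun y => f y * kappa y).
Proof.
move=> hf; apply: (le_gint (g := fun y => (sigma^-1 * expR (w ^+ 2 / 2)) * `|f y|)).
- apply: measurable_funM; first exact: gint_measurable.
  exact: measurable_shift_density.
- move=> y; rewrite normrM mulrC ler_wpM2r// ger0_norm ?shift_density_ge0//.
  exact: shift_density_le.
- exact/gintZ/gint_norm.
Qed.

Lemma gE_affine f : gint f -> gE (f \o aff) = gE (fun y => f y * kappa y).
Proof.
move=> hf; have mf := gint_measurable hf.
rewrite /gE /Rintegral; congr fine; rewrite [LHS]integralE [RHS]integralE.
have mF : measurable_fun setT (EFin \o f) by exact/measurable_EFinP.
have eqp : funepos (EFin \o (fun y : R => f y * kappa y)) = (fun y : R => ((EFin \o f)^\+ y * (kappa y)%:E)%E).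
  apply/funext => y; rewrite !funeposE /= EFinM maxe_pMl ?mul0e//.
  by rewrite lee_fin shift_density_ge0.
have eqn : funeneg (EFin \o (fun y : R => f y * kappa y)) = (fun y : R => ((EFin \o f)^\- y * (kappa y)%:E)%E).
  apply/funext => y; rewrite !funenegE /= -mulNr EFinM maxe_pMl ?mul0e//.
  by rewrite lee_fin shift_density_ge0.
congr (_ - _)%E.
  transitivity (\int[N]_z (EFin \o f)^\+ (aff z))%E.
    by apply: eq_integral => z _; rewrite !funeposE.
  rewrite (ge0_integral_gauss_affine (rho * w) sigma0 (measurable_funepos mF) (fun x => funepos_ge0 _ _)).
  by apply: eq_integral => y _; rewrite -[LHS](congr1 (@^~ y) eqp).
transitivity (\int[N]_z (EFin \o f)^\- (aff z))%E.
  by apply: eq_integral => z _; rewrite !funenegE.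
rewrite (ge0_integral_gauss_affine (rho * w) sigma0 (measurable_funeneg mF) (fun x => funeneg_ge0 _ _)).
by apply: eq_integral => y _; rewrite -[LHS](congr1 (@^~ y) eqn).
Qed.

Lemma mehler_bound f : gint f ->
  gE (fun z => `|f (aff z)|) <= sigma^-1 * expR (w ^+ 2 / 2) * gE (fun z => `|f z|).
Proof.
move=> hf; have hn := gint_norm hf.
rewrite (gE_affine hn) -gEZ//; apply: le_gE.
- exact: gint_shift_density.
- exact: gintZ.
- by move=> y; rewrite mulrC ler_wpM2r// shift_density_le.
Qed.

End affine.

(** As [f] is only integrable, it is kept fixed and the limit is taken in the kernel, which tends to
    1; once [sigma n >= 1 / 2], a multiple of [|f|] dominates. *)
Lemma gE_mixing w (rho sigma : nat -> R) f :
  (forall n, 0 < sigma n /\ rho n ^+ 2 + sigma n ^+ 2 = 1) ->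
  rho n @[n --> \oo] --> (0 : R) -> sigma n @[n --> \oo] --> (1 : R) -> gint f ->
  gE (fun z => f (rho n * w + sigma n * z)) @[n --> \oo] --> gE f.
Proof.
move=> rsn r0 s1 hf.
have rs0 n : 0 < sigma n by have [] := rsn n.
have eqE n : gE (fun z => f (rho n * w + sigma n * z)) =
    fine (\int[N]_y (f y * shift_density (rho n * w) (sigma n) y)%:E)%E.
  have [b c] := rsn n; exact: (gE_affine w (rho n) b hf).
rewrite (_ : (fun n => _) = (fun n => fine (\int[N]_y (f y * shift_density (rho n * w) (sigma n) y)%:E)%E)); last by apply/funext.
apply: fine_cvg.
rewrite fineK; last exact: integrable_fin_num hf.
have sH : \forall n \near \oo, 1 / 2 <= sigma n.
  by near=> n; apply: ltW; near: n; apply: (cvgr_gt 1 s1); lra.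
have [n0 _ Hn0] := sH.
rewrite -(cvg_shiftn n0) /=.
have mf := gint_measurable hf.
pose F n (y : R) := f y * shift_density (rho (n + n0)%N * w) (sigma (n + n0)%N) y.
have mF n : measurable_fun setT (EFin \o F n).
  by apply/measurable_EFinP; apply: measurable_funM => //; exact: measurable_shift_density.
have mf' : measurable_fun setT (EFin \o f) by exact/measurable_EFinP.
have cF (y : R) : F n y @[n --> \oo] --> f y.
  suff : f y * shift_density (rho n * w) (sigma n) y @[n --> \oo] --> f y by rewrite -(cvg_shiftn n0).
  rewrite -[X in _ --> X]mulr1; apply: cvgM; first exact: cvg_cst.
  rewrite (_ : 1 = 1^-1 * expR (y ^+ 2 / 2 - ((y - 0 * w) / 1) ^+ 2 / 2)); last first.
    by rewrite invr1 mul0r subr0 mulr1 subrr expR0 mul1r.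
  apply: cvgM; first by apply: cvgV => //; exact: oner_neq0.
  apply: continuous_cvg; first exact: continuous_expR.
  apply: cvgB; first exact: cvg_cst.
  apply: cvgM; last exact: cvg_cst.
  have h : (y - rho n * w) / sigma n @[n --> \oo] --> (y - 0 * w) / 1.
    apply: cvgM; last by apply: cvgV => //; exact: oner_neq0.
    by apply: cvgB; [exact: cvg_cst|apply: cvgM; [|exact: cvg_cst]].
  rewrite expr2; under eq_fun do rewrite expr2.
  exact: cvgM.
have ig : N.-integrable setT (EFin \o (fun y => 2 * expR (w ^+ 2 / 2) * `|f y|)).
  by apply: gintZ; exact: gint_norm.
have bF n y : `|F n y| <= 2 * expR (w ^+ 2 / 2) * `|f y|.
  rewrite normrM mulrC ler_wpM2r// ger0_norm ?shift_density_ge0//.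
  have [b c] := rsn (n + n0)%N.
  apply: le_trans (shift_density_le w b c y) _; rewrite ler_wpM2r ?expR_ge0//.
  have h : 1 / 2 <= sigma (n + n0)%N by apply: Hn0; rewrite /= leq_addl.
  by rewrite -[leRHS]invrK lef_pV2 ?posrE//; lra.
have aecv : {ae N, forall y, setT y -> (EFin \o F n) y @[n --> \oo] --> (EFin \o f) y}.
  by apply: aeW => y _ /=; apply: cvg_EFin; [near=> n|exact: cF].
have aebd : {ae N, forall y n, setT y -> (`|(EFin \o F n) y| <= (2 * expR (w ^+ 2 / 2) * `|f y|)%:E)%E}.
  by apply: aeW => y n _; rewrite /= lee_fin bF.
have D := @dominated_convergence _ _ _ N setT measurableT (fun n => EFin \o F n) (EFin \o f)
  (EFin \o (fun y => 2 * expR (w ^+ 2 / 2) * `|f y|)).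
by have [_ _] := D mF mf' aecv ig aebd.
Unshelve. all: by end_near. Qed.

End gaussian_expectation.

(** * Gaussian integrability and growth *)

Section growth.
Context {R : realType}.
Implicit Types (f g K k p : R -> R) (w c d C x z s : R).
Notation mu := (@lebesgue_measure R).
Notation N := (@normal_prob R 0 1).

Lemma expR_sqrD c d x : expR ((c + d) * x ^+ 2) = expR (c * x ^+ 2) * expR (d * x ^+ 2).
Proof. by rewrite mulrDl expRD. Qed.

(** Up to a constant, [expR (c * z ^+ 2)] times the Gaussian density is the centred normal density
    of variance [1 / (1 - 2 * c)]. *)
Lemma gint_exp c : c < 1 / 2 -> gint (fun z => expR (c * z ^+ 2)).
Proof.
move=> c2; have me : measurable_fun setT (fun z : R => expR (c * z ^+ 2)).
  by apply: measurableT_comp => //; apply: measurable_funM => //; exact: measurable_funX.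
apply/integrableP; split; first exact/measurable_EFinP.
under eq_integral do rewrite /= ger0_norm ?expR_ge0//.
rewrite ge0_integral_gauss; last 2 first.
- exact/measurable_EFinP.
- by move=> z; rewrite lee_fin expR_ge0.
have d0 : 0 < 1 - 2 * c by lra.
pose s := Num.sqrt (1 - 2 * c)^-1.
have s0 : s != 0 by rewrite gt_eqF// sqrtr_gt0 invr_gt0.
have s2 : s ^+ 2 = (1 - 2 * c)^-1 by rewrite sqr_sqrtr// invr_ge0 ltW.
pose q : R := normal_peak 1 / normal_peak s.
have q0 : 0 <= q by rewrite divr_ge0// normal_peak_ge0.
under eq_integral => z _.
  have -> : ((expR (c * z ^+ 2))%:E * (gdens z)%:E = q%:E * (normal_pdf 0 s z)%:E)%E.
    rewrite -!EFinM gdensE normal_pdfE// /normal_fun subr0 s2; congr EFin.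
    have qE : q * normal_peak s = normal_peak 1 by rewrite divfK// gt_eqF// normal_peak_gt0.
    rewrite [RHS]mulrA qE mulrCA -expRD; congr (_ * expR _); field.
    by rewrite gt_eqF.
  over.
rewrite ge0_integralZl//.
- by rewrite integral_normal_pdf mule1 ltry.
- by apply/measurable_EFinP; exact: measurable_normal_pdf.
- by move=> z _; rewrite lee_fin normal_pdf_ge0.
Qed.

Lemma norm_le_exp c z : 0 < c -> 1 + `|z| <= (2 + c^-1) * expR (c * z ^+ 2).
Proof.
move=> c0; apply: (@le_trans _ _ ((2 + c^-1) * (1 + c * z ^+ 2))).
  have := real_normK (num_real z); have zz := normr_ge0 z.
  have ci : 0 < c^-1 by rewrite invr_gt0.
  have e : c^-1 * (c * z ^+ 2) = z ^+ 2 by rewrite mulrA mulVf ?mul1r// gt_eqF.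
  rewrite mulrDl !mulrDr e !mulr1 => <-; have := sqr_ge0 (`|z| - 1).
  by have : 0 <= c * `|z| ^+ 2 by [rewrite mulr_ge0 ?sqr_ge0 ?ltW]; nra.
rewrite ler_pM2l; first exact: expR_ge1Dx.
by rewrite addr_gt0// invr_gt0.
Qed.

(** Each factor [1 + |z|] is absorbed by moving the exponent half of the remaining way from [c] to 1
    / 2. *)
Lemma gint_exp_poly i c : c < 1 / 2 -> gint (fun z => (1 + `|z|) ^+ i * expR (c * z ^+ 2)).
Proof.
elim: i c => [|i ih] c c2.
  rewrite (_ : (fun _ => _) = fun z => expR (c * z ^+ 2)); first exact: gint_exp.
  by apply/funext => z; rewrite expr0 mul1r.
pose d := (1 / 2 - c) / 2; have d0 : 0 < d by rewrite /d; lra.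
have cd : c + d < 1 / 2 by rewrite /d; lra.
apply: le_gint (gintZ (2 + d^-1) (ih _ cd)).
- apply: measurable_funM.
    by apply: measurable_funX; apply: measurable_funD => //; exact: measurableT_comp.
  by apply: measurableT_comp => //; apply: measurable_funM => //; exact: measurable_funX.
- move=> z; have z1 : 0 <= 1 + `|z| by rewrite addr_ge0.
  rewrite ger0_norm ?mulr_ge0 ?exprn_ge0 ?expR_ge0//.
  rewrite exprSr expR_sqrD -mulrA [leRHS]mulrCA ler_wpM2l ?exprn_ge0//.
  by rewrite [leLHS]mulrC [leRHS]mulrCA ler_wpM2l ?expR_ge0// norm_le_exp.
Qed.

Lemma gint_bounded_exp i c C f : c < 1 / 2 -> measurable_fun setT f ->
  (forall z, `|f z| <= C * ((1 + `|z|) ^+ i * expR (c * z ^+ 2))) -> gint f.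
Proof. by move=> c2 mf fC; apply: le_gint fC _ => //; apply/gintZ/gint_exp_poly. Qed.

(* Every exponent above that of the inverse Gaussian density is allowed, which is
   all that membership of a monotone function in L^1 of the Gaussian yields. *)
Definition growth f := forall c, 1 / 2 < c -> exists C, forall x, `|f x| <= C * expR (c * x ^+ 2).

Lemma growthD f g : growth f -> growth g -> growth (fun x => f x + g x).
Proof.
move=> hf hg c c2; have [C HC] := hf c c2; have [D HD] := hg c c2.
by exists (C + D) => x; rewrite (le_trans (ler_normD _ _))// mulrDl lerD.
Qed.

Lemma growthZ a f : growth f -> growth (fun x => a * f x).
Proof.
move=> hf c c2; have [C HC] := hf c c2.
by exists (`|a| * C) => x; rewrite normrM -mulrA ler_wpM2l.
Qed.

Lemma growth_cst a : growth (cst a).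
Proof.
move=> c c2; exists `|a| => x; rewrite ler_peMr//.
by rewrite -expR0 ler_expR mulr_ge0 ?sqr_ge0//; lra.
Qed.

Lemma growth_le f g : (forall x, `|f x| <= g x) -> growth g -> growth f.
Proof.
move=> fg hg c c2; have [C HC] := hg c c2; exists C => x.
by rewrite (le_trans (fg x))// (le_trans (ler_norm _)).
Qed.

Lemma growthX f : growth f -> growth (fun x => x * f x).
Proof.
move=> hf c c2; pose d := (c - 1 / 2) / 2.
have d0 : 0 < d by rewrite /d; lra.
have cd : 1 / 2 < c - d by rewrite /d; lra.
have [C HC] := hf _ cd; exists ((2 + d^-1) * C) => x.
have h : `|x| <= (2 + d^-1) * expR (d * x ^+ 2).
  by apply: le_trans (norm_le_exp x d0); rewrite lerDr.
rewrite normrM (_ : c = d + (c - d)); last by ring.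
by rewrite expR_sqrD mulrACA ler_pM.
Qed.

(** Integrating the bound on [eta] from 0 to [x] costs a factor [|x|], which an arbitrarily small
    increase of the exponent pays for. *)
Lemma growth_antiderivative f (eta : R -> R) : llip f -> measurable_fun setT eta ->
  {ae mu, forall x : R, is_derive x (1 : R) f (eta x)} -> growth eta -> growth f.
Proof.
move=> lf me de ge.
suff h : growth (fun x => f x - f 0).
  rewrite (_ : f = fun x => (f x - f 0) + (cst (f 0)) x); first by apply: growthD => //; exact: growth_cst.
  by apply/funext => x /=; rewrite subrK.
have ex : growth (fun x => x * expR (x ^+ 2 / 2)).
  apply: growthX => c c2; exists 1 => x; rewrite mul1r ger0_norm ?expR_ge0// ler_expR.
  by rewrite mulrC ler_wpM2r ?sqr_ge0//; lra.
move=> c c2; pose d := (c - 1 / 2) / 2.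
have d0 : 0 < d by rewrite /d; lra.
have cd : 1 / 2 < c - d by rewrite /d; lra.
have [C HC] := ge _ cd.
have C0 : 0 <= C by have := HC 0; rewrite expr0n/= mulr0 expR0 mulr1; exact: le_trans.
exists ((2 + d^-1) * C) => x.
have h : `|x| <= (2 + d^-1) * expR (d * x ^+ 2).
  by apply: le_trans (norm_le_exp x d0); rewrite lerDr.
suff h2 : `|f x - f 0| <= `|x| * (C * expR ((c - d) * x ^+ 2)).
  apply: (le_trans h2); rewrite {2}(_ : c = d + (c - d)); last by ring.
  rewrite (expR_sqrD d) [leRHS]mulrACA; apply: ler_pM => //; by rewrite mulr_ge0// expR_ge0.
have key a b : a <= b -> (forall t, a <= t -> t <= b -> `|t| <= `|x|) ->
    `|f b - f a| <= (C * expR ((c - d) * x ^+ 2)) * (b - a).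
  move=> ab tx; have [ie ->] := abs_continuous_ftc (llip_ac lf) me de ab.
  apply: le_trans (le_normr_Rintegral _ ie) _ => //.
  have mab : mu `[a, b]%classic = (b - a)%:E.
    rewrite lebesgue_measure_itv/= lte_fin; case: ifPn => //.
    by rewrite -leNgt => ba; congr EFin; apply/esym/eqP; rewrite subr_eq0 eq_le ba ab.
  have -> : C * expR ((c - d) * x ^+ 2) * (b - a) = \int[mu]_(t in `[a, b]) (C * expR ((c - d) * x ^+ 2)).
    by rewrite Rintegral_cst//; congr (_ * _); exact: (esym (congr1 fine mab)).
  apply: le_Rintegral => //.
  - exact: integrable_norm.
  - have fm : (mu `[a, b]%classic < +oo)%E by rewrite mab ltry.
    by apply: (measurable_bounded_integrable _ fm) => //; exact: bounded_cst.
  - move=> t; rewrite /= in_itv/= => /andP[at_ tb].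
    apply: le_trans (HC t) _; rewrite ler_wpM2l// ler_expR ler_wpM2l//; first by lra.
    by rewrite -real_normK ?num_real// -[leRHS]real_normK ?num_real// lerXn2r ?nnegrE// tx.
rewrite [leRHS]mulrC; have [x0|/ltW x0] := leP 0 x.
  have -> : C * expR ((c - d) * x ^+ 2) * `|x| = C * expR ((c - d) * x ^+ 2) * (x - 0) by rewrite subr0 ger0_norm.
  by apply: key => // t t0 tx; rewrite !ger0_norm.
have -> : C * expR ((c - d) * x ^+ 2) * `|x| = C * expR ((c - d) * x ^+ 2) * (0 - x) by rewrite sub0r ler0_norm.
by rewrite distrC; apply: key => // t xt t0; rewrite !ler0_norm// lerN2.
Qed.

End growth.

(** * Continuity and differentiation under the Gaussian integral *)

Section under_integral.
Context {R : realType}.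
Implicit Types (f g K k p : R -> R) (w c d C x z s q t : R).
Notation mu := (@lebesgue_measure R).
Notation N := (@normal_prob R 0 1).

Definition pweight p := measurable_fun setT p /\
  exists C i, forall z, `|p z| <= C * (1 + `|z|) ^+ i.

Lemma pweight_cst c : pweight (cst c).
Proof. by split => //; exists `|c|, 0%N => z; rewrite expr0 mulr1. Qed.

Lemma pweight_id : pweight id.
Proof. by split => //; exists 1, 1%N => z; rewrite expr1 mul1r lerDr. Qed.

Lemma pweightM p1 p2 : pweight p1 -> pweight p2 -> pweight (fun z => p1 z * p2 z).
Proof.
move=> [m1 [C1 [i1 H1]]] [m2 [C2 [i2 H2]]]; split; first exact: measurable_funM.
exists (C1 * C2), (i1 + i2)%N => z.
by rewrite normrM exprD mulrACA ler_pM.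
Qed.

Lemma pweightD p1 p2 : pweight p1 -> pweight p2 -> pweight (fun z => p1 z + p2 z).
Proof.
move=> [m1 [C1 [i1 H1]]] [m2 [C2 [i2 H2]]]; split; first exact: measurable_funD.
have aux C i j z : `|C| * (1 + `|z|) ^+ i <= `|C| * (1 + `|z|) ^+ (i + j).
  by rewrite ler_wpM2l// ler_weXn2l ?leq_addr// lerDl.
exists (`|C1| + `|C2|), (i1 + i2)%N => z.
rewrite mulrDl (le_trans (ler_normD _ _))// lerD//.
  apply: le_trans (H1 z) _; apply: le_trans (aux _ _ _ _).
  by rewrite ler_wpM2r ?ler_norm// exprn_ge0// addr_ge0.
rewrite addnC; apply: le_trans (H2 z) _; apply: le_trans (aux _ _ _ _).
by rewrite ler_wpM2r ?ler_norm// exprn_ge0// addr_ge0.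
Qed.

(** By Young's inequality the square of [x + s * z] is at most
    [(1 + 1 / t) x ^ 2 + (1 + t) s ^ 2 z ^ 2]. With [t = q / 4] and the exponent [(1 + t) / 2] for
    [f], the coefficient of [z ^ 2] is at most [(1 + t) ^ 2 (1 - q) / 2], which is below 1 / 2: the
    contraction recovers the integrability that [growth] alone misses. *)
Lemma growth_affine f (B q : R) : growth f -> 0 < q -> q <= 1 ->
  exists C c, [/\ 0 <= C, c < 1 / 2 & forall x s z, `|x| <= B -> s ^+ 2 <= 1 - q ->
    `|f (x + s * z)| <= C * expR (c * z ^+ 2)].
Proof.
move=> gf q0 q1; pose t := q / 4; have t0 : 0 < t by rewrite /t; lra.
have hc0 : 1 / 2 < (1 + t) / 2 by lra.
have [C HC] := gf _ hc0.
have C0 : 0 <= C by have := HC 0; rewrite expr0n/= mulr0 expR0 mulr1; exact: le_trans.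
exists (C * expR ((1 + t) / 2 * ((1 + t^-1) * B ^+ 2))), ((1 + t) / 2 * ((1 + t) * (1 - q))); split.
- by rewrite mulr_ge0// expR_ge0.
- rewrite /t; have : 0 < q ^+ 2 by rewrite exprn_gt0. have : 0 < q ^+ 3 by rewrite exprn_gt0. by nra.
- move=> x s z xB sq; apply: le_trans (HC _) _; rewrite -[leRHS]mulrA ler_wpM2l// -expRD ler_expR.
  rewrite -[X in _ <= _ + X]mulrA -mulrDr ler_wpM2l//; first by lra.
  have h1 : x ^+ 2 <= B ^+ 2.
    by rewrite -[leLHS]real_normK ?num_real// lerXn2r ?nnegrE// (le_trans _ xB).
  apply: (@le_trans _ _ ((1 + t^-1) * x ^+ 2 + (1 + t) * (s * z) ^+ 2)).
    have : 0 <= t^-1 * (x - t * (s * z)) ^+ 2 by rewrite mulr_ge0 ?sqr_ge0// invr_ge0 ltW.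
    have -> : t^-1 * (x - t * (s * z)) ^+ 2 = t^-1 * x ^+ 2 - 2 * x * (s * z) + t * (s * z) ^+ 2.
      by field; rewrite gt_eqF.
    by move=> ?; nra.
  apply: lerD; first by rewrite ler_wpM2l// addr_ge0// invr_ge0 ltW.
  rewrite exprMn -mulrA ler_wpM2l//; first by lra.
  by rewrite ler_wpM2r// sqr_ge0.
Qed.

Lemma gint_growth f p x s : growth f -> measurable_fun setT f -> pweight p -> s ^+ 2 < 1 ->
  gint (fun z => f (x + s * z) * p z).
Proof.
move=> gf mf [mp [D [i Hp]]] s1.
pose q := 1 - s ^+ 2; have q0 : 0 < q by rewrite subr_gt0.
have q1 : q <= 1 by rewrite gerBl sqr_ge0.
have [C [c [C0 c2 H]]] := growth_affine `|x| gf q0 q1.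
apply: (@gint_bounded_exp _ i c (C * D)) => //.
  by apply: measurable_funM => //; apply: measurableT_comp => //; apply: measurable_funD => //; exact: measurable_funM.
move=> z; rewrite normrM [(1 + _) ^+ _ * _]mulrC mulrACA ler_pM// H//.
by rewrite /q opprB addrCA subrr addr0.
Qed.

Lemma continuous_gE f p (a b : R -> R) u v B q : growth f -> continuous f -> pweight p ->
  continuous a -> continuous b -> 0 < q -> q <= 1 ->
  (forall t, u < t -> t < v -> `|a t| <= B /\ b t ^+ 2 <= 1 - q) ->
  forall t, u < t -> t < v -> {for t, continuous (fun t => gE (fun z => f (a t + b t * z) * p z))}.
Proof.
move=> gf cf hp ca cb q0 q1 H t ut tv.
have [mp [D [i Hp]]] := hp.
have mf := continuous_measurable_fun cf.
have [C [c [C0 c2 HC]]] := growth_affine B gf q0 q1.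
have := @continuity_under_integral R _ _ N (fun t z => f (a t + b t * z) * p z) setT measurableT u v _ _
  (fun z => C * D * ((1 + `|z|) ^+ i * expR (c * z ^+ 2))).
apply.
- move=> x; rewrite /= in_itv/= => /andP[ux xv]; apply: gint_growth => //.
  by have [_ h] := H _ ux xv; apply: le_lt_trans h _; lra.
- apply: aeW => z _ x _.
  apply: cvgM; last exact: cvg_cst.
  apply: continuous_cvg; first exact: cf.
  apply: cvgD; first exact: ca.
  by apply: cvgM; [exact: cb|exact: cvg_cst].
- exact/gintZ/gint_exp_poly.
- move=> x; rewrite /= in_itv/= => /andP[ux xv]; have [h1 h2] := H _ ux xv.
  apply: aeW => z _; rewrite normrM [(1 + _) ^+ _ * _]mulrC mulrACA ler_pM// HC//.
- by rewrite inE /= in_itv/= ut.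
Qed.

(** Since [b t ^+ 2 <= 1 - q] throughout, [growth_affine] supplies one dominating function for all
    [t]; the inner derivative [da t + db t * z] adds one power of [1 + |z|]. *)
Lemma is_derive_gE K k p (a b : R -> R) (da db : R -> R) u v B q : growth K -> growth k ->
  (forall x, is_derive x (1 : R) K (k x)) -> continuous k -> pweight p -> 0 < q -> q <= 1 ->
  (forall t, u < t -> t < v -> [/\ `|a t| <= B, b t ^+ 2 <= 1 - q, `|da t| <= B & `|db t| <= B]) ->
  (forall t, u < t -> t < v -> is_derive t (1 : R) a (da t) /\ is_derive t (1 : R) b (db t)) ->
  forall t, u < t -> t < v ->
  is_derive t (1 : R) (fun t => gE (fun z => K (a t + b t * z) * p z))
    (gE (fun z => k (a t + b t * z) * ((da t + db t * z) * p z))).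
Proof.
move=> gK gk dK ck hp q0 q1 H dab t ut tv.
have [mp [D [i Hp]]] := hp.
have cK := is_derive_continuous dK.
have mK := continuous_measurable_fun cK.
have [C [c [C0 c2 HC]]] := growth_affine B gk q0 q1.
have It : (`]u, v[%classic : set R) t by rewrite /= in_itv/= ut.
pose F t z := K (a t + b t * z) * p z.
have dF x z : u < x -> x < v -> is_derive x (1 : R) (F ^~ z) (k (a x + b x * z) * ((da x + db x * z) * p z)).
  move=> ux xv; have [d1 d2] := dab _ ux xv; have d3 := dK (a x + b x * z).
  have d4 : is_derive x (1 : R) (fun x => a x + b x * z) (da x + db x * z).
    by apply: is_derive_eq; rewrite scaler0 add0r /GRing.scale/= mulrC.
  have d5 : is_derive x (1 : R) (fun x => K (a x + b x * z)) (k (a x + b x * z) * (da x + db x * z)).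
    exact: is_derive1_comp.
  by apply: is_derive_eq; rewrite scaler0 add0r /GRing.scale/= mulrC mulrA.
have pF x z : u < x -> x < v -> partial1of2 F x z = k (a x + b x * z) * ((da x + db x * z) * p z).
  by move=> ux xv; rewrite partial1of2E; have [] := dF x z ux xv.
pose G z := C * (B * D) * ((1 + `|z|) ^+ i.+1 * expR (c * z ^+ 2)).
have intF x : (`]u, v[%classic : set R) x -> N.-integrable setT (EFin \o F x).
  rewrite /= in_itv/= => /andP[ux xv]; apply: gint_growth => //.
  by have [_ h _ _] := H _ ux xv; apply: le_lt_trans h _; lra.
have derF x z : (`]u, v[%classic : set R) x -> setT z -> derivable (F ^~ z) x 1.
  by rewrite /= in_itv/= => /andP[ux xv] _; have [] := dF x z ux xv.
have Gb x z : (`]u, v[%classic : set R) x -> setT z -> `|partial1of2 F x z| <= G z.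
  rewrite /= in_itv/= => /andP[ux xv] _; rewrite pF// normrM /G.
  have [h1 h2 h3 h4] := H _ ux xv.
  rewrite [(1 + _) ^+ _ * _]mulrC mulrACA ler_pM// ?HC//.
  rewrite normrM exprS mulrACA ler_pM//.
  rewrite mulrDr mulr1 (le_trans (ler_normD _ _))// lerD//.
  by rewrite normrM ler_wpM2r.
have G0 z : 0 <= G z by apply: le_trans (Gb t z It _).
have iG : N.-integrable setT (EFin \o G) by exact/gintZ/gint_exp_poly.
have e : gE (fun z => k (a t + b t * z) * ((da t + db t * z) * p z)) = \int[N]_z partial1of2 F t z.
  by rewrite /gE; congr (\int[N]_z _); apply/funext => z; rewrite pF.
rewrite e; apply: DeriveDef.
  exact: (@derivable_under_integral R _ _ N F setT measurableT t u v It intF derF G G0 iG Gb).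
by rewrite -derive1E; exact: (@differentiation_under_integral R _ _ N F setT measurableT t u v It intF derF G G0 iG Gb).
Qed.

Lemma ae_affine (A : R -> Prop) c s : 0 < s -> {ae mu, forall x : R, A x} ->
  {ae mu, forall z : R, A (c + s * z)}.
Proof.
move=> s0 [B [mB B0 AB]].
pose aff : measurableTypeR R -> measurableTypeR R := (fun z : R => (c + s * z)).
have maff : measurable_fun [set: measurableTypeR R] aff.
  by apply: measurable_funD => //; exact: measurable_funM.
have mB' : measurable (aff @^-1` B) by rewrite -[X in measurable X]setTI; exact: maff.
exists (aff @^-1` B); split => //.
  have m1 : measurable_fun setT (fun x : R => (\1_B x)%:E : \bar R).
    by apply/measurable_EFinP; exact: measurable_indic.
  have h0 (x : R) : (0 <= (\1_B x)%:E :> \bar R)%E by rewrite lee_fin.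
  have e := integral_affine c s0 m1 h0.
  have e1 : (\int[mu]_z (\1_B (c + s * z))%:E = mu (aff @^-1` B))%E.
    transitivity (\int[mu]_z (\1_(aff @^-1` B) z)%:E)%E => //.
    by rewrite integral_indic// setIT.
  have e2 : (\int[mu]_z (\1_B z)%:E = 0)%E.
    by rewrite integral_indic// setIT; exact: B0.
  by rewrite -[LHS]e1 e e2 mule0.
by move=> z /= nA; apply: AB.
Qed.

End under_integral.

Lemma derivable_is_derive (R : realType) (f : R -> R) (x d : R) :
  derivable f x 1 -> derive1 f x = d -> is_derive x (1 : R) f d.
Proof. by move=> df <-; rewrite derive1E; exact: derivableP. Qed.

(** * Antiderivatives on the whole line *)

Section antiderivative.
Context {R : realType}.
Notation mu := (@lebesgue_measure R).
Variable f : R -> R.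
Hypothesis f_int : forall a b : R, mu.-integrable `[a, b] (EFin \o f).

Definition antiderivative (x : R) : R :=
  if 0 <= x then \int[mu]_(t in `[0, x]) f t else - \int[mu]_(t in `[x, 0]) f t.

Lemma Rintegral_chasles (a b c : R) : a <= b -> b <= c ->
  \int[mu]_(t in `[a, c]) f t = \int[mu]_(t in `[a, b]) f t + \int[mu]_(t in `[b, c]) f t.
Proof.
move=> ab bc; apply/eqP; rewrite addrC -subr_eq; apply/eqP.
rewrite Rintegral_itvB//.
  rewrite Rintegral_itv_obnd_cbnd//; apply: integrableS (f_int b c) => //.
  by apply: subset_itvr; rewrite bnd_simp.
Qed.

Lemma antiderivativeB (a b : R) : a <= b ->
  antiderivative b - antiderivative a = \int[mu]_(t in `[a, b]) f t.
Proof.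
move=> ab; rewrite /antiderivative; have [a0|a0] := leP 0 a.
  by rewrite (le_trans a0 ab) (Rintegral_chasles a0 ab) addrC addKr.
have [b0|b0] := leP 0 b; first by rewrite opprK addrC -(Rintegral_chasles (ltW a0) b0).
by rewrite opprK (Rintegral_chasles ab (ltW b0)) addrC addrK.
Qed.

Lemma antiderivative_lip (a b M : R) : (forall x, a <= x -> x <= b -> `|f x| <= M) ->
  forall x y, a <= x -> x <= y -> y <= b -> `|antiderivative y - antiderivative x| <= M * (y - x).
Proof.
move=> HM x y ax xy yb.
rewrite antiderivativeB//; apply: le_trans (le_normr_Rintegral _ (f_int x y)) _ => //.
have mab : mu `[x, y]%classic = (y - x)%:E.
  rewrite lebesgue_measure_itv/= lte_fin; case: ifPn => //.
  by rewrite -leNgt => yx; congr EFin; apply/esym/eqP; rewrite subr_eq0 eq_le yx xy.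
have -> : M * (y - x) = \int[mu]_(t in `[x, y]) M.
  by rewrite Rintegral_cst//; congr (_ * _); exact: (esym (congr1 fine mab)).
apply: le_Rintegral => //.
- exact: integrable_norm.
- have fm : (mu `[x, y]%classic < +oo)%E by rewrite mab ltry.
  by apply: (measurable_bounded_integrable _ fm) => //; exact: bounded_cst.
- move=> t; rewrite /= in_itv/= => /andP[xt ty].
  by apply: HM; [exact: le_trans xt|exact: le_trans yb].
Qed.

Lemma antiderivative_is_derive (a x d : R) : a < x ->
  is_derive x (1 : R) (fun y => \int[mu]_(t in `[a, y]) f t) d -> is_derive x (1 : R) antiderivative d.
Proof.
move=> ax dx.
have d2 : is_derive x (1 : R) (fun y => \int[mu]_(t in `[a, y]) f t + antiderivative a) d.
  by apply: is_derive_eq; rewrite addr0.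
apply: (near_eq_is_derive (f := fun y => \int[mu]_(t in `[a, y]) f t + antiderivative a)) d2.
near=> y; rewrite -antiderivativeB ?subrK//.
by apply: ltW; near: y; exact: lt_nbhsr.
Unshelve. all: by end_near. Qed.

Lemma continuous_antiderivative : continuous f ->
  forall x, is_derive x (1 : R) antiderivative (f x).
Proof.
move=> cf x; have x1 : x - 1 < x by lra.
apply: (antiderivative_is_derive x1).
have x2 : x < x + 1 by lra.
have [d e] := @continuous_FTC1_closed R f (x - 1) x (x + 1) x2 (f_int _ _) x1 (cf x).
exact: derivable_is_derive d e.
Qed.

(** Lebesgue differentiation to the right of [- n] for each [n], where [antiderivative] differs by a
    constant from the integral started at [- n]. *)
Lemma antiderivative_ae_is_derive : measurable_fun setT f ->
  {ae mu, forall x : R, is_derive x (1 : R) antiderivative (f x)}.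
Proof.
move=> mf.
have H (n : nat) : {ae mu, forall x : R, - n%:R < x -> is_derive x (1 : R) antiderivative (f x)}.
  have := @FTC1 R f (BLeft (- n%:R)) (f_int _).
  have lf : locally_integrable [set: R] f.
    split => //; first exact: openT.
    move=> K _ cK; have mK : measurable K by apply: closed_measurable; exact: compact_closed.
    have [M [_ HM]] := compact_bounded cK.
    have KM : K `<=` `[- (`|M| + 1), `|M| + 1]%classic.
      move=> y Ky; rewrite /= in_itv/= -ler_norml; apply: (HM (`|M| + 1)) => //.
      by rewrite (le_lt_trans (ler_norm M))// ltrDl.
    have /integrableP[_] := f_int (- (`|M| + 1)) (`|M| + 1); apply: le_lt_trans.
    apply: (@ge0_subset_integral _ _ _ mu) => //.
    by apply/measurable_EFinP; apply: measurableT_comp => //; exact: measurable_funTS.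
  move=> /(_ lf) /=; apply: (@filterS _ _ (ae_filter_ringOfSetsType mu)) => x Hx nx.
  move: (x : R) Hx nx => {}x Hx nx.
  have [|d e] := Hx _; first by rewrite lte_fin.
  apply: (antiderivative_is_derive nx).
  exact: derivable_is_derive d e.
have := @negligible_bigcup _ _ _ mu _ H; apply: negligibleS => x /= nd.
exists (Num.bound `|x : R|) => //= h; apply: nd; apply: h.
by have := archi_boundP (normr_ge0 (x : R)); rewrite ltr_norml => /andP[].
Qed.

End antiderivative.

(** * Gaussian integration by parts *)

Section integration_by_parts.
Context {R : realType}.
Implicit Types (f g K k p eta V : R -> R) (w c d C x z s q t : R).
Notation mu := (@lebesgue_measure R).
Notation N := (@normal_prob R 0 1).

Lemma gint_gdens f : gint f -> mu.-integrable setT (EFin \o (fun x => f x * gdens x)) /\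
  gE f = \int[mu]_x (f x * gdens x).
Proof.
move=> hf; have mf := gint_measurable hf.
have mF : measurable_fun setT (EFin \o f) by exact/measurable_EFinP.
have mg : measurable_fun setT (@gdens R) by exact: measurable_normal_pdf.
have g0 (y : R) : 0 <= gdens y by exact: normal_pdf_ge0.
have mfg : measurable_fun setT (fun x => f x * gdens x) by exact: measurable_funM.
split.
  apply/integrableP; split; first exact/measurable_EFinP.
  have mnf : measurable_fun setT (fun x : R => `|(f x)%:E|%E) by apply: measurableT_comp.
  have := ge0_integral_gauss mnf (fun x => abse_ge0 _).
  have /integrableP[_] := hf => /[swap] -> /=; apply: le_lt_trans.
  rewrite le_eqVlt; apply/orP; left; apply/eqP; apply: eq_integral => y _.
  by rewrite normrM EFinM; congr (_ * _%:E)%E; exact: ger0_norm (g0 y).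
rewrite /gE /Rintegral; congr fine; rewrite [LHS]integralE [RHS]integralE.
congr (_ - _)%E.
  rewrite (ge0_integral_gauss (measurable_funepos mF) (fun x => funepos_ge0 _ _)).
  by apply: eq_integral => y _; rewrite !funeposE /= EFinM maxe_pMl ?mul0e// lee_fin.
rewrite (ge0_integral_gauss (measurable_funeneg mF) (fun x => funeneg_ge0 _ _)).
by apply: eq_integral => y _; rewrite !funenegE /= -mulNr EFinM maxe_pMl ?mul0e// lee_fin.
Qed.

Lemma is_derive_gdens x : is_derive x (1 : R) gdens (- x * gdens x).
Proof.
rewrite (_ : gdens = fun z => normal_peak 1 * expR (- (z ^+ 2 / 2))); last first.
  by apply/funext => z; rewrite gdensE.
apply: is_derive_eq; rewrite /GRing.scale /=; by field.
Qed.

Lemma gdens_llip : llip (@gdens R).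
Proof.
apply: continuous_llip is_derive_gdens _ => x.
apply: cvgM; first by apply: cvgN; exact: cvg_id.
exact: (is_derive_continuous is_derive_gdens).
Qed.

Lemma pow_le_exp i c d : c < d -> exists2 C, 0 <= C & forall z,
  (1 + `|z|) ^+ i * expR (c * z ^+ 2) <= C * expR (d * z ^+ 2).
Proof.
elim: i c => [|i ih] c cd.
  exists 1 => // z; rewrite expr0 !mul1r ler_expR ler_wpM2r ?sqr_ge0//; exact: ltW.
pose e := (d - c) / 2; have e0 : 0 < e by rewrite /e; lra.
have [|C C0 HC] := ih (e + c); first by rewrite /e; lra.
exists ((2 + e^-1) * C) => [|z]; first by rewrite mulr_ge0// addr_ge0// invr_ge0 ltW.
rewrite exprS -[leRHS]mulrA -[leLHS]mulrA.
apply: le_trans (_ : (2 + e^-1) * expR (e * z ^+ 2) * ((1 + `|z|) ^+ i * expR (c * z ^+ 2)) <= _).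
  by rewrite ler_wpM2r ?norm_le_exp// mulr_ge0 ?expR_ge0// exprn_ge0// addr_ge0.
rewrite -[leLHS]mulrA [X in _ * X <= _]mulrCA -expR_sqrD ler_wpM2l//.
by rewrite addr_ge0// invr_ge0 ltW.
Qed.

(** The Gaussian density leaves a factor [expR (- (e * z ^+ 2))], with [e] the gap from [c] to 1 /
    2, and [e * z ^+ 2 <= expR (e * z ^+ 2)]. The factor [z ^+ 2] gives a rate for the boundary
    terms of the integration by parts. *)
Lemma gauss_decay c C V : c < 1 / 2 -> 0 <= C -> (forall z, `|V z| <= C * expR (c * z ^+ 2)) ->
  exists D, forall z, `|V z * gdens z| * z ^+ 2 <= D.
Proof.
move=> c2 C0 HV; pose e := 1 / 2 - c; have e0 : 0 < e by rewrite /e; lra.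
have p0 := normal_peak_ge0 (1 : R).
exists (C * normal_peak 1 * e^-1) => z.
rewrite normrM gdensE [`|_ * expR _|]ger0_norm ?mulr_ge0 ?expR_ge0//.
apply: le_trans (_ : (C * expR (c * z ^+ 2)) * (normal_peak 1 * expR (- (z ^+ 2 / 2))) * z ^+ 2 <= _).
  by rewrite ler_wpM2r ?sqr_ge0// ler_wpM2r// mulr_ge0// expR_ge0.
rewrite [X in X * z ^+ 2]mulrACA -expRD -[leLHS]mulrA ler_wpM2l ?mulr_ge0//.
rewrite (_ : _ + - _ = - (e * z ^+ 2)); last by rewrite /e; field.
rewrite expRN ler_pdivrMl ?expR_gt0// mulrC ler_pdivlMl//.
by apply: le_trans (expR_ge1Dx _); rewrite lerDr.
Qed.

(** Almost everywhere the derivative of [V z * gdens z] is [(eta z - V z * z) * gdens z]. As [V] is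
    only locally Lipschitz, the fundamental theorem for absolutely continuous functions is used on
    [[- n, n]], and the boundary terms tend to 0. *)
Lemma stein_ibp V eta c C : c < 1 / 2 -> 0 <= C -> llip V -> measurable_fun setT eta ->
  {ae mu, forall x : R, is_derive x (1 : R) V (eta x)} ->
  (forall z, `|V z| <= C * expR (c * z ^+ 2)) -> (forall z, `|eta z| <= C * expR (c * z ^+ 2)) ->
  gE (fun z => V z * z) = gE eta.
Proof.
move=> c2 C0 lV me dV HV He.
have mV := continuous_measurable_fun (llip_continuous lV).
have i1 : gint eta.
  apply: (@gint_bounded_exp _ 0 c C) => // z; by rewrite expr0 mul1r.
have i2 : gint (fun z => V z * z).
  apply: (@gint_bounded_exp _ 1 c C) => //; first exact: measurable_funM.
  move=> z; rewrite normrM expr1 mulrCA mulrC; apply: ler_pM => //.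
  by rewrite lerDr.
apply/eqP; rewrite eq_sym -subr_eq0 -gEB//; apply/eqP.
have ih := gintB i1 i2; have [iH ->] := gint_gdens ih.
pose H z := (eta z - V z * z) * gdens z; rewrite -/H in iH *.
pose W z := V z * gdens z.
have lW : llip W by exact: llipM lV gdens_llip.
have mH : measurable_fun setT H by apply/measurable_EFinP; have /integrableP[] := iH.
have dW : {ae mu, forall x : R, is_derive x (1 : R) W (H x)}.
  move: dV; apply: (@filterS _ _ (ae_filter_ringOfSetsType mu)) => x dx.
  move: (x : R) dx => {}x dx; have dg := is_derive_gdens x.
  by apply: is_derive_eq; rewrite /GRing.scale/= /H; ring.
have ftc (n : nat) : W n%:R - W (- n%:R) = \int[mu]_(t in `[- n%:R, n%:R]) H t.
  have nn : - n%:R <= n%:R :> R by rewrite (@le_trans _ _ 0)// oppr_le0.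
  by have [_] := abs_continuous_ftc (llip_ac lW) mH dW nn.
have lim1 : \int[mu]_(t in `[- n%:R, n%:R]) H t @[n --> \oo] --> \int[mu]_x H x.
  apply: fine_cvg; rewrite fineK; last exact: integrable_fin_num.
  pose F (n : nat) (x : R) : \bar R := ((EFin \o H) \_ `[- n%:R, n%:R]) x.
  rewrite (_ : (fun n : nat => _) = (fun n => (\int[mu]_x F n x)%E)); last first.
    by apply/funext => n; rewrite integral_mkcond.
  have mF n : measurable_fun setT (F n).
    by apply/(measurable_restrictT _ _).1 => //; exact/measurable_EFinP/measurable_funTS.
  have mh : measurable_fun setT (EFin \o H) by exact/measurable_EFinP.
  have cF : {ae mu, forall x, setT x -> F n x @[n --> \oo] --> (EFin \o H) x}.
    apply: aeW => x _; apply: cvg_near_cst; near=> n.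
    rewrite /F patchE ifT// inE /= in_itv/= -ler_norml.
    by near: n; exact: nbhs_infty_ger.
  have iN : mu.-integrable setT (EFin \o (fun x => `|H x|)) by exact: integrable_norm.
  have bF : {ae mu, forall x n, setT x -> (`|F n x| <= (EFin \o (fun x => `|H x|)%R) x)%E}.
    by apply: aeW => x n _; rewrite /F patchE; case: ifPn => _; rewrite /= ?normr0 lee_fin.
  have D := @dominated_convergence _ _ _ mu setT measurableT F (EFin \o H) (EFin \o (fun x => `|H x|)).
  by have [_ _] := D mF mh cF iN bF.
have [D HD] := gauss_decay c2 C0 HV.
have lim2 : W n%:R - W (- n%:R) @[n --> \oo] --> (0 : R).
  apply/cvgr0Pnorm_le => e e0; near=> n.
  have n1 : (1 : R) <= n%:R by near: n; exact: nbhs_infty_ger.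
  (* Each boundary term is at most [|D| / n ^ 2], hence at most [|D| / n], so this choice makes
     their sum at most [e]. *)
  have n2 : 2 * `|D| / e <= n%:R by near: n; exact: nbhs_infty_ger.
  have n0 : (0 : R) < n%:R by lra.
  apply: le_trans (ler_normB _ _) _.
  have h1 := HD n%:R; have h2 := HD (- n%:R).
  have h3 := ler_norm D; rewrite ler_pdivrMr// in n2.
  rewrite sqrrN -/(W _) in h2; rewrite -/(W _) in h1.
  move: (W _) (W (- _)) h1 h2 => w1 w2 h1 h2.
  have k0 : (n%:R : R) <= n%:R ^+ 2 by rewrite expr2 ler_peMl// ltW.
  rewrite -(ler_pM2r n0).
  have h4 : `|w1| * n%:R <= `|w1| * n%:R ^+ 2 by rewrite ler_wpM2l.
  have h5 : `|w2| * n%:R <= `|w2| * n%:R ^+ 2 by rewrite ler_wpM2l.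
  by rewrite mulrDl; lra.
rewrite (_ : (fun n : nat => W n%:R - W (- n%:R)) = (fun n : nat => \int[mu]_(t in `[- n%:R, n%:R]) H t)) in lim2; last exact/funext.
exact: (cvg_unique _ lim1 lim2).
Unshelve. all: by end_near. Qed.

End integration_by_parts.

(** * Derivatives of averages of Lipschitz and of measurable functions *)

Section heat.
Context {R : realType}.
Implicit Types (g p V : R -> R) (w c d C x z s q t : R).
Notation mu := (@lebesgue_measure R).
Notation N := (@normal_prob R 0 1).

(** Growth strictly below the inverse Gaussian density, as integration by parts requires. A function
    in [growth] enters this class after the substitution [x + s * z] with [s ^+ 2 < 1]. *)
Definition subgauss g := exists c C, [/\ c < 1 / 2, 0 <= C &
  forall z, `|g z| <= C * expR (c * z ^+ 2)].

Lemma subgauss2 g V : subgauss g -> subgauss V -> exists c C, [/\ c < 1 / 2, 0 <= C,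
  forall z, `|g z| <= C * expR (c * z ^+ 2) & forall z, `|V z| <= C * expR (c * z ^+ 2)].
Proof.
move=> [c [C [c2 C0 H]]] [d [D [d2 D0 G]]].
exists (Num.max c d), (C + D); split; [by rewrite gt_max c2 d2|exact: addr_ge0|move=> z..].
- apply: le_trans (H z) _; apply: ler_pM => //; first by rewrite lerDl.
  by rewrite ler_expR ler_wpM2r ?sqr_ge0// le_max lexx.
- apply: le_trans (G z) _; apply: ler_pM => //; first by rewrite lerDr.
  by rewrite ler_expR ler_wpM2r ?sqr_ge0// le_max lexx orbT.
Qed.

Lemma subgaussD g V : subgauss g -> subgauss V -> subgauss (fun z => g z + V z).
Proof.
move=> sg sV; have [c [C [c2 C0 H G]]] := subgauss2 sg sV.
exists c, (C + C); split => // [|z]; first exact: addr_ge0.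
by rewrite (le_trans (ler_normD _ _))// mulrDl lerD.
Qed.

Lemma subgaussZ a g : subgauss g -> subgauss (fun z => a * g z).
Proof.
move=> [c [C [c2 C0 H]]]; exists c, (`|a| * C); split => // [|z]; first exact: mulr_ge0.
by rewrite normrM -mulrA ler_wpM2l.
Qed.

Lemma subgauss_growth g p x s : growth g -> pweight p -> s ^+ 2 < 1 ->
  subgauss (fun z => g (x + s * z) * p z).
Proof.
move=> gg [_ [D [i Hp]]] s1.
pose q := 1 - s ^+ 2; have q0 : 0 < q by rewrite subr_gt0.
have q1 : q <= 1 by rewrite gerBl sqr_ge0.
have [C [c [C0 c2 H]]] := growth_affine `|x| gg q0 q1.
pose d := (c + 1 / 2) / 2.
have cd : c < d by rewrite /d; lra.
have d2 : d < 1 / 2 by rewrite /d; lra.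
have [M M0 HM] := pow_le_exp i cd.
have D0 : 0 <= D by have := Hp 0; rewrite normr0 addr0 expr1n mulr1; exact: le_trans.
exists d, (C * D * M); split => // [|z]; first by rewrite !mulr_ge0.
rewrite normrM; apply: (@le_trans _ _ (C * expR (c * z ^+ 2) * (D * (1 + `|z|) ^+ i))).
  by apply: ler_pM => //; apply: H => //; rewrite /q opprB addrCA subrr addr0.
rewrite mulrACA -[leRHS]mulrA ler_wpM2l ?mulr_ge0// mulrC; exact: HM.
Qed.

Section ibp.
Variables (f eta : R -> R).
Hypotheses (lf : llip f) (me : measurable_fun setT eta)
  (de : {ae mu, forall x : R, is_derive x (1 : R) f (eta x)}) (ge : growth eta).

Let gf : growth f. Proof. exact: growth_antiderivative de ge. Qed.
Let mf : measurable_fun setT f. Proof. exact: continuous_measurable_fun (llip_continuous lf). Qed.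

Lemma ibp_affine a b p dp : 0 < b -> b ^+ 2 < 1 -> (forall z, is_derive z (1 : R) p (dp z)) ->
  continuous dp -> pweight p -> pweight dp ->
  gE (fun z => f (a + b * z) * (p z * z)) =
  b * gE (fun z => eta (a + b * z) * p z) + gE (fun z => f (a + b * z) * dp z).
Proof.
move=> b0 b1 dpp cdp wp wdp.
have s1 := subgauss_growth a gf wp b1.
have s2 := subgauss_growth a ge wp b1.
have s3 := subgauss_growth a gf wdp b1.
have i2 := gint_growth a ge me wp b1.
have i3 := gint_growth a gf mf wdp b1.
have [c [C [c2 C0 H1 H2]]] := subgauss2 s1 (subgaussD (subgaussZ b s2) s3).
rewrite -gEZ// -gED//; last exact: gintZ.
rewrite -(stein_ibp c2 C0 _ _ _ H1 H2).
- by rewrite /gE; congr (\int[N]_z _); apply/funext => z; rewrite mulrA.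
- apply: llipM; first exact: llip_affine.
  exact: continuous_llip dpp cdp.
- by apply: measurable_funD; [apply: gint_measurable; exact: gintZ|exact: gint_measurable].
- have := ae_affine a b0 de; apply: (@filterS _ _ (ae_filter_ringOfSetsType mu)) => z.
  move: (z : R) => {}z dz; have d1 := dpp z.
  have d2 : is_derive z (1 : R) (fun z => a + b * z) b.
    by apply: is_derive_eq; rewrite /GRing.scale/=; ring.
  have d3 : is_derive z (1 : R) (fun z => f (a + b * z)) (eta (a + b * z) * b).
    exact: is_derive1_comp.
  by apply: is_derive_eq; rewrite /GRing.scale/=; ring.
Qed.

Lemma ibp1 a b : 0 < b -> b ^+ 2 < 1 ->
  gE (fun z => f (a + b * z) * z) = b * gE (fun z => eta (a + b * z)).
Proof.
move=> b0 b1; have := @ibp_affine a b (cst 1) (cst 0) b0 b1 _ _ (pweight_cst 1) (pweight_cst 0).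
have e1 : gE (fun z => f (a + b * z) * cst 0 z) = 0.
  by rewrite -[RHS](gE_cst 0); congr (\int[N]_z _); apply/funext => z; rewrite /= mulr0.
rewrite e1 addr0 /= => H; transitivity (gE (fun z => f (a + b * z) * (1 * z))).
  by congr (\int[N]_z _); apply/funext => z; rewrite mul1r.
rewrite H; last by move=> z; exact: cvg_cst.
by congr (_ * _); congr (\int[N]_z _); apply/funext => z; rewrite mulr1.
Qed.

Lemma ibp2 a b : 0 < b -> b ^+ 2 < 1 ->
  gE (fun z => f (a + b * z) * (z * z)) =
  b * gE (fun z => eta (a + b * z) * z) + gE (fun z => f (a + b * z)).
Proof.
move=> b0 b1; have := @ibp_affine a b id (cst 1) b0 b1 _ _ pweight_id (pweight_cst 1).
move=> -> //; last by move=> z; exact: cvg_cst.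
by congr (_ + _); congr (\int[N]_z _); apply/funext => z; rewrite mulr1.
Qed.

End ibp.

Section smoothing.
Variables (f eta : R -> R).
Hypotheses (lf : llip f) (me : measurable_fun setT eta)
  (de : {ae mu, forall x : R, is_derive x (1 : R) f (eta x)}) (ge : growth eta).

Let gf : growth f. Proof. exact: growth_antiderivative de ge. Qed.
Let cf : continuous f. Proof. exact: llip_continuous. Qed.
Let mf : measurable_fun setT f. Proof. exact: continuous_measurable_fun. Qed.

Let Phi := antiderivative f.

Let fi a b : mu.-integrable `[a, b] (EFin \o f).
Proof.
by apply: continuous_compact_integrable; [exact: segment_compact|exact: continuous_subspaceT].
Qed.
Let dPhi x : is_derive x (1 : R) Phi (f x).
Proof. exact: continuous_antiderivative. Qed.
Let lPhi : llip Phi. Proof. exact: continuous_llip dPhi cf. Qed.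
Let aePhi : {ae mu, forall x : R, is_derive x (1 : R) Phi (f x)}.
Proof. by apply: aeW => x. Qed.
Let gPhi : growth Phi. Proof. exact: growth_antiderivative aePhi gf. Qed.
Let mPhi : measurable_fun setT Phi.
Proof. exact: continuous_measurable_fun (llip_continuous lPhi). Qed.

Let pz2 : pweight (fun z : R => z * z).
Proof. by apply: pweightM; exact: pweight_id. Qed.

Let gint0 g x s : growth g -> measurable_fun setT g -> s ^+ 2 < 1 -> gint (fun z => g (x + s * z)).
Proof.
move=> gg mg s1; have := gint_growth x gg mg (pweight_cst 1) s1.
by under eq_fun do rewrite /= mulr1.
Qed.

(** As [f] is only locally Lipschitz, its average is first written as [(b t)^-1] times that of
    [Phi (a t + b t * z) * z], where the antiderivative [Phi] is continuously differentiable.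
    Differentiation under the integral and integration by parts lead to averages of [eta]; the
    leftover average of [f] cancels against the derivative of [(b t)^-1]. *)
Lemma heat (a b da db : R -> R) u v B q : 0 < q -> q <= 1 ->
  (forall t, u < t -> t < v -> [/\ `|a t| <= B, b t ^+ 2 <= 1 - q, `|da t| <= B & `|db t| <= B]) ->
  (forall t, u < t -> t < v -> is_derive t (1 : R) a (da t) /\ is_derive t (1 : R) b (db t)) ->
  (forall t, u < t -> t < v -> 0 < b t) ->
  forall t, u < t -> t < v ->
  is_derive t (1 : R) (fun t => gE (fun z => f (a t + b t * z)))
    (da t * gE (fun z => eta (a t + b t * z)) + db t * gE (fun z => eta (a t + b t * z) * z)).
Proof.
move=> q0 q1 H dab b0 t ut tv.
have b1 s : u < s -> s < v -> b s ^+ 2 < 1.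
  by move=> us sv; have [_ h _ _] := H _ us sv; apply: le_lt_trans h _; lra.
have D := @is_derive_gE _ Phi f id a b da db u v B q gPhi gf dPhi cf pweight_id q0 q1 H dab t ut tv.
have e : gE (fun z => f (a t + b t * z) * ((da t + db t * z) * id z)) =
   da t * gE (fun z => f (a t + b t * z) * z) + db t * gE (fun z => f (a t + b t * z) * (z * z)).
  rewrite -!gEZ; last 2 first.
  - exact: gint_growth (b1 _ ut tv).
  - exact: gint_growth pweight_id (b1 _ ut tv).
  rewrite -gED; last 2 first.
  - by apply: gintZ; exact: gint_growth pweight_id (b1 _ ut tv).
  - by apply: gintZ; exact: gint_growth (b1 _ ut tv).
  by congr (\int[N]_z _); apply/funext => z /=; ring.
rewrite {}e (ibp1 lf me de ge _ (b0 _ ut tv) (b1 _ ut tv)) (ibp2 lf me de ge _ (b0 _ ut tv) (b1 _ ut tv)) in D.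
have [_ db'] := dab _ ut tv.
have bn : b t != 0 by rewrite gt_eqF// b0.
pose G s := (b s)^-1 * gE (fun z => Phi (a s + b s * z) * z).
have GE s : u < s -> s < v -> gE (fun z => f (a s + b s * z)) = G s.
  move=> us sv; rewrite /G (ibp1 lPhi mf aePhi gf _ (b0 _ us sv) (b1 _ us sv)).
  by rewrite mulrA mulVf ?mul1r// gt_eqF// b0.
have dG : is_derive t (1 : R) G (da t * gE (fun z => eta (a t + b t * z)) + db t * gE (fun z => eta (a t + b t * z) * z)).
  have dV := is_deriveV bn db'.
  rewrite /G; apply: is_derive_eq; rewrite /GRing.scale/=.
  rewrite (ibp1 lPhi mf aePhi gf _ (b0 _ ut tv) (b1 _ ut tv)).
  by field.
apply: (near_eq_is_derive (f := G)) dG.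
by near=> s; rewrite GE//; near: s; [exact: lt_nbhsr|exact: lt_nbhsl].
Unshelve. all: by end_near. Qed.

(** Two integrations by parts turn the average of the merely measurable [eta] into [(b ^+ 2)^-1]
    times that of [Phi] against [p], the second Hermite polynomial. There [w] sits in a smooth
    function; differentiating and integrating by parts once gives the formula. *)
Lemma smoothing_is_derive rho b w : 0 < b -> b ^+ 2 < 1 ->
  is_derive w (1 : R) (fun w => gE (fun z => eta (rho * w + b * z)))
    (rho / b * gE (fun z => eta (rho * w + b * z) * z)).
Proof.
move=> b0 b1.
pose p (z : R) := z * z + -1.
have wp : pweight p by apply: pweightD => //; exact: pweight_cst.
pose q := 1 - b ^+ 2; have q0 : 0 < q by rewrite subr_gt0.
have q1 : q <= 1 by rewrite gerBl sqr_ge0.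
pose B := `|rho| * (`|w| + 1) + `|rho|.
have D := @is_derive_gE _ Phi f p (fun w => rho * w) (cst b) (cst rho) (cst 0) (w - 1) (w + 1) B q
  gPhi gf dPhi cf wp q0 q1.
have {}D : is_derive w (1 : R) (fun w => gE (fun z => Phi (rho * w + b * z) * p z))
   (gE (fun z => f (rho * w + b * z) * ((rho + 0 * z) * p z))).
  apply: D; [|move=> t _ _; split|lra|lra].
  - move=> t t1 t2; rewrite /B /q /= normr0; split => //.
    + rewrite normrM ler_wpDr// ler_wpM2l// -[t](subrK w) addrC (le_trans (ler_normD _ _))// lerD2l.
      by rewrite ler_norml; apply/andP; split; lra.
    + by rewrite opprB addrCA subrr addr0.
    + by rewrite lerDr mulr_ge0// addr_ge0.
  - by apply: is_derive_eq; rewrite /GRing.scale/=; ring.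
  - exact: is_derive_cst.
have E2 (F F' : R -> R) t : growth F -> measurable_fun setT F ->
  gE (fun z => F (rho * t + b * z) * p z) =
  gE (fun z => F (rho * t + b * z) * (z * z)) - gE (fun z => F (rho * t + b * z)).
  move=> gF mF; rewrite -gEB; last 2 first.
  - exact: gint_growth.
  - exact: gint0.
  by congr (\int[N]_z _); apply/funext => z /=; rewrite /p; ring.
have e : gE (fun z => f (rho * w + b * z) * ((rho + 0 * z) * p z)) =
    rho * (b * gE (fun z => eta (rho * w + b * z) * z)).
  transitivity (rho * gE (fun z => f (rho * w + b * z) * p z)).
    rewrite -gEZ; last exact: gint_growth.
    by congr (\int[N]_z _); apply/funext => z /=; ring.
  by rewrite E2// (ibp2 lf me de ge _ b0 b1) addrK.
rewrite {}e in D.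
have eE t : gE (fun z => eta (rho * t + b * z)) = (b ^+ 2)^-1 * gE (fun z => Phi (rho * t + b * z) * p z).
  rewrite E2// (ibp2 lPhi mf aePhi gf _ b0 b1) addrK (ibp1 lf me de ge _ b0 b1).
  by field; rewrite gt_eqF.
rewrite (_ : (fun w => _) = (fun t => (b ^+ 2)^-1 * gE (fun z => Phi (rho * t + b * z) * p z))); last exact/funext.
apply: is_derive_eq; rewrite /GRing.scale/=; field; by rewrite gt_eqF.
Qed.

End smoothing.
End heat.

(** * The Ornstein-Uhlenbeck semigroup *)

Section ornstein_uhlenbeck.
Context {R : realType}.
Implicit Types (g p : R -> R) (w c d C x z s q t B : R).
Notation mu := (@lebesgue_measure R).
Notation N := (@normal_prob R 0 1).

Definition rho s : R := expR (- s).
Definition sig s : R := Num.sqrt (1 - expR (- (2 * s))).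

Lemma rho_gt0 s : 0 < rho s. Proof. exact: expR_gt0. Qed.

Lemma rho_lt1 s : 0 < s -> rho s < 1.
Proof. by move=> s0; rewrite -[ltRHS]expR0 ltr_expR oppr_lt0. Qed.

Lemma rho_sqr s : rho s ^+ 2 = expR (- (2 * s)).
Proof. by rewrite /rho expr2 -expRD; congr expR; ring. Qed.

Lemma sig_gt0 s : 0 < s -> 0 < sig s.
Proof.
move=> s0; rewrite sqrtr_gt0 subr_gt0 -rho_sqr.
by rewrite exprn_ilt1 ?rho_lt1// ltW// rho_gt0.
Qed.

Lemma rho_sig s : 0 < s -> rho s ^+ 2 + sig s ^+ 2 = 1.
Proof.
move=> s0; rewrite /sig sqr_sqrtr; first by rewrite rho_sqr addrCA subrr addr0.
have := sig_gt0 s0; rewrite sqrtr_gt0; exact: ltW.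
Qed.

(** Negative [s] is included, where [Num.sqrt] returns 0: continuity at [s = 0] is proved on a
    two-sided neighbourhood. *)
Lemma sig_sqr_le s : sig s ^+ 2 <= Num.max 0 (1 - rho s ^+ 2).
Proof.
rewrite /sig rho_sqr le_max; have [h|h] := leP 0 (1 - expR (- (2 * s))).
  by rewrite sqr_sqrtr// lexx orbT.
by rewrite ltr0_sqrtr// expr0n lexx.
Qed.

Lemma sig_sqr_lt1 s : 0 < s -> sig s ^+ 2 < 1.
Proof. by move=> s0; rewrite -(rho_sig s0) ltrDr exprn_gt0// rho_gt0. Qed.

Lemma sig_le1 s : 0 < s -> sig s <= 1.
Proof. by move=> s0; have := sqr_ge0 (rho s); have := rho_sig s0; have := sig_gt0 s0; nra. Qed.

Lemma sig0 : sig 0 = 0.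
Proof. by rewrite /sig mulr0 oppr0 expR0 subrr sqrtr0. Qed.

Lemma rho0 : rho 0 = 1. Proof. by rewrite /rho oppr0 expR0. Qed.

Lemma le_rho s t : s <= t -> rho t <= rho s.
Proof. by move=> st; rewrite ler_expR lerN2. Qed.

Lemma le_rho2 s t : s <= t -> rho t ^+ 2 <= rho s ^+ 2.
Proof. by move=> st; rewrite !rho_sqr ler_expR lerN2 ler_pM2l. Qed.

Lemma le_sig s t : s <= t -> sig s <= sig t.
Proof. by move=> st; apply: ler_wsqrtr; rewrite lerD2l lerN2 ler_expR lerN2 ler_pM2l. Qed.

Lemma is_derive_rho s : is_derive s (1 : R) rho (- rho s).
Proof. by rewrite /rho; apply: is_derive_eq; rewrite /GRing.scale/=; ring. Qed.

Lemma is_derive_sig s : 0 < s -> is_derive s (1 : R) sig (rho s ^+ 2 / sig s).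
Proof.
move=> s0; have h : 0 < 1 - expR (- (2 * s)) by have := sig_gt0 s0; rewrite sqrtr_gt0.
have d1 : is_derive s (1 : R) (fun s => 1 - expR (- (2 * s))) (2 * expR (- (2 * s))).
  by apply: is_derive_eq; rewrite /GRing.scale/=; ring.
have d2 := is_derive1_sqrt h.
have d3 : is_derive s (1 : R) sig ((2 * sig s)^-1 * (2 * expR (- (2 * s)))).
  exact: is_derive1_comp.
apply: is_derive_eq; rewrite rho_sqr; field; rewrite gt_eqF//; exact: sig_gt0.
Qed.

Lemma continuous_rho : continuous rho.
Proof. exact: is_derive_continuous is_derive_rho. Qed.

Lemma continuous_sig : continuous sig.
Proof.
move=> s; apply: continuous_cvg; first exact: sqrt_continuous.
apply: cvgB; first exact: cvg_cst.
apply: continuous_cvg; first exact: continuous_expR.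
by apply: cvgN; apply: cvgM; [exact: cvg_cst|exact: cvg_id].
Qed.

Lemma cvg_rho : rho n.+1%:R @[n --> \oo] --> (0 : R).
Proof.
apply: (@cvg_comp _ _ _ (fun n : nat => n.+1%:R) rho); last exact: cvgr_expR.
rewrite (_ : (fun n : nat => _) = (fun n => (n + 1)%:R)); last by apply/funext => n; rewrite addn1.
by apply/cvgryPge => A; near=> n; rewrite natrD ler_wpDr//; near: n; exact: nbhs_infty_ger.
Unshelve. all: by end_near. Qed.

Lemma cvg_sig : sig n.+1%:R @[n --> \oo] --> (1 : R).
Proof.
have h : 1 - expR (- (2 * n.+1%:R)) @[n --> \oo] --> (1 : R).
  rewrite -[X in _ --> X]subr0; apply: cvgB; first exact: cvg_cst.
  under eq_fun do rewrite -rho_sqr expr2.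
  by rewrite -(mulr0 (0 : R)); apply: cvgM; exact: cvg_rho.
by have := cvg_comp _ _ h (@sqrt_continuous R 1); rewrite sqrtr1.
Qed.

Definition ou g s w := gE (fun z => g (rho s * w + sig s * z)).
Definition ouz g s w := gE (fun z => g (rho s * w + sig s * z) * z).

(** Two regimes. For [sig s <= 1 / 2] the contraction is strong enough for [growth_affine] with
    [q = 3 / 4]. For [sig s > 1 / 2], which includes large [s], where the contraction is lost in the
    limit, Mehler's bound applies with [1 / sig s <= 2]; there [1 + |z|] is at most [2 + 2 * B]
    times [1 + |rho s * w + sig s * z|], which moves the weight inside. *)
Lemma ou_bound i g B : measurable_fun setT g -> growth g ->
  gint (fun z => (1 + `|z|) ^+ i * g z) -> 0 <= B ->
  exists2 C, 0 <= C & forall s w, 0 < s -> `|w| <= B ->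
    gE (fun z => (1 + `|z|) ^+ i * `|g (rho s * w + sig s * z)|) <= C.
Proof.
move=> mg gg ig B0.
have wp : pweight (fun z : R => (1 + `|z|) ^+ i).
  split; first by apply: measurable_funX; apply: measurable_funD => //; exact: measurableT_comp.
  by exists 1, i => z; rewrite mul1r ger0_norm// exprn_ge0// addr_ge0.
have q0 : 0 < 3 / 4 :> R by lra.
have q1 : 3 / 4 <= 1 :> R by lra.
have [C1 [c [C10 c2 H]]] := growth_affine B gg q0 q1.
pose E1 := gE (fun z => (1 + `|z|) ^+ i * expR (c * z ^+ 2)).
pose E2 := gE (fun z => `|(1 + `|z|) ^+ i * g z|).
have E10 : 0 <= E1 by apply: gE_ge0 => z; rewrite mulr_ge0 ?expR_ge0// exprn_ge0// addr_ge0.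
have E20 : 0 <= E2 by apply: gE_ge0.
pose K := (2 + 2 * B) ^+ i.
have K0 : 0 <= K by rewrite exprn_ge0//; lra.
exists (C1 * E1 + K * (2 * expR (B ^+ 2 / 2) * E2)).
  by rewrite addr_ge0 ?mulr_ge0 ?expR_ge0.
move=> s w s0 wB; have s1 := sig_sqr_lt1 s0; have r1 := rho_lt1 s0; have r0 := rho_gt0 s.
have rw : `|rho s * w| <= B.
  by rewrite normrM gtr0_norm// (le_trans _ wB)// ler_piMl// ltW.
have i0 : gint (fun z => (1 + `|z|) ^+ i * `|g (rho s * w + sig s * z)|).
  have := gint_norm (gint_growth (rho s * w) gg mg wp s1).
  congr (integrable _ _ _); apply/funext => z /=; rewrite normrM mulrC; congr (_ * _)%:E.
  by rewrite ger0_norm// exprn_ge0// addr_ge0.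
have [sh|sh] := leP (sig s) (1 / 2).
  apply: (@le_trans _ _ (C1 * E1)); last by rewrite lerDl !mulr_ge0 ?expR_ge0.
  rewrite -gEZ; last exact: gint_exp_poly.
  apply: le_gE => // [|z]; first by apply: gintZ; exact: gint_exp_poly.
  rewrite mulrCA ler_wpM2l ?exprn_ge0 ?addr_ge0//.
  by apply: H => //; have := sig_gt0 s0; nra.
apply: (@le_trans _ _ (K * (2 * expR (B ^+ 2 / 2) * E2))); last by rewrite lerDr !mulr_ge0.
have g2 : gint (fun z => `|(1 + `|rho s * w + sig s * z|) ^+ i * g (rho s * w + sig s * z)|).
  exact: gint_norm (gint_affine w (sig_gt0 s0) (rho_sig s0) ig).
apply: (@le_trans _ _ (K * gE (fun z => `|(1 + `|rho s * w + sig s * z|) ^+ i * g (rho s * w + sig s * z)|))).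
  rewrite -gEZ//; apply: le_gE => // [|z]; first exact: gintZ.
  rewrite normrM [`|_ ^+ i|]ger0_norm; last by rewrite exprn_ge0// addr_ge0.
  rewrite mulrA ler_wpM2r// /K -exprMn lerXn2r ?nnegrE ?addr_ge0 ?mulr_ge0 ?addr_ge0//; first by rewrite mulr_ge0.
  have h1 : sig s * `|z| <= `|rho s * w + sig s * z| + B.
    rewrite -[X in X * `|z|](gtr0_norm (sig_gt0 s0)) -normrM.
    have e : sig s * z = (rho s * w + sig s * z) - rho s * w by ring.
    by rewrite {1}e (le_trans (ler_normB _ _))// lerD2l.
  move: (normr_ge0 z) (normr_ge0 (rho s * w + sig s * z)) h1.
  by move: `|z| `|_ + _| => a b a0 b0 h1; nra.
rewrite ler_wpM2l//; apply: le_trans (mehler_bound w (sig_gt0 s0) (rho_sig s0) ig) _.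
rewrite ler_wpM2r//; apply: ler_pM => //.
- by rewrite invr_ge0 ltW// sig_gt0.
- by rewrite -[leRHS]invrK lef_pV2 ?posrE ?sig_gt0//; lra.
- by rewrite ler_expR ler_wpM2r// -[leLHS]real_normK ?num_real// lerXn2r ?nnegrE.
Qed.

Lemma gint_ou g s w : measurable_fun setT g -> growth g -> 0 < s ->
  gint (fun z => g (rho s * w + sig s * z)).
Proof.
move=> mg gg s0; have := gint_growth (rho s * w) gg mg (pweight_cst 1) (sig_sqr_lt1 s0).
by under eq_fun do rewrite /= mulr1.
Qed.

Lemma gint_ouz g s w : measurable_fun setT g -> growth g -> 0 < s ->
  gint (fun z => g (rho s * w + sig s * z) * z).
Proof.
by move=> mg gg s0; have := gint_growth (rho s * w) gg mg pweight_id (sig_sqr_lt1 s0); exact.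
Qed.

Lemma ou_le g B : measurable_fun setT g -> growth g -> gint g -> 0 <= B ->
  exists2 C, 0 <= C & forall s w, 0 < s -> `|w| <= B -> `|ou g s w| <= C.
Proof.
move=> mg gg ig B0.
have ig' : gint (fun z => (1 + `|z|) ^+ 0 * g z) by under eq_fun do rewrite expr0 mul1r.
have [C C0 HC] := ou_bound mg gg ig' B0; exists C => // s w s0 wB.
apply: le_trans (HC s w s0 wB); apply: le_trans (le_norm_gE (gint_ou w mg gg s0)) _.
by rewrite le_eqVlt; apply/orP; left; apply/eqP; congr (\int[N]_z _); apply/funext => z; rewrite expr0 mul1r.
Qed.

Lemma ou_ouz_le g B : measurable_fun setT g -> growth g -> gint (fun z => (1 + `|z|) * g z) -> 0 <= B ->
  exists2 C, 0 <= C & forall s w, 0 < s -> `|w| <= B -> `|ou g s w| <= C /\ `|ouz g s w| <= C.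
Proof.
move=> mg gg ig B0.
have ig' : gint (fun z => (1 + `|z|) ^+ 1 * g z) by under eq_fun do rewrite expr1.
have [C C0 HC] := ou_bound mg gg ig' B0; exists C => // s w s0 wB.
have i1 := gint_norm (gint_ou w mg gg s0); have i2 := gint_norm (gint_ouz w mg gg s0).
have i3 : gint (fun z => (1 + `|z|) ^+ 1 * `|g (rho s * w + sig s * z)|).
  have := gintD i1 i2; congr (integrable _ _ _); apply/funext => z /=.
  by rewrite expr1 normrM; congr (_%:E); ring.
split; apply: le_trans (HC s w s0 wB).
  apply: le_trans (le_norm_gE (gint_ou w mg gg s0)) _; apply: le_gE => // z.
  by rewrite expr1 ler_peMl// lerDl.
apply: le_trans (le_norm_gE (gint_ouz w mg gg s0)) _; apply: le_gE => // z.
by rewrite expr1 normrM mulrC ler_wpM2r// lerDr.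
Qed.

Lemma continuous_flow g p s w : growth g -> continuous g -> pweight p ->
  {for s, continuous (fun s => gE (fun z => g (rho s * w + sig s * z) * p z))}.
Proof.
move=> gg cg wp; pose u := s - 1; pose v := s + 1.
(* The minimum with 1 covers [v <= 0], where [rho v] is at least 1. *)
pose q := Num.min 1 (rho v ^+ 2).
have q0 : 0 < q by rewrite lt_min ltr01 exprn_gt0// rho_gt0.
have q1 : q <= 1 by rewrite ge_min lexx.
apply: (@continuous_gE _ g p (fun s => rho s * w) sig u v (rho u * `|w|) q) => //.
- by move=> t; apply: cvgM; [exact: continuous_rho|exact: cvg_cst].
- exact: continuous_sig.
- move=> t ut tv; split.
    by rewrite normrM gtr0_norm ?rho_gt0// ler_wpM2r// le_rho// ltW.
  apply: le_trans (sig_sqr_le t) _; rewrite ge_max subr_ge0 q1 /= lerD2l lerN2 ge_min.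
  by apply/orP; right; rewrite le_rho2// ltW.
- by rewrite /u; lra.
- by rewrite /v; lra.
Qed.

Lemma ou_cvg0 g w : growth g -> continuous g -> ou g s w @[s --> 0] --> g w.
Proof.
move=> gg cg; have := @continuous_flow g (cst 1) 0 w gg cg (pweight_cst 1).
rewrite /prop_for /continuous_at /= rho0 sig0.
have -> : gE (fun z => g (1 * w + 0 * z) * cst 1 z) = g w.
  rewrite -[RHS](gE_cst (g w)); congr (\int[N]_z _); apply/funext => z /=.
  by rewrite mulr1 mul1r mul0r addr0.
by under eq_fun do under [X in gE X]eq_fun do rewrite /= mulr1.
Qed.

Lemma ou_cvgy g w : gint g -> ou g n.+1%:R w @[n --> \oo] --> gE g.
Proof.
move=> ig; apply: (gE_mixing w _ cvg_rho cvg_sig ig) => n.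
have n0 : (0 : R) < n.+1%:R by rewrite ltr0n.
by split; [exact: sig_gt0|exact: rho_sig].
Qed.

Section flow.
Variables (f eta : R -> R).
Hypotheses (lf : llip f) (me : measurable_fun setT eta)
  (de : {ae mu, forall x : R, is_derive x (1 : R) f (eta x)}) (ge : growth eta).

Let gf : growth f. Proof. exact: growth_antiderivative de ge. Qed.
Let cf : continuous f. Proof. exact: llip_continuous. Qed.
Let mf : measurable_fun setT f. Proof. exact: continuous_measurable_fun. Qed.

Lemma ou_ibp s w : 0 < s -> ouz f s w = sig s * ou eta s w.
Proof. by move=> s0; exact: (ibp1 lf me de ge _ (sig_gt0 s0) (sig_sqr_lt1 s0)). Qed.

Lemma is_derive_ou s w : 0 < s ->
  is_derive s (1 : R) (ou f ^~ w) (- (rho s * w) * ou eta s w + rho s ^+ 2 / sig s * ouz eta s w).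
Proof.
move=> s0; pose u := s / 2; pose v := s + 1.
have u0 : 0 < u by rewrite /u; lra.
(* The derivative of [sig] is unbounded near 0; to the right of [u = s / 2] it is at most
   [(sig u)^-1]. *)
pose B := `|w| + (sig u)^-1.
have q0 : 0 < rho v ^+ 2 by rewrite exprn_gt0// rho_gt0.
have v0 : 0 < v by rewrite /v; lra.
have q1 : rho v ^+ 2 <= 1 by rewrite exprn_ile1 ?ltW ?rho_gt0 ?rho_lt1.
apply: (@heat _ f eta lf me de ge (fun s => rho s * w) sig (fun s => - (rho s * w))
   (fun s => rho s ^+ 2 / sig s) u v B (rho v ^+ 2) q0 q1).
- move=> t ut tv; have t0 := lt_trans u0 ut.
  have h1 : `|rho t * w| <= B.
    rewrite /B ler_wpDr ?invr_ge0 ?sqrtr_ge0// normrM ler_piMl//.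
    by rewrite gtr0_norm ?rho_gt0// ltW// rho_lt1.
  split => //; last 2 first.
  + by rewrite normrN.
  + rewrite /B ler_wpDl// ger0_norm; last by rewrite divr_ge0 ?sqr_ge0// sqrtr_ge0.
    rewrite -[leRHS]mul1r; apply: ler_pM; rewrite ?sqr_ge0 ?invr_ge0 ?sqrtr_ge0//.
      by rewrite exprn_ile1 ?ltW ?rho_gt0 ?rho_lt1.
    by rewrite lef_pV2 ?posrE ?sig_gt0// le_sig// ltW.
  + rewrite lerBrDr addrC -(rho_sig t0) lerD2r.
    by rewrite le_rho2// ltW.
- move=> t ut tv; have t0 := lt_trans u0 ut; split; last exact: is_derive_sig.
  have dr := is_derive_rho t.
  by apply: is_derive_eq; rewrite /GRing.scale/=; ring.
- by move=> t ut tv; apply: sig_gt0; exact: lt_trans ut.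
- by rewrite /u; lra.
- by rewrite /v; lra.
Qed.

Lemma is_derive_ouw s w : 0 < s ->
  is_derive w (1 : R) (ou eta s) (rho s / sig s * ouz eta s w).
Proof.
by move=> s0; exact: (smoothing_is_derive lf me de ge (rho s) w (sig_gt0 s0) (sig_sqr_lt1 s0)).
Qed.

Lemma is_derive_ouw_lip s w : 0 < s -> is_derive w (1 : R) (ou f s) (rho s * ou eta s w).
Proof.
move=> s0; have q0 : 0 < rho s ^+ 2 by rewrite exprn_gt0// rho_gt0.
have q1 : rho s ^+ 2 <= 1 by rewrite exprn_ile1 ?ltW ?rho_gt0 ?rho_lt1.
pose B := rho s * (`|w| + 1) + rho s.
have r0 := rho_gt0 s.
have := @heat _ f eta lf me de ge (fun t => rho s * t) (cst (sig s)) (cst (rho s)) (cst 0)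
  (w - 1) (w + 1) B _ q0 q1.
rewrite /= => /(_ _ _ _ w) H.
apply: (is_derive_eq (H _ _ _ _ _)).
- move=> t t1 t2; rewrite /B normr0; split.
  + rewrite normrM gtr0_norm// ler_wpDr ?(ltW r0)// ler_wpM2l ?(ltW r0)//.
    rewrite -[t](subrK w) addrC (le_trans (ler_normD _ _))// lerD2l.
    by rewrite ler_norml; apply/andP; split; lra.
  + by rewrite -(rho_sig s0) addrAC subrr add0r.
  + by rewrite gtr0_norm// lerDr mulr_ge0 ?(ltW r0)// addr_ge0.
  + by rewrite addr_ge0 ?mulr_ge0 ?(ltW r0)// addr_ge0.
- move=> t _ _; split; last exact: is_derive_cst.
  by apply: is_derive_eq; rewrite /GRing.scale/=; ring.
- by move=> t _ _; exact: sig_gt0.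
- by lra.
- by lra.
- by rewrite mul0r addr0.
Qed.

Lemma continuous_ou_lip s w : 0 < s -> {for s, continuous (ou f ^~ w)}.
Proof.
by move=> s0; apply: differentiable_continuous; apply/derivable1_diffP; have [] := is_derive_ou w s0.
Qed.

Let continuous_quot (F G : R -> R) s : {for s, continuous F} -> {for s, continuous G} ->
  G s != 0 -> {for s, continuous (fun s => F s / G s)}.
Proof. by move=> cF cG G0; apply: cvgM => //; apply: cvgV. Qed.

(** [eta] is not continuous, so its average is read through integration by parts as
    [ouz f s w / sig s], an average of the continuous [f]. *)
Lemma continuous_ou s w : 0 < s -> {for s, continuous (ou eta ^~ w)}.
Proof.
move=> s0.
have c : {for s, continuous (fun s => ouz f s w / sig s)}.
  apply: continuous_quot; [exact: continuous_flow pweight_id|exact: continuous_sig|].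
  by rewrite gt_eqF// sig_gt0.
have e t : 0 < t -> ou eta t w = ouz f t w / sig t.
  by move=> t0; rewrite ou_ibp// mulrC mulKf// gt_eqF// sig_gt0.
change (ou eta t w @[t --> s] --> ou eta s w).
rewrite e//; apply: cvg_trans c; apply: near_eq_cvg.
by near=> t; rewrite e//; near: t; exact: lt_nbhsr.
Unshelve. all: by end_near. Qed.

(** The same device with the weight [z ^ 2 - 1], against which the average of [f] is
    [sig s * ouz eta s w]. *)
Lemma continuous_ouz s w : 0 < s -> {for s, continuous (ouz eta ^~ w)}.
Proof.
move=> s0; pose p (z : R) := z * z + -1.
have wp : pweight p.
  by apply: pweightD; [apply: pweightM; exact: pweight_id|exact: pweight_cst].
pose G t := gE (fun z => f (rho t * w + sig t * z) * p z).
have c : {for s, continuous (fun s => G s / sig s)}.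
  apply: continuous_quot; [exact: continuous_flow|exact: continuous_sig|].
  by rewrite gt_eqF// sig_gt0.
have e t : 0 < t -> ouz eta t w = G t / sig t.
  move=> t0; have -> : G t = gE (fun z => f (rho t * w + sig t * z) * (z * z)) - ou f t w.
    rewrite -gEB; last 2 first.
    - by apply: (gint_growth _ gf mf _ (sig_sqr_lt1 t0)); apply: pweightM; exact: pweight_id.
    - exact: gint_ou.
    by congr (\int[N]_z _); apply/funext => z; rewrite /p; ring.
  rewrite (ibp2 lf me de ge _ (sig_gt0 t0) (sig_sqr_lt1 t0)) addrK.
  by rewrite mulrC mulKf// gt_eqF// sig_gt0.
change (ouz eta t w @[t --> s] --> ouz eta s w).
rewrite e//; apply: cvg_trans c; apply: near_eq_cvg.
by near=> t; rewrite e//; near: t; exact: lt_nbhsr.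
Unshelve. all: by end_near. Qed.

End flow.
End ornstein_uhlenbeck.

(** * Integrals over the half-line of times *)

Section half_line.
Context {R : realType}.
Implicit Types (g G : R -> R) (w c d C x z s q t B : R).
Notation mu := (@lebesgue_measure R).
Notation N := (@normal_prob R 0 1).
Notation D := (`]0, +oo[%classic : set R).

Lemma measurable_half g : (forall s, 0 < s -> {for s, continuous g}) -> measurable_fun D g.
Proof.
move=> cg; apply: open_continuous_measurable_fun; first exact: interval_open.
by move=> s; rewrite inE/= in_itv/= andbT => s0; exact: cg.
Qed.

Let a_ n : R := n.+1%:R^-1.
Let b_ n : R := n.+1%:R.
Let I_ n : set R := `[a_ n, b_ n]%classic.

Let a0 n : 0 < a_ n. Proof. by rewrite invr_gt0. Qed.
Let ab n : a_ n <= b_ n.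
Proof. by rewrite (@le_trans _ _ 1)// ?invf_le1// ler1n. Qed.
Let ID n : I_ n `<=` D.
Proof. by move=> s; rewrite /I_ /= !in_itv/= andbT => /andP[h _]; exact: lt_le_trans h. Qed.

Lemma ftc_segment G g a b : 0 < a -> a <= b -> (forall s, 0 < s -> is_derive s (1 : R) G (g s)) ->
  (forall s, 0 < s -> {for s, continuous g}) ->
  (\int[mu]_(s in `[a, b]) (g s)%:E = (G b - G a)%:E)%E.
Proof.
move=> a0' ab' dG cg.
have cG s : 0 < s -> {for s, continuous G}.
  by move=> s0; apply: differentiable_continuous; apply/derivable1_diffP; have [] := dG s s0.
move: ab'; rewrite le_eqVlt => /predU1P[<-|ab'].
  by rewrite set_itv1 integral_set1 subrr.
rewrite (@continuous_FTC2 R g G a b)//.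
- apply: continuous_in_subspaceT => s; rewrite inE/= in_itv/= => /andP[h _].
  by apply: cg; exact: lt_le_trans h.
- split.
  + by move=> s; rewrite in_itv/= => /andP[h _]; have [] := dG s (lt_trans a0' h).
  + exact/cvg_at_right_filter/cG.
  + by apply/cvg_at_left_filter/cG; exact: lt_trans ab'.
- move=> s; rewrite in_itv/= => /andP[h _]; rewrite derive1E.
  by have [] := dG s (lt_trans a0' h).
Qed.

(** Monotone convergence along the segments [I_ n]: on each the integral is an increment of [G], at
    most [2 * M]. *)
Lemma integrable_half_ge0 G g M : (forall s, 0 < s -> is_derive s (1 : R) G (g s)) ->
  (forall s, 0 < s -> {for s, continuous g}) -> (forall s, 0 < s -> 0 <= g s) ->
  (forall s, 0 < s -> `|G s| <= M) -> mu.-integrable D (EFin \o g).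
Proof.
move=> dG cg g0 GM; have mg := measurable_half cg.
have mG : measurable_fun D (EFin \o g) by exact/measurable_EFinP.
apply/integrableP; split => //.
have cover : \bigcup_n I_ n = D.
  apply/seteqP; split => [s [n _]|s]; first exact: ID.
  rewrite /= in_itv/= andbT => s0.
  have [n hn] : exists n : nat, s <= n.+1%:R /\ s^-1 <= n.+1%:R.
    exists (maxn (Num.bound s) (Num.bound s^-1)); split.
      apply: ltW; apply: lt_le_trans (archi_boundP (ltW s0)) _.
      by rewrite ler_nat leqW// leq_maxl.
    have si : 0 <= s^-1 by rewrite invr_ge0 ltW.
    apply: ltW; apply: lt_le_trans (archi_boundP si) _.
    by rewrite ler_nat leqW// leq_maxr.
  exists n => //; rewrite /I_ /= in_itv/= hn.1 andbT /a_ -[leRHS]invrK lef_pV2 ?posrE ?invr_gt0//.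
  exact: hn.2.
have nd : nondecreasing_seq I_.
  move=> m n mn; apply/subsetPset; apply: subset_itv; rewrite bnd_simp.
    by rewrite /a_ lef_pV2 ?posrE// ler_nat.
  by rewrite /b_ ler_nat.
have mgI n : measurable_fun (I_ n) (EFin \o g) by exact: measurable_funS (@ID n) mG.
have g0I n s : I_ n s -> (0 <= (EFin \o g) s)%E.
  by move=> /ID; rewrite /= in_itv/= andbT lee_fin => /g0.
have L := @ge0_nondecreasing_set_cvg_integral _ (measurableTypeR R) R I_ (EFin \o g) mu nd (fun n => measurable_itv _) mgI g0I.
rewrite cover in L.
apply: (@le_lt_trans _ _ (\int[mu]_(s in D) (g s)%:E)%E).
  rewrite le_eqVlt; apply/orP; left; apply/eqP; apply: eq_integral => s; rewrite inE/= in_itv/= andbT => s0.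
  by rewrite ger0_norm// g0.
apply: (@le_lt_trans _ _ (2 * M)%:E); last exact: ltry.
rewrite -(cvg_lim _ L)//; apply: lime_le; first by apply/cvg_ex; eexists; exact: L.
apply: nearW => n /=; rewrite (ftc_segment (a0 n) (ab n) dG cg) lee_fin.
apply: le_trans (ler_norm _) _; apply: le_trans (ler_normB _ _) _.
by rewrite mulrDl mul1r lerD// GM.
Qed.

Lemma ftc_half G g (l0 l1 : R) : (forall s, 0 < s -> is_derive s (1 : R) G (g s)) ->
  (forall s, 0 < s -> {for s, continuous g}) -> mu.-integrable D (EFin \o g) ->
  G n.+1%:R^-1 @[n --> \oo] --> l0 -> G n.+1%:R @[n --> \oo] --> l1 ->
  \int[mu]_(s in D) g s = l1 - l0.
Proof.
move=> dG cg ig L0 L1; have mg := measurable_half cg.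
have mG : measurable_fun D (EFin \o g) by exact/measurable_EFinP.
have lim2 : G (b_ n) - G (a_ n) @[n --> \oo] --> l1 - l0 by exact: cvgB.
have lim1 : G (b_ n) - G (a_ n) @[n --> \oo] --> \int[mu]_(s in D) g s.
  rewrite (_ : (fun n => _) = (fun n => fine (\int[mu]_(s in I_ n) (g s)%:E)%E)); last first.
    by apply/funext => n; rewrite (ftc_segment (a0 n) (ab n) dG cg).
  apply: fine_cvg; rewrite fineK; last exact: integrable_fin_num.
  pose F (n : nat) (x : R) : \bar R := ((EFin \o g) \_ (I_ n)) x.
  rewrite (_ : (fun n : nat => _) = (fun n => (\int[mu]_(x in D) F n x)%E)); last first.
    apply/funext => n; rewrite /F -integral_mkcondr; congr (integral _ _ _).
    by rewrite setIidr//; exact: ID.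
  have mF n : measurable_fun D (F n).
    apply/(measurable_restrict _ _ _) => //; first exact: measurable_itv.
    rewrite setIidr//; exact: measurable_funS (@ID n) mG.
  have cF : {ae mu, forall x, D x -> F n x @[n --> \oo] --> (EFin \o g) x}.
    apply: aeW => x; rewrite /= in_itv/= andbT => x0; apply: cvg_near_cst; near=> n.
    rewrite /F patchE ifT// inE /I_ /= in_itv/=; apply/andP; split.
      rewrite /a_ -[leRHS]invrK lef_pV2 ?posrE ?invr_gt0//.
      apply: (@le_trans _ _ n%:R); last by rewrite ler_nat.
      by near: n; exact: nbhs_infty_ger.
    apply: (@le_trans _ _ n%:R); last by rewrite ler_nat.
    by near: n; exact: nbhs_infty_ger.
  have iN : mu.-integrable D (EFin \o (fun x => `|g x|)) by exact: integrable_norm.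
  have bF : {ae mu, forall x n, D x -> (`|F n x| <= (EFin \o (fun x => `|g x|)%R) x)%E}.
    by apply: aeW => x n _; rewrite /F patchE; case: ifPn => _; rewrite /= ?normr0 lee_fin.
  have DC := @dominated_convergence _ _ _ mu D (measurable_itv _) F (EFin \o g) (EFin \o (fun x => `|g x|)).
  by have [_ _] := DC mF mG cF iN bF.
exact: (cvg_unique _ lim1 lim2).
Unshelve. all: by end_near. Qed.

Lemma is_derive_half (F dF : R -> R -> R) w : (forall w, mu.-integrable D (EFin \o F w)) ->
  (forall s w, 0 < s -> is_derive w (1 : R) (F ^~ s) (dF w s)) ->
  (forall B, 0 <= B -> exists2 H, mu.-integrable D (EFin \o H) &
     forall s w, 0 < s -> `|w| <= B -> `|dF w s| <= H s) ->
  is_derive w (1 : R) (fun w => \int[mu]_(s in D) F w s) (\int[mu]_(s in D) dF w s).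
Proof.
move=> iF dFF dom; have B0 : 0 <= `|w| + 1 by rewrite addr_ge0.
have [H iH HH] := dom _ B0.
have Iw : (`]w - 1, w + 1[%classic : set R) w by rewrite /= in_itv/=; apply/andP; split; lra.
have xB x : (`]w - 1, w + 1[%classic : set R) x -> `|x| <= `|w| + 1.
  rewrite /= in_itv/= => /andP[x1 x2].
  rewrite -[x](subrK w) addrC (le_trans (ler_normD _ _))// lerD2l.
  by rewrite ler_norml; apply/andP; split; lra.
have pF x s : D s -> partial1of2 F x s = dF x s.
  by rewrite /= in_itv/= andbT => s0; rewrite partial1of2E; have [] := dFF s x s0.
have h1 x : (`]w - 1, w + 1[%classic : set R) x -> mu.-integrable D (EFin \o F x) by [].
have h2 x s : (`]w - 1, w + 1[%classic : set R) x -> D s -> derivable (F ^~ s) x 1.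
  by move=> _; rewrite /= in_itv/= andbT => s0; have [] := dFF s x s0.
pose H' (s : R) : R := `|H s|.
have h3 (s : R) : 0 <= H' s by exact: normr_ge0.
have h4 : mu.-integrable D (EFin \o H') by exact: integrable_norm.
have h5 x s : (`]w - 1, w + 1[%classic : set R) x -> D s -> `|partial1of2 F x s| <= H' s.
  move=> /xB xb Ds; rewrite pF//; move: Ds; rewrite /= in_itv/= andbT => s0.
  by apply: le_trans (ler_norm _); apply: HH.
have -> : \int[mu]_(s in D) dF w s = \int[mu]_(s in D) partial1of2 F w s.
  by apply: eq_Rintegral => s; rewrite inE => Ds; rewrite pF.
have mD : measurable D by exact: measurable_itv.
apply: DeriveDef.
  exact: (@derivable_under_integral R _ _ mu F D mD w _ _ Iw h1 h2 H' h3 h4 h5).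
by rewrite -derive1E; exact: (@differentiation_under_integral R _ _ mu F D mD w _ _ Iw h1 h2 H' h3 h4 h5).
Qed.

Lemma integrable_half_le g H : (forall s, 0 < s -> {for s, continuous g}) ->
  mu.-integrable D (EFin \o H) -> (forall s, 0 < s -> `|g s| <= H s) ->
  mu.-integrable D (EFin \o g).
Proof.
move=> cg iH gH; apply: le_integrable iH => //.
  by apply/measurable_EFinP; exact: measurable_half.
move=> s; rewrite /= in_itv/= andbT lee_fin => s0.
by apply: le_trans (gH s s0) (ler_norm _).
Qed.

Lemma integrable_halfZ c g : mu.-integrable D (EFin \o g) ->
  mu.-integrable D (EFin \o (fun s => c * g s)).
Proof.
move=> ig; rewrite (_ : EFin \o _ = (fun s => c%:E * (EFin \o g) s)%E); first exact: integrableZl.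
by apply/funext => s /=; rewrite EFinM.
Qed.

Lemma continuous_rhoX k : continuous (fun s : R => rho s ^+ k).
Proof.
move=> s; elim: k => [|k ih]; first by under eq_fun do rewrite expr0; exact: cvg_cst.
by under eq_fun do rewrite exprS; apply: cvgM => //; exact: continuous_rho.
Qed.

Lemma is_derive_rhoX k s : is_derive s (1 : R) (fun s => rho s ^+ k) (- (k%:R * rho s ^+ k)).
Proof.
elim: k => [|k ih].
  by under eq_fun do rewrite expr0; rewrite mul0r oppr0; exact: is_derive_cst.
have dr := is_derive_rho s.
under eq_fun do rewrite exprS.
by apply: is_derive_eq; rewrite /GRing.scale/= exprS -natr1; ring.
Qed.

Lemma rhoX_le k s : 0 < s -> rho s ^+ k.+1 <= rho s.
Proof.
move=> s0; rewrite exprS ler_piMr ?(ltW (rho_gt0 _))//.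
by rewrite exprn_ile1 ?ltW ?rho_gt0 ?rho_lt1.
Qed.

Let is_deriveNM (f : R -> R) x d c : is_derive x (1 : R) f d ->
  is_derive x (1 : R) (fun s => - (c * f s)) (- (c * d)).
Proof. by move=> df; apply: is_derive_eq; rewrite /GRing.scale/=; ring. Qed.

Let is_derive_rhoX_prim k s : 0 < s ->
  is_derive s (1 : R) (fun s => - (k.+1%:R^-1 * rho s ^+ k.+1)) (rho s ^+ k.+1).
Proof.
move=> _; have d := is_derive_rhoX k.+1 s.
have kn : k.+1%:R != 0 :> R by rewrite pnatr_eq0.
by apply: (is_derive_eq (is_deriveNM _ d)); rewrite mulrN opprK mulKf.
Qed.

Lemma integrable_rhoX k : mu.-integrable D (EFin \o (fun s => rho s ^+ k.+1)).
Proof.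
apply: (@integrable_half_ge0 (fun s => - (k.+1%:R^-1 * rho s ^+ k.+1)) _ 1).
- exact: is_derive_rhoX_prim.
- by move=> s _; exact: continuous_rhoX.
- by move=> s _; rewrite exprn_ge0// ltW// rho_gt0.
- move=> s s0; have r0 := ltW (rho_gt0 s).
  rewrite normrN normrM ger0_norm ?invr_ge0// ger0_norm ?exprn_ge0//.
  apply: mulr_ile1; rewrite ?invr_ge0 ?exprn_ge0//; first by rewrite invf_le1// ler1n.
  by apply: le_trans (rhoX_le k s0) _; exact/ltW/rho_lt1.
Qed.

Lemma Rintegral_rhoX k : \int[mu]_(s in D) (rho s ^+ k.+1) = k.+1%:R^-1.
Proof.
transitivity (0 - - k.+1%:R^-1 : R); last by rewrite sub0r opprK.
apply: (@ftc_half (fun s => - (k.+1%:R^-1 * rho s ^+ k.+1)) _ (- k.+1%:R^-1) 0).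
- exact: is_derive_rhoX_prim.
- by move=> s _; exact: continuous_rhoX.
- exact: integrable_rhoX.
- apply: cvgN; rewrite -[X in _ --> X]mulr1; apply: cvgM; first exact: cvg_cst.
  have h := @continuous_rhoX k.+1 0; rewrite /continuous_at rho0 expr1n in h.
  exact: (cvg_comp _ _ (@cvg_harmonic R) h).
- rewrite -oppr0; apply: cvgN; rewrite -(mulr0 k.+1%:R^-1); apply: cvgM; first exact: cvg_cst.
  elim: k => [|k ih]; first exact: cvg_rho.
  by under eq_fun do rewrite exprS; rewrite -(mul0r (0 : R)); apply: cvgM => //; exact: cvg_rho.
Qed.

Lemma continuous_dsig s : 0 < s -> {for s, continuous (fun s : R => rho s ^+ 2 / sig s)}.
Proof.
move=> s0; apply: cvgM; first exact: continuous_rhoX.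
by apply: cvgV; [rewrite gt_eqF// sig_gt0|exact: continuous_sig].
Qed.

(** Near 0 the integrand behaves like the inverse square root of [2 * s]; it is integrable as the
    derivative of the bounded function [sig]. *)
Lemma integrable_dsig : mu.-integrable D (EFin \o (fun s => rho s ^+ 2 / sig s)).
Proof.
apply: (@integrable_half_ge0 sig _ 1).
- exact: is_derive_sig.
- exact: continuous_dsig.
- by move=> s s0; rewrite divr_ge0 ?exprn_ge0 ?ltW ?rho_gt0 ?sig_gt0.
- by move=> s s0; rewrite gtr0_norm ?sig_gt0// sig_le1.
Qed.

(** [sig] increases from 0 to 1. This value is why E |Z P1(Z)| enters the final bound with no extra
    numerical factor. *)
Lemma Rintegral_dsig : \int[mu]_(s in D) (rho s ^+ 2 / sig s) = 1.
Proof.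
transitivity (1 - 0 : R); last by rewrite subr0.
apply: (@ftc_half sig _ 0 1).
- exact: is_derive_sig.
- exact: continuous_dsig.
- exact: integrable_dsig.
- have h := @continuous_sig R 0; rewrite /continuous_at sig0 in h.
  exact: (cvg_comp _ _ (@cvg_harmonic R) h).
- exact: cvg_sig.
Qed.

End half_line.

(** * Derivatives of the Stein solution *)

Section stein_derivatives.
Context {R : realType}.
Implicit Types (g G : R -> R) (w C x z s t B : R).
Notation mu := (@lebesgue_measure R).
Notation D := (`]0, +oo[%classic : set R).

(** With [chi] the derivative of order [k] of the test function and [psi] its derivative almost
    everywhere, [stein_u], [stein_v] and [stein_w] are the derivatives of orders k + 1, k + 2 and k
    of the Stein solution. The constant [c] will be the mean of [chi] for [k = 0], where no power of
    [rho] makes the integral converge, and 0 for [k > 0]. *)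
Definition stein_u k psi w := - \int[mu]_(s in D) (rho s ^+ k.+1 * ou psi s w).
Definition stein_v k psi w := - \int[mu]_(s in D) (rho s ^+ k.+2 / sig s * ouz psi s w).
Definition stein_w k (c : R) chi w := - \int[mu]_(s in D) (rho s ^+ k * (ou chi s w - c)).

Variables (k : nat) (c : R) (chi psi : R -> R).
Hypotheses (lf : llip chi) (me : measurable_fun setT psi)
  (de : {ae mu, forall x : R, is_derive x (1 : R) chi (psi x)}) (ge : growth psi)
  (mom : gint (fun z => (1 + `|z|) * psi z))
  (chi_decay : forall w, exists C, forall s, 0 < s -> `|rho s ^+ k * (ou chi s w - c)| <= C * rho s).

Let gf : growth chi. Proof. exact: growth_antiderivative de ge. Qed.
Let cf : continuous chi. Proof. exact: llip_continuous. Qed.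

Let cont_ou w s : 0 < s -> {for s, continuous (fun s => rho s ^+ k.+1 * ou psi s w)}.
Proof.
by move=> s0; have h := continuous_ou lf me de ge (w := w) s0; apply: cvgM h; exact: continuous_rhoX.
Qed.

Let cont_ouz w s : 0 < s -> {for s, continuous (fun s => rho s ^+ k.+2 / sig s * ouz psi s w)}.
Proof.
move=> s0; have h := continuous_ouz lf me de ge (w := w) s0; apply: cvgM h.
apply: cvgM; first exact: continuous_rhoX.
by apply: cvgV; [rewrite gt_eqF// sig_gt0|exact: continuous_sig].
Qed.

Let cont_chi w s : 0 < s -> {for s, continuous (fun s => rho s ^+ k * (ou chi s w - c))}.
Proof.
move=> s0; apply: cvgM; first exact: continuous_rhoX.
have h := continuous_ou_lip lf me de ge (w := w) s0.
by apply: (cvgB h); exact: cvg_cst.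
Qed.

Lemma rho_dsig_le s : 0 < s -> 0 <= rho s ^+ k.+2 / sig s <= rho s ^+ 2 / sig s.
Proof.
move=> s0; have r0 := ltW (rho_gt0 s); have g0 := sig_gt0 s0.
rewrite divr_ge0 ?exprn_ge0 ?(ltW g0)//= ler_pM2r ?invr_gt0//.
by rewrite -(addn2 k) exprD ler_piMl ?exprn_ge0// exprn_ile1// ltW// rho_lt1.
Qed.

Let bound_ou B : 0 <= B -> exists2 C, 0 <= C & forall s w, 0 < s -> `|w| <= B ->
  `|rho s ^+ k.+1 * ou psi s w| <= C * rho s ^+ 1 /\
  `|rho s ^+ k.+2 / sig s * ouz psi s w| <= C * (rho s ^+ 2 / sig s).
Proof.
move=> B0; have [C C0 HC] := ou_ouz_le me ge mom B0; exists C => // s w s0 wB.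
have [h1 h2] := HC s w s0 wB; have r0 := ltW (rho_gt0 s).
have /andP[h3 h4] := rho_dsig_le s0.
rewrite [`|_ * ou _ _ _|]normrM [`|_ * ouz _ _ _|]normrM [C * rho s ^+ 1]mulrC [C * (_ / _)]mulrC expr1.
rewrite (ger0_norm h3) [`|_ ^+ _|]ger0_norm ?exprn_ge0//.
by split; apply: ler_pM => //; rewrite ?exprn_ge0// rhoX_le.
Qed.

Lemma integrable_u w : mu.-integrable D (EFin \o (fun s => rho s ^+ k.+1 * ou psi s w)).
Proof.
have [C C0 HC] := bound_ou (normr_ge0 w).
apply: (integrable_half_le (@cont_ou w) (H := fun s => C * rho s ^+ 1)).
  by apply: integrable_halfZ; exact: integrable_rhoX.
by move=> s s0; have [] := HC s w s0 (lexx _).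
Qed.

Lemma integrable_v w : mu.-integrable D (EFin \o (fun s => rho s ^+ k.+2 / sig s * ouz psi s w)).
Proof.
have [C C0 HC] := bound_ou (normr_ge0 w).
apply: (integrable_half_le (@cont_ouz w) (H := fun s => C * (rho s ^+ 2 / sig s))).
  by apply: integrable_halfZ; exact: integrable_dsig.
by move=> s s0; have [] := HC s w s0 (lexx _).
Qed.

Lemma integrable_w w : mu.-integrable D (EFin \o (fun s => rho s ^+ k * (ou chi s w - c))).
Proof.
have [C HC] := chi_decay w.
apply: (integrable_half_le (@cont_chi w) (H := fun s => C * rho s ^+ 1)).
  by apply: integrable_halfZ; exact: integrable_rhoX.
by move=> s s0; rewrite expr1; exact: HC.
Qed.

(** For each [s > 0] smoothing makes the average of the measurable [psi] differentiable at the price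
    of a factor [1 / sig s], and a multiple of [rho s ^+ 2 / sig s] dominates. *)
Lemma is_derive_stein_u w : is_derive w (1 : R) (stein_u k psi) (stein_v k psi w).
Proof.
apply: is_deriveN.
apply: (@is_derive_half R (fun w s => rho s ^+ k.+1 * ou psi s w)
  (fun w s => rho s ^+ k.+2 / sig s * ouz psi s w)).
- exact: integrable_u.
- move=> s x s0; have d := is_derive_ouw lf me de ge x s0.
  by apply: is_derive_eq; rewrite !exprSr; move: (rho s ^+ k) => rk; rewrite /GRing.scale/=; ring.
- move=> B B0; have [C C0 HC] := bound_ou B0.
  exists (fun s => C * (rho s ^+ 2 / sig s)); last by move=> s x s0 xB; have [] := HC s x s0 xB.
  by apply: integrable_halfZ; exact: integrable_dsig.
Qed.

Lemma is_derive_stein_w w : is_derive w (1 : R) (stein_w k c chi) (stein_u k psi w).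
Proof.
apply: is_deriveN.
apply: (@is_derive_half R (fun w s => rho s ^+ k * (ou chi s w - c))
  (fun w s => rho s ^+ k.+1 * ou psi s w)).
- exact: integrable_w.
- move=> s x s0; have d := is_derive_ouw_lip lf me de ge x s0.
  by apply: is_derive_eq; rewrite !exprSr; move: (rho s ^+ k) => rk; rewrite /GRing.scale/=; ring.
- move=> B B0; have [C C0 HC] := bound_ou B0.
  exists (fun s => C * rho s ^+ 1); last by move=> s x s0 xB; have [] := HC s x s0 xB.
  by apply: integrable_halfZ; exact: integrable_rhoX.
Qed.

(* The fundamental theorem of calculus for [s |-> rho s ^+ k * (ou chi s w - c)],
   whose derivative follows from Gaussian integration by parts. *)
Lemma stein_vE w :
  stein_v k psi w = chi w - c + w * stein_u k psi w + k%:R * stein_w k c chi w.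
Proof.
pose G s := rho s ^+ k * (ou chi s w - c).
pose g s := - k%:R * (rho s ^+ k * (ou chi s w - c)) +
  (- w * (rho s ^+ k.+1 * ou psi s w) + rho s ^+ k.+2 / sig s * ouz psi s w).
have dG s : 0 < s -> is_derive s (1 : R) G (g s).
  move=> s0; have d1 := is_derive_ou lf me de ge w s0; have d2 := is_derive_rhoX k s.
  apply: is_derive_eq; rewrite /GRing.scale/= /g [rho s ^+ k.+2]exprSr [rho s ^+ k.+1]exprSr.
  by field; rewrite gt_eqF// sig_gt0.
have cg s : 0 < s -> {for s, continuous g}.
  move=> s0; apply: cvgD; last apply: cvgD.
  - by apply: cvgM; [exact: cvg_cst|exact: cont_chi].
  - by apply: cvgM; [exact: cvg_cst|exact: cont_ou].
  - exact: cont_ouz.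
have iu := integrable_u w; have iv := integrable_v w; have iw := integrable_w w.
have mD : measurable D by exact: measurable_itv.
have iZ (a : R) h : mu.-integrable D (EFin \o h) -> mu.-integrable D (EFin \o (fun s => a * h s)).
  exact: integrable_halfZ.
have iD h1 h2 : mu.-integrable D (EFin \o h1) -> mu.-integrable D (EFin \o h2) ->
    mu.-integrable D (EFin \o (fun s => h1 s + h2 s)).
  move=> i1 i2; rewrite (_ : EFin \o _ = (EFin \o h1) \+ (EFin \o h2))%E; last first.
    by apply/funext => s /=; rewrite EFinD.
  exact: integrableD.
have ig : mu.-integrable D (EFin \o g) by apply: (iD _ _ (iZ _ _ iw)); exact: (iD _ _ (iZ _ _ iu)).
have L0 : G n.+1%:R^-1 @[n --> \oo] --> chi w - c.
  have h : G s @[s --> 0] --> chi w - c.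
    rewrite -[X in _ --> X]mul1r; apply: cvgM.
      have := @continuous_rhoX R k 0; rewrite /continuous_at rho0 expr1n; exact.
    by apply: cvgB; [exact: ou_cvg0|exact: cvg_cst].
  exact: (cvg_comp _ _ (@cvg_harmonic R) h).
have L1 : G n.+1%:R @[n --> \oo] --> (0 : R).
  have [C HC] := chi_decay w.
  apply: (@squeeze_cvgr _ _ _ _ (fun n => - (C * rho n.+1%:R)) (fun n => C * rho n.+1%:R)).
  - by apply: nearW => n; rewrite -ler_norml HC.
  - by rewrite -oppr0; apply: cvgN; rewrite -(mulr0 C); apply: cvgM; [exact: cvg_cst|exact: cvg_rho].
  - by rewrite -(mulr0 C); apply: cvgM; [exact: cvg_cst|exact: cvg_rho].
have := ftc_half dG cg ig L0 L1.
rewrite /g RintegralD//; [|exact: iZ|by apply: iD => //; exact: iZ].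
rewrite RintegralD//; [|exact: iZ].
rewrite !RintegralZl// sub0r /stein_v /stein_u /stein_w => e.
apply/eqP; rewrite -subr_eq0; apply/eqP.
move: e; move: (\int[mu]_(s in D) (rho s ^+ k * _)) (\int[mu]_(s in D) (rho s ^+ k.+1 * _)).
move: (\int[mu]_(s in D) (rho s ^+ k.+2 / _ * _)) => V W U e.
have -> : V = - (chi w - c) + k%:R * W + w * U by rewrite -e; ring.
ring.
Qed.

(** By [stein_vE] the difference is [w u + k W - c], with [W] the function [stein_w]; its derivative
    is [u + w v + k u]. The irregularities of [stein_v] and [chi] cancel, so the difference is
    differentiable at every point. *)
Lemma is_derive_stein_r w :
  is_derive w (1 : R) (fun w => stein_v k psi w - chi w) (k.+1%:R * stein_u k psi w + w * stein_v k psi w).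
Proof.
rewrite (_ : (fun w => _) = (fun w => - c + (w * stein_u k psi w + k%:R * stein_w k c chi w))); last first.
  by apply/funext => x; rewrite stein_vE; ring.
have du := is_derive_stein_u w; have dw := is_derive_stein_w w.
by apply: is_derive_eq; rewrite /GRing.scale/= -natr1; ring.
Qed.

(** The weight [rho s ^+ k.+1] has integral [1 / (k + 1)], which the factor [k.+1] cancels. *)
Lemma stein_u_le w (q : R -> R) : (forall s z, 0 < s -> `|psi (rho s * w + sig s * z)| <= q z) -> gint q ->
  k.+1%:R * `|stein_u k psi w| <= gE q.
Proof.
move=> hq iq; rewrite /stein_u normrN mulrC -ler_pdivlMr ?ltr0n//.
have mD : measurable D by exact: measurable_itv.
apply: le_trans (le_normr_Rintegral _ (integrable_u w)) _ => //.
rewrite -[k.+1%:R^-1](Rintegral_rhoX k) -RintegralZl//; last exact: integrable_rhoX.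
apply: le_Rintegral => //.
- by apply: integrable_norm => //; exact: integrable_u.
- by apply: integrable_halfZ; exact: integrable_rhoX.
move=> s; rewrite /= in_itv/= andbT => s0; move: (s : R) s0 => {}s s0.
rewrite normrM mulrC [`|rho s ^+ _|]ger0_norm ?exprn_ge0 ?(ltW (rho_gt0 s))// ler_wpM2r ?exprn_ge0 ?(ltW (rho_gt0 s))//.
have io := gint_ou w me ge s0.
apply: le_trans (le_norm_gE io) _; apply: le_gE => // [|z]; first exact: gint_norm.
exact: hq.
Qed.

Lemma stein_v_le w (q : R -> R) : (forall s z, 0 < s -> `|psi (rho s * w + sig s * z)| <= q z) ->
  gint (fun z => `|z| * q z) -> `|stein_v k psi w| <= gE (fun z => `|z| * q z).
Proof.
move=> hq iq; rewrite /stein_v normrN.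
have q0 : 0 <= gE (fun z => `|z| * q z).
  apply: gE_ge0 => z; rewrite mulr_ge0//.
  by apply: le_trans (hq 1 z ltr01).
have mD : measurable D by exact: measurable_itv.
apply: le_trans (le_normr_Rintegral _ (integrable_v w)) _ => //.
rewrite -[leRHS]mulr1 -(@Rintegral_dsig R) -RintegralZl//; last exact: integrable_dsig.
apply: le_Rintegral => //.
- by apply: integrable_norm => //; exact: integrable_v.
- by apply: integrable_halfZ; exact: integrable_dsig.
move=> s; rewrite /= in_itv/= andbT => s0; move: (s : R) s0 => {}s s0; have /andP[h1 h2] := rho_dsig_le s0.
rewrite normrM mulrC (ger0_norm h1); apply: ler_pM => //.
have io := gint_ouz w me ge s0.
apply: le_trans (le_norm_gE io) _; apply: le_gE => // [|z]; first exact: gint_norm.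
by rewrite normrM mulrC ler_wpM2l// hq.
Qed.

End stein_derivatives.

(** * Convergence of the semigroup to the mean *)

Section decay.
Context {R : realType}.
Implicit Types (f df : R -> R) (a b w s t x : R).
Notation mu := (@lebesgue_measure R).

Lemma derive_le0_le f df a b : a <= b ->
  (forall x, a <= x -> x <= b -> is_derive x (1 : R) f (df x)) ->
  (forall x, a <= x -> x <= b -> df x <= 0) -> f b <= f a.
Proof.
move=> ab dff df0.
have cf : {within `[a, b], continuous f}.
  apply: continuous_in_subspaceT => x; rewrite inE/= in_itv/= => /andP[ax xb].
  by apply: differentiable_continuous; apply/derivable1_diffP; have [] := dff x ax xb.
have [|c] := @MVT_segment R f df a b ab _ cf.
  by move=> x; rewrite in_itv/= => /andP[/ltW ax /ltW xb]; exact: dff.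
rewrite in_itv/= => /andP[ac cb] e; rewrite -subr_le0 e.
by rewrite mulr_le0_ge0 ?subr_ge0// df0.
Qed.

Lemma is_derive_lin (F G : R -> R) x (dF dG c d : R) : is_derive x (1 : R) F dF ->
  is_derive x (1 : R) G dG -> is_derive x (1 : R) (fun t => c * F t + d * G t) (c * dF + d * dG).
Proof. by move=> ? ?; apply: is_derive_eq; rewrite /GRing.scale/=; ring. Qed.

Lemma is_derive_exprn k x : is_derive x (1 : R) (fun x => x ^+ k.+1) (k.+1%:R * x ^+ k).
Proof.
elim: k => [|k ih].
  by under eq_fun do rewrite expr1; rewrite mulr1; exact: is_derive_id.
under eq_fun do rewrite exprS.
by apply: is_derive_eq; rewrite /GRing.scale/= exprS -[k.+2%:R]natr1; ring.
Qed.

Section chi.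
Variables (chi psi : R -> R).
Hypotheses (lf : llip chi) (me : measurable_fun setT psi)
  (de : {ae mu, forall x : R, is_derive x (1 : R) chi (psi x)}) (ge : growth psi)
  (mom : gint (fun z => (1 + `|z|) * psi z)) (ichi : gint chi).

Let gf : growth chi. Proof. exact: growth_antiderivative de ge. Qed.
Let mf : measurable_fun setT chi.
Proof. exact: continuous_measurable_fun (llip_continuous lf). Qed.

Lemma ou_decayS k w : exists C, forall s, 0 < s -> `|rho s ^+ k.+1 * (ou chi s w - 0)| <= C * rho s.
Proof.
have [C C0 HC] := ou_le mf gf ichi (normr_ge0 w); exists C => s s0.
rewrite subr0 normrM mulrC; apply: ler_pM => //; first exact: HC.
by rewrite ger0_norm ?exprn_ge0 ?(ltW (rho_gt0 s))// rhoX_le.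
Qed.

(** For [s >= 1] the derivative in [s] is at most [K * rho s] in absolute value, so adding
    [K * rho s] makes the average and its negative nonincreasing; letting the later time tend to
    infinity gives the rate. For [s < 1] boundedness suffices, with the division by [rho 1] in
    [M]. *)
Lemma ou_decay0 w : exists C, forall s, 0 < s -> `|rho s ^+ 0 * (ou chi s w - gE chi)| <= C * rho s.
Proof.
have [C C0 HC] := ou_ouz_le me ge mom (normr_ge0 w).
have [C' C'0 HC'] := ou_le mf gf ichi (normr_ge0 w).
(* The two terms of the derivative contribute [C * |w|] and [2 * C], the 2 being a bound for
   [1 / sig s] when [s >= 1]. *)
pose K := C * (`|w| + 2); have K0 : 0 <= K by rewrite mulr_ge0// addr_ge0.
pose dG s := - (rho s * w) * ou psi s w + rho s ^+ 2 / sig s * ouz psi s w.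
have dGK s : 1 <= s -> `|dG s| <= K * rho s.
  move=> s1; have s0 : 0 < s by lra.
  have [h1 h2] := HC s w s0 (lexx _); have r0 := rho_gt0 s; have g0 := sig_gt0 s0.
  have r1 := rho_lt1 s0.
  (* Since [1 + 2 * s <= expR (2 * s)], [rho s ^+ 2 <= 1 / 3] for [s >= 1]. *)
  have sg : 1 / 2 <= sig s.
    have rs := rho_sig s0; have e1 := expR_ge1Dx (2 * s).
    have : rho s ^+ 2 * expR (2 * s) = 1 by rewrite rho_sqr -expRD addNr expR0.
    have := sqr_ge0 (rho s); move: (rho s ^+ 2) rs => r2 rs r20 re.
    have r13 : r2 <= 1 / 3.
      by have : r2 * (1 + 2 * s) <= r2 * expR (2 * s) by [exact: ler_wpM2l]; nra.
    by nra.
  rewrite /dG (le_trans (ler_normD _ _))// !normrM normrN normrM (gtr0_norm r0).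
  rewrite [`|(sig s)^-1|]ger0_norm ?invr_ge0 ?(ltW g0)//.
  have -> : K * rho s = rho s * (`|w| * C) + rho s * (2 * C) by rewrite /K; ring.
  have si : (sig s)^-1 <= 2 by rewrite -[leRHS]invrK lef_pV2 ?posrE//; lra.
  have si0 : 0 <= (sig s)^-1 by rewrite invr_ge0 ltW.
  rewrite -!mulrA; apply: lerD; rewrite ler_pM2l//; first by rewrite ler_wpM2l.
  rewrite -[leRHS]mul1r; apply: ler_pM => //; last exact: ler_pM.
  - exact: ltW.
  - by rewrite mulr_ge0.
  - exact: ltW.
have osc s t : 1 <= s -> s <= t -> `|ou chi t w - ou chi s w| <= K * rho s.
  move=> s1 st; have r0 := rho_gt0 t.
  have side (e : R) : `|e| = 1 -> e * (ou chi t w - ou chi s w) <= K * rho s.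
    move=> e1; suff : e * ou chi t w + K * rho t <= e * ou chi s w + K * rho s.
      have h : 0 <= K * rho t by rewrite mulr_ge0// ltW.
      by move=> h'; rewrite mulrBr lerBlDl; apply: le_trans h'; rewrite lerDl.
    apply: (@derive_le0_le (fun s => e * ou chi s w + K * rho s) (fun s => e * dG s + K * - rho s)) => //.
    - move=> x sx _; have x0 : 0 < x by lra.
      have d1 := is_derive_ou lf me de ge w x0; have d2 := is_derive_rho x.
      exact: is_derive_lin.
    - move=> x sx _; have x1 : 1 <= x by lra.
      have := dGK x x1; have := ler_norm (e * dG x); rewrite normrM e1 mul1r; lra.
  rewrite ler_norml; have := side 1 (normr1 _); have := side (-1) (normrN1 _).
  by rewrite mulN1r mul1r => h1 h2; rewrite lerNl h1 h2.
have lim s : 1 <= s -> `|ou chi s w - gE chi| <= K * rho s.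
  move=> s1; apply/ler_addgt0Pr => e e0.
  have /cvgrPdist_le/(_ e e0) L := ou_cvgy w ichi.
  near \oo => n.
  have h1 : `|gE chi - ou chi n.+1%:R w| <= e by near: n; exact: L.
  have h2 : s <= n.+1%:R.
    by rewrite (@le_trans _ _ n%:R) ?ler_nat//; near: n; exact: nbhs_infty_ger.
  have h3 := osc _ _ s1 h2.
  by apply: le_trans (ler_distD (ou chi n.+1%:R w) _ _) _; apply: lerD; rewrite distrC.
pose M := (C' + `|gE chi|) / rho 1.
have M0 : 0 <= M by rewrite divr_ge0 ?addr_ge0// ltW// rho_gt0.
exists (K + M) => s s0; have r0 := rho_gt0 s.
rewrite expr0 mul1r mulrDl; have [s1|s1] := leP 1 s.
  by apply: le_trans (lim s s1) _; rewrite lerDl mulr_ge0// ltW.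
rewrite (le_trans (ler_normB _ _))// ler_wpDl//; first by rewrite mulr_ge0// ltW.
apply: (@le_trans _ _ (C' + `|gE chi|)); first by rewrite lerD2r HC'.
rewrite /M mulrAC ler_pdivlMr ?rho_gt0// ler_wpM2l ?addr_ge0//.
by apply: le_rho; exact: ltW.
Unshelve. all: by end_near. Qed.

End chi.
End decay.

(** * The maximum principle *)

Section maximum_principle.
Context {R : realType}.
Implicit Types (u v chi : R -> R) (w x A : R).

Lemma is_derive_comp_opp (f : R -> R) (x d : R) : is_derive (- x) (1 : R) f d ->
  is_derive x (1 : R) (fun y => f (- y)) (- d).
Proof.
move=> df; have d' : is_derive x (1 : R) (fun x : R => - x) (-1) by apply: is_derive_eq.
have d2 : is_derive x (1 : R) (fun x => f (- x)) (d * -1) by exact: is_derive1_comp.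
by apply: is_derive_eq; rewrite mulrN1.
Qed.

(* If the bound fails at [w], then [th] stays below [th w < 0] to the right of
   [w], so [x ^+ m * (A / m - u x)] decreases at least like [- x ^+ m] and
   [A / m - u] becomes negative, against the bound on [u]. *)
Let principle u v chi A k w : (forall x, is_derive x (1 : R) u (v x)) ->
  (forall x, is_derive x (1 : R) (fun x => v x - chi x) (k.+1%:R * u x + x * v x)) ->
  (forall x y, x <= y -> `|chi y - chi x| <= A * (y - x)) ->
  (forall x, k.+1%:R * `|u x| <= A) -> 0 < w -> k.+1%:R * u w + w * v w <= A.
Proof.
move=> du dr lc bu w0; rewrite leNgt; apply/negP => hw.
set m : R := k.+1%:R; have m0 : 0 < m by rewrite ltr0n.
(* [X] is nonnegative by the bound on [u], and [th x] is the amount by which [m * u x + x * v x]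
   stays below [A]; it is negative at [w] by the assumption to be refuted. *)
pose X x := A / m - u x; pose th x := m * X x - x * v x.
have X0 x : 0 <= X x.
  rewrite subr_ge0 ler_pdivlMr// mulrC; apply: le_trans (bu x).
  by rewrite ler_wpM2l ?ler_norm// ltW.
have thE x : th x = A - (m * u x + x * v x).
  by rewrite /th /X; field; rewrite gt_eqF.
pose c := - th w; have c0 : 0 < c by rewrite /c thE oppr_gt0 subr_lt0.
have cu : continuous u by exact: is_derive_continuous du.
have cr := is_derive_continuous dr.
have cchi : continuous chi.
  apply: llip_continuous => a b ab; exists A => x y _ xy _; exact: lc.
have cv : continuous v.
  move=> x; rewrite (_ : v = fun x => (v x - chi x) + chi x); last by apply/funext => y; rewrite subrK.
  by apply: cvgD; [exact: cr|exact: cchi].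
have cth : continuous th.
  move=> x; apply: cvgB; apply: cvgM; [exact: cvg_cst| |exact: cvg_id|exact: cv].
  by apply: cvgB; [exact: cvg_cst|exact: cu].
have thw b : w <= b -> th b <= th w.
  move=> wb; apply: local_right_decrease => //; first exact: continuous_subspaceT.
  move=> x wx xb thx.
  have x0 : 0 < x by exact: lt_le_trans wx.
  have vx : 0 <= v x.
    have h1 : 0 <= m * X x by rewrite mulr_ge0// ltW.
    have : 0 < x * v x by move: thx c0; rewrite /c /th => ? ?; lra.
    by rewrite pmulr_rgt0// => /ltW.
  (* [e] is the error rate allowed in the two first-order expansions. The bound [c / 2] keeps the
     growth rate [c - e] of [v] above [c / 2], so that [th] loses at least [w * c / 2] per unit,
     which outweighs [e]. *)
  pose e := Num.min (c / 2) (w * c / 2).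
  have e0 : 0 < e by rewrite lt_min divr_gt0//= divr_gt0// mulr_gt0.
  have e1 : e <= c / 2 by rewrite ge_min lexx.
  have e2 : e <= w * c / 2 by rewrite ge_min lexx orbT.
  have em : 0 < e / m by rewrite divr_gt0.
  have [r1 /= r10 H1] := is_derive_near (du x) em.
  have [r2 /= r20 H2] := is_derive_near (dr x) e0.
  near=> y.
  have xy : x < y by near: y; exact: nbhs_right_gt.
  have y1 : y < x + r1 by near: y; apply: nbhs_right_lt; rewrite ltrDl.
  have y2 : y < x + r2 by near: y; apply: nbhs_right_lt; rewrite ltrDl.
  have d0 : 0 < y - x by rewrite subr_gt0.
  have n1 : `|x - y| < r1 by rewrite distrC gtr0_norm//; lra.
  have n2 : `|x - y| < r2 by rewrite distrC gtr0_norm//; lra.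
  have {H1} := H1 y n1; rewrite (gtr0_norm d0) => H1.
  have {H2} := H2 y n2; rewrite (gtr0_norm d0) => H2.
  have H3 := lc x y (ltW xy).
  have rE : m * u x + x * v x = A - th x by rewrite thE; ring.
  rewrite -/m rE in H2.
  move: H1 H2 H3; rewrite !ler_norml => /andP[H1 _] /andP[H2 _] /andP[H3 _].
  set D := y - x in d0 H1 H2 H3.
  (* [v - chi] has derivative [A - th x >= A + c] and [chi] is Lipschitz with constant [A], so [v]
     grows at rate at least [c - e], although it need not be differentiable. *)
  have Ev : (c - e) * D <= v y - v x.
    have : - e * D <= v y - v x - (chi y - chi x) - (A - th x) * D by move: H2; rewrite !mulNr; lra.
    by rewrite /c; nra.
  have Eu : - e * D <= m * (u y - u x - v x * D).
    have := H1; rewrite -(ler_pM2l m0) => H1'.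
    by rewrite (le_trans _ H1')// le_eqVlt; apply/orP; left; apply/eqP; field; rewrite gt_eqF.
  rewrite /th /X -subr_ge0.
  have -> : m * (A / m - u x) - x * v x - (m * (A / m - u y) - y * v y) =
     m * (u y - u x - v x * D) + (m + 1) * (v x * D) + y * (v y - v x).
    by rewrite /D; ring.
  have h1 : 0 <= (m + 1) * (v x * D).
    by apply: mulr_ge0; [rewrite addr_ge0// ltW|apply: mulr_ge0 => //; exact: ltW].
  have h2 : w * ((c / 2) * D) <= y * (v y - v x).
    apply: ler_pM; [exact: ltW|by rewrite mulr_ge0 ?divr_ge0 ?(ltW c0) ?(ltW d0)|exact: ltW (le_lt_trans wx xy)|].
    by apply: le_trans Ev; rewrite ler_pM2r//; lra.
  have h3 : e * D <= w * (c / 2 * D) by rewrite !mulrA ler_wpM2r// ltW.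
  by move: Eu; rewrite mulNr; lra.
pose W x := x ^+ k.+1 * (X x + c / m).
pose dW x := x ^+ k * (th x + c).
have WW b : w <= b -> W b <= W w.
  move=> wb; apply: (@derive_le0_le R W dW) => // x wx _.
    have d := du x; have dx : is_derive x (1 : R) (fun x : R => x ^+ k.+1) (m * x ^+ k).
      exact: is_derive_exprn.
    have dX : is_derive x (1 : R) (fun x => X x + c / m) (- v x).
      by apply: is_derive_eq; rewrite /GRing.scale/=; ring.
    apply: is_derive_eq; rewrite /GRing.scale/= /dW /th exprS.
    by move: (x ^+ k) (X x) => xk Xx; field; rewrite gt_eqF.
  have x0 : 0 <= x by exact: le_trans (ltW w0) wx.
  by rewrite mulr_ge0_le0 ?exprn_ge0//; have := thw x wx; rewrite /c; lra.
(* Far enough that [b * (c / m)] exceeds [W w], and at least 1 so that [b <= b ^+ k.+1]. *)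
pose b := Num.max w 1 + (W w * m / c).
have Ww : 0 <= W w by rewrite mulr_ge0 ?exprn_ge0 ?ltW// ltr_wpDl// divr_gt0.
have q0 : 0 <= W w * m / c by apply: divr_ge0; [exact: mulr_ge0 Ww (ltW m0)|exact: ltW].
have mw : w <= Num.max w 1 by rewrite le_max lexx.
have m1 : 1 <= Num.max w 1 by rewrite le_max lexx orbT.
have wb : w <= b by rewrite /b; lra.
have b1 : 1 <= b by rewrite /b; lra.
have := WW b wb; apply/negP; rewrite -ltNge.
have cm : 0 < c / m by rewrite divr_gt0.
apply: (@lt_le_trans _ _ (b * (c / m))).
  rewrite /b mulrDl (_ : W w * m / c * (c / m) = W w); last first.
    by field; rewrite !gt_eqF.
  by rewrite ltrDr mulr_gt0//; lra.
rewrite /W; apply: ler_pM; [lra|exact: ltW| |by rewrite lerDr].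
by rewrite exprS ler_peMr ?exprn_ege1//; lra.
Unshelve. all: by end_near. Qed.

(** The one-sided bound at positive points is applied to [u] and to [- u], and at negative points to
    the reflection of [u]; at 0 only the bound on [u] remains. *)
Lemma maximum_principle u v chi A k w : (forall x, is_derive x (1 : R) u (v x)) ->
  (forall x, is_derive x (1 : R) (fun x => v x - chi x) (k.+1%:R * u x + x * v x)) ->
  (forall x y, x <= y -> `|chi y - chi x| <= A * (y - x)) ->
  (forall x, k.+1%:R * `|u x| <= A) -> `|k.+1%:R * u w + w * v w| <= A.
Proof.
move=> du dr lc bu.
have neg (u' v' chi' : R -> R) : (forall x, is_derive x (1 : R) u' (v' x)) ->
  (forall x, is_derive x (1 : R) (fun x => v' x - chi' x) (k.+1%:R * u' x + x * v' x)) ->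
  (forall x y, x <= y -> `|chi' y - chi' x| <= A * (y - x)) ->
  (forall x, k.+1%:R * `|u' x| <= A) -> forall w, 0 < w -> `|k.+1%:R * u' w + w * v' w| <= A.
  move=> d1 d2 l b x x0; rewrite ler_norml; apply/andP; split; last exact: principle d1 d2 l b x0.
  rewrite lerNl opprD -!mulrN.
  apply: (@principle (fun x => - u' x) (fun x => - v' x) (fun x => - chi' x)) => //.
  - move=> y; have d := d2 y.
    rewrite (_ : (fun x => _) = (fun x => - (v' x - chi' x))); last by apply/funext => z; ring.
    by apply: is_derive_eq; ring.
  - by move=> y z yz; rewrite -opprD normrN; exact: l.
  - by move=> y; rewrite normrN.
have [w0|w0|<-] := ltgtP 0 w; first exact: neg dr lc bu _ w0.
  have {neg} := neg (fun x => u (- x)) (fun x => - v (- x)) (fun x => - chi (- x)) _ _ _ _ (- w).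
  rewrite opprK mulrNN oppr_gt0; apply => //.
  - by move=> y; exact: is_derive_comp_opp (du (- y)).
  - move=> y; have d := is_derive_comp_opp (dr (- y)).
    rewrite (_ : (fun x => _) = (fun x => - (v (- x) - chi (- x)))); last by apply/funext => z; ring.
    by apply: is_derive_eq; ring.
  - by move=> x y xy; rewrite opprK addrC (le_trans (lc _ _ _)) ?lerN2// opprK addrC.
by rewrite mul0r addr0 normrM ger0_norm.
Qed.

End maximum_principle.

(** * Bounds for the two highest integrals *)

Section bounds.
Context {R : realType}.
Implicit Types (a b w s t x : R).
Notation mu := (@lebesgue_measure R).
Notation N := (@normal_prob R 0 1).
Notation D := (`]0, +oo[%classic : set R).

Lemma stein_uD k (p1 p2 : R -> R) w :
  measurable_fun setT p1 -> growth p1 -> measurable_fun setT p2 -> growth p2 ->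
  mu.-integrable D (EFin \o (fun s => rho s ^+ k.+1 * ou p1 s w)) ->
  mu.-integrable D (EFin \o (fun s => rho s ^+ k.+1 * ou p2 s w)) ->
  stein_u k (fun x => p1 x + p2 x) w = stein_u k p1 w + stein_u k p2 w.
Proof.
move=> m1 g1 m2 g2 i1 i2; rewrite /stein_u -opprD -RintegralD//; congr (- _).
apply: eq_Rintegral => s; rewrite inE/= in_itv/= andbT => s0; move: (s : R) s0 => {}s s0.
by rewrite /ou gED ?mulrDr//; exact: gint_ou.
Qed.

Lemma stein_vD k (p1 p2 : R -> R) w :
  measurable_fun setT p1 -> growth p1 -> measurable_fun setT p2 -> growth p2 ->
  mu.-integrable D (EFin \o (fun s => rho s ^+ k.+2 / sig s * ouz p1 s w)) ->
  mu.-integrable D (EFin \o (fun s => rho s ^+ k.+2 / sig s * ouz p2 s w)) ->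
  stein_v k (fun x => p1 x + p2 x) w = stein_v k p1 w + stein_v k p2 w.
Proof.
move=> m1 g1 m2 g2 i1 i2; rewrite /stein_v -opprD -RintegralD//; congr (- _).
apply: eq_Rintegral => s; rewrite inE/= in_itv/= andbT => s0; move: (s : R) s0 => {}s s0.
rewrite -mulrDr; congr (_ * _); rewrite /ouz -gED; [|exact: gint_ouz..].
by congr (\int[N]_z _); apply/funext => z; rewrite mulrDl.
Qed.

Lemma bounded_integrable_segment (f : R -> R) A a b : measurable_fun setT f ->
  (forall x, `|f x| <= A) -> mu.-integrable `[a, b] (EFin \o f).
Proof.
move=> mf fA; have fm : (mu `[a, b]%classic < +oo)%E.
  by rewrite lebesgue_measure_itv/= lte_fin; case: ifPn => // _; exact: ltry.
apply: (measurable_bounded_integrable _ fm) => //.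
- exact: measurable_funTS.
- exists A; split => [|M AM x _]; first exact: num_real.
  by apply: le_trans (fA x) _; exact: ltW.
Qed.

Section core.
Variables (k : nat) (chi psi : R -> R).
Hypotheses (lf : llip chi) (me : measurable_fun setT psi)
  (de : {ae mu, forall x : R, is_derive x (1 : R) chi (psi x)}) (ge : growth psi)
  (mom : gint (fun z => (1 + `|z|) * psi z)).
Variables (A : R) (Q : R -> R).
Hypotheses (A0 : 0 <= A) (psiAQ : forall x, `|psi x| <= A + Q x) (Q0 : forall x, 0 <= Q x).

Let pa x := Num.max (- A) (Num.min A (psi x)).
Let pb x := psi x - pa x.

Let paA (x : R) : `|pa x| <= A.
Proof.
rewrite /pa ler_norml le_max lexx/= ge_max ge_min lexx andbT /=.
by apply: (@le_trans _ _ 0) => //; rewrite oppr_le0.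
Qed.

Let pbQ x : `|pb x| <= Q x.
Proof.
have := psiAQ x; have := Q0 x; rewrite /pb /pa !ler_norml.
case: (leP A (psi x)) => h1; case: (leP (- A)) => h2 h3 h4; apply/andP; lra.
Qed.

Let ma : measurable_fun setT pa.
Proof. by apply: measurable_maxr => //; exact: measurable_minr. Qed.
Let mb : measurable_fun setT pb. Proof. exact: measurable_funB. Qed.
Let ga : growth pa. Proof. exact: growth_le paA (growth_cst A). Qed.
Let gb : growth pb.
Proof.
have := growthD ge (growthZ (-1) ga).
by under eq_fun do rewrite mulN1r.
Qed.

(** The antiderivative makes the truncation [pa] of [psi] an instance of the preceding theory, with
    [Ca] in the role of [chi]; the rest [pb] goes with [chi - Ca]. *)
Let Ca := antiderivative pa.
Let ia a b : mu.-integrable `[a, b] (EFin \o pa).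
Proof. exact: bounded_integrable_segment paA. Qed.

Let Ca_lip x y : x <= y -> `|Ca y - Ca x| <= A * (y - x).
Proof. by move=> xy; apply: (@antiderivative_lip _ _ ia x y A) => // z _ _; exact: paA. Qed.

Let la : llip Ca.
Proof. by move=> a b ab; exists A => x y _ xy _; exact: Ca_lip. Qed.

Let da : {ae mu, forall x : R, is_derive x (1 : R) Ca (pa x)}.
Proof. exact: antiderivative_ae_is_derive. Qed.

Let momabs : gint (fun z : R => (1 + `|z|) ^+ 1).
Proof.
have h : (0 : R) < 1 / 2 by lra.
have := gint_exp_poly 1 h.
by under eq_fun do rewrite mul0r expR0 mulr1.
Qed.

Let moma : gint (fun z => (1 + `|z|) * pa z).
Proof.
apply: (le_gint _ _ (gintZ A momabs)).
  apply: measurable_funM => //; apply: measurable_funD => //; exact: measurableT_comp.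
by move=> z; rewrite expr1 normrM mulrC [`|1 + _|]ger0_norm ?addr_ge0// ler_wpM2r ?addr_ge0//.
Qed.

Let momb : gint (fun z => (1 + `|z|) * pb z).
Proof.
have := gintB mom moma; rewrite /gint; congr (integrable _ _ _).
by apply/funext => z /=; rewrite /pb mulrBr.
Qed.

Let iCa : gint Ca.
Proof.
apply: (le_gint _ _ (gintZ A momabs)).
  exact: continuous_measurable_fun (llip_continuous la).
move=> z; have Ca0 : Ca 0 = 0 by rewrite /Ca /antiderivative lexx set_itv1 Rintegral_set1.
rewrite expr1; apply: (@le_trans _ _ (A * `|z|)); last by rewrite ler_wpM2l// lerDr.
have [z0|/ltW z0] := leP 0 z.
  by have := Ca_lip z0; rewrite Ca0 !subr0 [`|z|]ger0_norm.
by have := Ca_lip z0; rewrite Ca0 !sub0r normrN [`|z|]ler0_norm.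
Qed.

Let lb : llip (fun x => chi x + -1 * Ca x).
Proof. by apply: llipD lf _; apply: llipM la; exact: llip_cst. Qed.

Let db : {ae mu, forall x : R, is_derive x (1 : R) (fun x => chi x + -1 * Ca x) (pb x)}.
Proof.
apply: (@filterS2 _ _ (ae_filter_ringOfSetsType mu) _ _ _ _ de da) => x; move: (x : R) => {}x d1 d2.
by apply: is_derive_eq; rewrite /pb /GRing.scale/=; ring.
Qed.

Let decay_a : exists c, forall w, exists C, forall s, 0 < s -> `|rho s ^+ k * (ou Ca s w - c)| <= C * rho s.
Proof.
case: k => [|k'].
  exists (gE Ca) => w; exact: ou_decay0 la ma da ga moma iCa w.
exists 0 => w; exact: (ou_decayS la ma da ga iCa k' w).
Qed.

Let uD w : stein_u k psi w = stein_u k pa w + stein_u k pb w.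
Proof.
have <- := stein_uD ma ga mb gb (integrable_u k la ma da ga moma w) (integrable_u k lb mb db gb momb w).
by congr (stein_u k _ w); apply/funext => x; rewrite /pb addrC subrK.
Qed.

Let vD w : stein_v k psi w = stein_v k pa w + stein_v k pb w.
Proof.
have <- := stein_vD ma ga mb gb (integrable_v k la ma da ga moma w) (integrable_v k lb mb db gb momb w).
by congr (stein_v k _ w); apply/funext => x; rewrite /pb addrC subrK.
Qed.

Let u_a x : k.+1%:R * `|stein_u k pa x| <= A.
Proof.
have := stein_u_le k la ma da ga moma (w := x) (q := cst A) (fun s z _ => paA _) (gint_cst A).
by rewrite gE_cst.
Qed.

(** Only [pb] is estimated through [stein_u] and [stein_v] separately; for [pa] this would leave a
    multiple of [A * |w|], which the maximum principle avoids. *)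
Lemma stein_bound w (q : R -> R) : (forall s z, 0 < s -> Q (rho s * w + sig s * z) <= q z) ->
  gint q -> gint (fun z => `|z| * q z) ->
  `|k.+1%:R * stein_u k psi w + w * stein_v k psi w| <=
  A + gE q + `|w| * gE (fun z => `|z| * q z).
Proof.
move=> Qq iq izq.
have pbq s z : 0 < s -> `|pb (rho s * w + sig s * z)| <= q z.
  by move=> s0; apply: le_trans (pbQ _) (Qq _ _ s0).
have [c dec] := decay_a.
have h1 : `|k.+1%:R * stein_u k pa w + w * stein_v k pa w| <= A.
  apply: (@maximum_principle _ (stein_u k pa) (stein_v k pa) Ca) => //.
  - by move=> x; exact: is_derive_stein_u la ma da ga moma x.
  - by move=> x; exact: is_derive_stein_r la ma da ga moma dec x.
have h2 := stein_u_le k lb mb db gb momb pbq iq.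
have h3 := stein_v_le k lb mb db gb momb pbq izq.
rewrite uD vD; have -> : k.+1%:R * (stein_u k pa w + stein_u k pb w) + w * (stein_v k pa w + stein_v k pb w)
  = (k.+1%:R * stein_u k pa w + w * stein_v k pa w) + k.+1%:R * stein_u k pb w + w * stein_v k pb w.
  by move: (stein_u k pa w) (stein_u k pb w) (stein_v k pa w) (stein_v k pb w) => *; ring.
rewrite (le_trans (ler_normD _ _))//; apply: lerD; last by rewrite normrM ler_wpM2l.
rewrite (le_trans (ler_normD _ _))//; apply: lerD => //.
by rewrite normrM ger0_norm.
Qed.

(** At 0 the term with [stein_v] disappears and with it the moment of [|z| * q z], which may be
    infinite in the application. *)
Lemma stein_bound0 (q : R -> R) : (forall s z, 0 < s -> Q (rho s * 0 + sig s * z) <= q z) ->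
  gint q -> `|k.+1%:R * stein_u k psi 0| <= A + gE q.
Proof.
move=> Qq iq.
have pbq s z : 0 < s -> `|pb (rho s * 0 + sig s * z)| <= q z.
  by move=> s0; apply: le_trans (pbQ _) (Qq _ _ s0).
have h2 := stein_u_le k lb mb db gb momb pbq iq.
rewrite uD mulrDr (le_trans (ler_normD _ _))//; apply: lerD; rewrite normrM ger0_norm//.
Qed.

End core.
End bounds.

(** * Functions that are monotone along rays *)

Section ray_monotone.
Context {R : realType}.
Implicit Types (w x y z a r s : R).
Notation mu := (@lebesgue_measure R).
Notation N := (@normal_prob R 0 1).

Section one_function.
Variable F : R -> R.
Hypotheses (F0 : forall w, 0 <= F w) (F_mono : forall w a, 1 < a -> F w <= F (a * w)).

Lemma ray_scale r x : 0 < r -> r <= 1 -> F (r * x) <= F x.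
Proof.
move=> r0; rewrite le_eqVlt => /predU1P[->|r1]; first by rewrite mul1r.
by have := @F_mono (r * x) r^-1; rewrite mulKf ?gt_eqF//; apply; rewrite invf_gt1.
Qed.

Lemma ray_pos x y : 0 < x -> x <= y -> F x <= F y.
Proof.
move=> x0 xy; have y0 := lt_le_trans x0 xy.
have := @ray_scale (x / y) y; rewrite divfK ?gt_eqF//; apply; first by rewrite divr_gt0.
by rewrite ler_pdivrMr// mul1r.
Qed.

Lemma ray_neg x y : x <= y -> y < 0 -> F y <= F x.
Proof.
move=> xy y0; have x0 := le_lt_trans xy y0.
have := @ray_scale (y / x) x; rewrite divfK ?lt_eqF//; apply; first by rewrite -mulrNN -invrN divr_gt0 ?oppr_gt0.
by rewrite ler_ndivrMr// mul1r.
Qed.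

Lemma ray_bounded (B : R) : exists2 M : R, 0 <= M & forall x, `|x| <= B -> F x <= M.
Proof.
exists (F B + F (- B) + F 0); first by rewrite !addr_ge0.
move=> x; rewrite ler_norml => /andP[x1 x2].
have := F0 B; have := F0 (- B); have := F0 0.
have [x0|x0|->] := ltgtP x 0.
- by have := ray_neg x1 x0; lra.
- by have := ray_pos x0 x2; lra.
- lra.
Qed.

(** The ray condition makes [F] monotone on each open half-line and says nothing about its value at
    0, which is split off. *)
Lemma ray_measurable : measurable_fun setT F.
Proof.
pose Fp x := if 0 < x then F x else 0.
pose Fm x := if x < 0 then F x else 0.
have -> : F = (fun x => Fp x + Fm x + F 0 * \1_[set 0] x).
  apply/funext => x; rewrite /Fp /Fm indicE; have [x0|x0|->] := ltgtP x 0.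
  - by rewrite memNset ?mulr0 ?addr0 ?add0r// => /= e; rewrite e ltxx in x0.
  - by rewrite memNset ?mulr0 ?addr0// => /= e; rewrite e ltxx in x0.
  - by rewrite mem_set// mulr1 !add0r.
apply: measurable_funD; last by apply: measurable_funM => //; exact: measurable_indic.
apply: measurable_funD.
  apply: nondecreasing_measurable => // x y; rewrite /Fp => xy.
  have [x0|x0] := ltP 0 x; first by rewrite (lt_le_trans x0 xy) ray_pos.
  by case: ifPn => // _.
apply: nonincreasing_measurable => // x y; rewrite /Fm => xy.
have [y0|y0] := ltP y 0; first by rewrite (le_lt_trans xy y0) ray_neg.
by case: ifPn => // _.
Qed.

Lemma gE_unit_segment x d p : gint F -> 0 <= p ->
  (forall z, x <= z -> z <= x + 1 -> p <= F z /\ d <= gdens z) -> 0 <= d -> p * d <= gE F.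
Proof.
move=> iF p0 H d0; have [iG ->] := gint_gdens iF.
have g0 z : 0 <= gdens z by exact: normal_pdf_ge0.
have mI : measurable (`[x, x + 1]%classic : set R) by exact: measurable_itv.
have mab : mu `[x, x + 1]%classic = 1%:E.
  by rewrite lebesgue_measure_itv/= lte_fin ltrDl ltr01 -EFinD addrAC subrr add0r.
have h : p * d = \int[mu]_(z in `[x, x + 1]) (p * d).
  by rewrite Rintegral_cst// -[LHS]mulr1; congr (_ * _); exact: (esym (congr1 fine mab)).
have iS : mu.-integrable (`[x, x + 1]%classic : set R) (EFin \o (fun z => F z * gdens z)).
  exact: integrableS iG.
apply: (@le_trans _ _ (\int[mu]_(z in `[x, x + 1]) (F z * gdens z))).
  rewrite h; apply: le_Rintegral => //.
    by apply: (@bounded_integrable_segment _ (cst (p * d)) `|p * d|).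
  move=> z; rewrite /= in_itv/= => /andP[z1 z2]; have [h1 h2] := H z z1 z2.
  exact: ler_pM.
rewrite /Rintegral; apply: fine_le.
- exact: integrable_fin_num.
- exact: integrable_fin_num.
- apply: (@ge0_subset_integral _ _ _ mu) => //.
  + by have /integrableP[] := iG.
  + by move=> z _; rewrite lee_fin mulr_ge0.
Qed.

(** The mean of [F] is at least its integral over the unit segment that starts at [x] and points
    away from 0, hence at least [F x] times the Gaussian density at [|x| + 1]. The cross term [|x|]
    in [(|x| + 1) ^ 2 / 2] is absorbed by [(c - 1 / 2) x ^ 2] at the cost of a constant. *)
Lemma ray_growth : gint F -> growth F.
Proof.
move=> iF c c2; have pk : 0 < normal_peak (1 : R) by exact: normal_peak_gt0.
pose K := `|gE F| / normal_peak 1 * expR ((4 * (c - 1 / 2))^-1 * 1 + 1 / 2) + F 0.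
have gd x z : `|z| <= `|x| + 1 -> gdens z >= normal_peak 1 * expR (- ((`|x| + 1) ^+ 2 / 2)).
  move=> zx; rewrite gdensE ler_pM2l// ler_expR lerN2 ler_wpM2r//.
  by rewrite -[leLHS]real_normK ?num_real// lerXn2r ?nnegrE ?addr_ge0.
have key x : x != 0 -> F x * (normal_peak 1 * expR (- ((`|x| + 1) ^+ 2 / 2))) <= gE F.
  move=> x0; have dn : 0 <= normal_peak 1 * expR (- ((`|x| + 1) ^+ 2 / 2)).
    by rewrite mulr_ge0 ?expR_ge0// ltW.
  have [xn|xp|xe] := ltgtP x 0; last by rewrite xe eqxx in x0.
    apply: (@gE_unit_segment (x - 1)) => // z z1 z2; split; first by apply: ray_neg => //; lra.
    by apply: gd; rewrite !ltr0_norm//; lra.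
  apply: (@gE_unit_segment x) => // z z1 z2; split; first exact: ray_pos.
  by apply: gd; rewrite !gtr0_norm//; lra.
exists K => x; rewrite ger0_norm//.
have ex : 1 <= expR (c * x ^+ 2).
  by rewrite -expR0 ler_expR mulr_ge0 ?sqr_ge0//; lra.
have [->|x0] := eqVneq x 0.
  by rewrite expr0n/= mulr0 expR0 mulr1 /K lerDr mulr_ge0 ?expR_ge0// divr_ge0// ltW.
rewrite /K mulrDl ler_wpDr//; first by rewrite mulr_ge0// expR_ge0.
have := key x x0; rewrite mulrA expRN ler_pdivrMr ?expR_gt0// -ler_pdivlMr// => h.
pose e := c - 1 / 2; have e0 : 0 < e by rewrite /e; lra.
apply: (le_trans h).
rewrite mulrAC -[leRHS]mulrA -expRD; apply: ler_pM.
- by rewrite divr_ge0 ?(ltW pk)//; apply: gE_ge0.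
- exact: expR_ge0.
- by rewrite ler_wpM2r ?ler_norm// invr_ge0 ltW.
rewrite ler_expR -/e mulr1.
have -> : c * x ^+ 2 = e * `|x| ^+ 2 + `|x| ^+ 2 / 2.
  by rewrite real_normK ?num_real// /e; field.
have h2 : 0 <= e * (`|x| - (2 * e)^-1) ^+ 2 by rewrite mulr_ge0 ?sqr_ge0// ltW.
have : e * (`|x| - (2 * e)^-1) ^+ 2 = e * `|x| ^+ 2 - `|x| + (4 * e)^-1.
  by field; rewrite gt_eqF.
move: h2 => /[swap] -> h2.
have -> : (`|x| + 1) ^+ 2 / 2 = `|x| ^+ 2 / 2 + `|x| + 1 / 2 by field.
lra.
Qed.

End one_function.

Section transfer.
Context d (T : measurableType d) (Pr : probability T R) (Z : {RV Pr >-> R}).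
Hypothesis Z_normal : forall A : set R, measurable A -> distribution Pr Z A = normal_prob 0 1 A.

(* [normal_prob] lives on the display of [measurableTypeR R], the law of [Z] on
   that of [R]; transporting along the identity bridges the two. *)
Lemma integral_normal (F : R -> R) : measurable_fun setT F -> (forall x, 0 <= F x) ->
  (\int[distribution Pr Z]_z (F z)%:E = \int[N]_z (F z)%:E)%E.
Proof.
move=> mF F0; pose idf : measurableTypeR R -> R := id.
have midf : measurable_fun [set: measurableTypeR R] idf by exact: measurable_id.
pose nu := mscale (NngNum ler01) (pushforward N idf).
have -> : (\int[distribution Pr Z]_z (F z)%:E = \int[nu midf]_z (F z)%:E)%E.
  have Zn (A : set R) : measurable A -> distribution Pr Z A = nu midf A.
    by move=> mA; rewrite (Z_normal mA) /nu /mscale/= mul1e.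
  by apply: eq_measure_integral => A mA _; exact: Zn.
have mE : measurable_fun setT (EFin \o F) by exact/measurable_EFinP.
rewrite /nu ge0_integral_mscale//=; last by move=> x _; rewrite lee_fin.
rewrite mul1e; etransitivity.
  by apply: (ge0_integral_pushforward midf) => // x _; rewrite lee_fin.
by rewrite preimage_setT.
Qed.

Lemma ge0_expectation_normal (F : R -> R) : measurable_fun setT F -> (forall x, 0 <= F x) ->
  ('E_Pr[fun t : T => F (Z t)] = \int[N]_z (F z)%:E)%E.
Proof.
move=> mF F0; rewrite unlock.
have mE : measurable_fun setT (EFin \o F) by exact/measurable_EFinP.
transitivity (\int[distribution Pr Z]_z (F z)%:E)%E.
  by rewrite ge0_integral_distribution.
exact: integral_normal.
Qed.

Lemma gint_normal (F : R -> R) : measurable_fun setT F -> (forall x, 0 <= F x) ->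
  Pr.-integrable setT (fun x : T => (F (Z x))%:E) -> gint F.
Proof.
move=> mF F0 iF; apply/integrableP; split; first exact/measurable_EFinP.
under eq_integral do rewrite /= ger0_norm//.
rewrite -ge0_expectation_normal// unlock.
have /integrableP[_] := iF.
by under eq_integral do rewrite /= ger0_norm//.
Qed.

Lemma expectation_normal (F : R -> R) : gint F -> ('E_Pr[fun t : T => F (Z t)] = (gE F)%:E)%E.
Proof.
move=> iF; have mF := gint_measurable iF; rewrite unlock -gE_EFin//.
have mE : measurable_fun setT (EFin \o F) by exact/measurable_EFinP.
rewrite [LHS]integralE [RHS]integralE.
pose Fp x := Num.max (F x) 0; pose Fn x := Num.max (- F x) 0.
have pE x : ((EFin \o F)^\+ x = (Fp x)%:E)%E by rewrite funeposE /Fp EFin_max.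
have nE x : ((EFin \o F)^\- x = (Fn x)%:E)%E by rewrite funenegE /Fn EFin_max.
have mp : measurable_fun setT Fp by exact: measurable_maxr.
have mn : measurable_fun setT Fn by apply: measurable_maxr => //; exact: measurableT_comp.
have p0 x : 0 <= Fp x by rewrite le_max lexx orbT.
have n0 x : 0 <= Fn x by rewrite le_max lexx orbT.
have hp := ge0_expectation_normal mp p0; have hn := ge0_expectation_normal mn n0.
rewrite unlock in hp; rewrite unlock in hn; congr (_ - _)%E.
  under [RHS]eq_integral do rewrite pE.
  by rewrite -hp; apply: eq_integral => t _; rewrite -pE !funeposE.
under [RHS]eq_integral do rewrite nE.
by rewrite -hn; apply: eq_integral => t _; rewrite -nE !funenegE.
Qed.

End transfer.
End ray_monotone.

(** * The test function *)

Section test_function.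
Context {R : realType}.
Implicit Types (u v w x y z : R).
Notation mu := (@lebesgue_measure R).

(** The density of [f] is its derivative almost everywhere, hence bounded by [M]. The interval is
    widened by 1 on each side since the density is known to be the derivative only in the
    interior. *)
Lemma ac_lipschitz (f : R -> R) M : 0 <= M -> abs_continuous f ->
  (forall x d, is_derive x (1 : R) f d -> `|d| <= M) -> forall u v, `|f u - f v| <= M * `|u - v|.
Proof.
move=> M0 acf fM u v; wlog vu : u v / v <= u.
  move=> W; have [vu|/ltW uv] := leP v u; first exact: W.
  by rewrite distrC [`|u - v|]distrC; exact: W.
have ab : v - 1 < u + 1 by lra.
have [g [ig gE dg]] := ac_density_derivable ab (abs_continuous_ac_on acf (ltW ab)).
have iS : mu.-integrable `[v, u] (EFin \o g) by exact: integrableS ig.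
have v1 : v - 1 <= v by rewrite gerBl.
have u1 : u <= u + 1 by rewrite lerDl.
rewrite (gE v u v1 vu u1).
have muv : mu `[v, u]%classic = (u - v)%:E.
  rewrite lebesgue_measure_itv/= lte_fin; case: ifPn => //.
  by rewrite -leNgt => uv; congr EFin; apply/esym/eqP; rewrite subr_eq0 eq_le uv vu.
rewrite [`|u - v|]ger0_norm ?subr_ge0//.
apply: le_trans (le_normr_Rintegral _ iS) _ => //.
have bd : {ae mu, forall x, (`[v, u]%classic : set R) x -> (`|(EFin \o g) x| <= M%:E)%E}.
  move: dg; apply: (@filterS _ _ (ae_filter_ringOfSetsType mu)) => x; move: (x : R) => {}x dx.
  rewrite /= in_itv/= => /andP[h1 h2]; rewrite lee_fin; apply: (fM x); apply: dx.
  by rewrite in_itv/=; apply/andP; split; lra.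
have : (\int[mu]_(x in `[v, u]) `|(EFin \o g) x| <= M%:E * mu `[v, u])%E.
  by apply: integral_le_bound => //; exact: measurable_int iS.
rewrite [X in (_ <= _ * X)%E]muv -EFinM => h.
have i2 : mu.-integrable `[v, u] (EFin \o (fun x => `|g x|)) by exact: integrable_norm.
by rewrite -lee_fin /Rintegral fineK//; exact: integrable_fin_num.
Qed.

Lemma deriv_supnorm_ge0 (h : R -> R) j : 0 <= deriv_supnorm h j.
Proof.
rewrite /deriv_supnorm; set S := (X in sup X).
(* Where there is no supremum, [sup] has the default value 0. *)
have [uS|nS] := pselect (has_sup S); last by rewrite sup_out.
have [[y Sy] _] := uS; apply: (@le_trans _ _ y); last exact: sup_upper_bound.
by case: Sy => x _ <-.
Qed.

Section h_side.
Variables (k : nat) (h : R -> R).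
Hypothesis hC : Cb k.+1 h.

Lemma deriv_supnorm_ub j x : (1 <= j <= k.+1)%N -> derivable (derive1n j.-1 h) x 1 ->
  `|derive1n j h x| <= deriv_supnorm h j.
Proof.
move=> jk dx; have [_ _ /(_ j jk)[M HM]] := hC.
apply: sup_upper_bound; last by exists x.
split; first by exists `|derive1n j h x|, x.
by exists M => _ [y dy <-]; exact: HM.
Qed.

Lemma Cb_is_derive j y : (j < k)%N -> is_derive y (1 : R) (derive1n j h) (derive1n j.+1 h y).
Proof. by move=> jk; apply: derivable_is_derive => //; have [H _ _] := hC; exact: H. Qed.

(** Below the top order the function is differentiable everywhere; at [j = k] only absolute
    continuity is available. *)
Lemma Cb_lipschitz j u v : (j < k.+1)%N ->
  `|derive1n j h u - derive1n j h v| <= deriv_supnorm h j.+1 * `|u - v|.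
Proof.
rewrite ltnS leq_eqVlt => /predU1P[->|jk].
  apply: ac_lipschitz; [exact: deriv_supnorm_ge0|by have [_ H _] := hC|move=> x d dx].
  have [dd e] := dx; have : derive1n k.+1 h x = d by rewrite derive1nS derive1E.
  by move=> <-; apply: deriv_supnorm_ub; [rewrite /= leqnn|exact: dd].
wlog vu : u v / v <= u.
  move=> W; have [vu|/ltW uv] := leP v u; first exact: W.
  by rewrite distrC [`|u - v|]distrC; exact: W.
rewrite [`|u - v|]ger0_norm ?subr_ge0//; apply: plip_lipschitz => //; first exact: deriv_supnorm_ge0.
move=> x _ _; have d := Cb_is_derive x jk.
apply: plip_le (plip_derive d); apply: deriv_supnorm_ub; first by rewrite /= ltnW.
by have [] := d.
Qed.

End h_side.

Section g_side.
Variables (k : nat) (g P : R -> R).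
Hypotheses (gC : CP P k.+1 g) (P0 : forall x, 0 <= P x).

Lemma CP_root x : (P x `^ k.+1%:R^-1) ^+ k.+1 = P x.
Proof. by rewrite -powR_mulrn ?powR_ge0// -powRrM mulVf ?pnatr_eq0// powRr1. Qed.

(** Raising the hypothesis to the power [i / (k + 1)] gives the homogeneous bound on which the
    estimate of Bell monomials rests. *)
Lemma CP_bound i x : (1 <= i <= k.+1)%N -> `|derive1n i g x| <= (P x `^ k.+1%:R^-1) ^+ i.
Proof.
move=> ik; have [_ /(_ i x ik)] := gC; have /andP[i0 _] := ik.
have in0 : (i%:R : R) != 0 by rewrite pnatr_eq0 -lt0n.
set a := `|_|; move=> H.
have -> : a = (a `^ (k.+1%:R / i%:R)) `^ (i%:R / k.+1%:R).
  by rewrite -powRrM mulrA divfK// divff ?pnatr_eq0// powRr1// /a normr_ge0.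
have -> : (P x `^ k.+1%:R^-1) ^+ i = P x `^ (i%:R / k.+1%:R).
  by rewrite -powR_mulrn ?powR_ge0// -powRrM mulrC.
by apply: ge0_ler_powR; rewrite ?nnegrE ?powR_ge0 ?divr_ge0.
Qed.

Lemma CP_is_derive i y : (i < k.+1)%N -> is_derive y (1 : R) (derive1n i g) (derive1n i.+1 g y).
Proof. by move=> ik; apply: derivable_is_derive => //; have [H _] := gC; exact: H. Qed.

End g_side.

Section composite.
Variables (k : nat) (h g P : R -> R).
Hypotheses (hC : Cb k.+1 h) (gC : CP P k.+1 g).
Hypotheses (P0 : forall x, 0 <= P x) (P_mono : forall w a, 1 < a -> P w <= P (a * w)).
Hypotheses (iP : gint P) (izP : gint (fun z => `|z| * P z)).

Let L j : R := if (0 < j <= k.+1)%N then deriv_supnorm h j else 0.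
Let L0 j : 0 <= L j. Proof. by rewrite /L; case: ifP => // _; exact: deriv_supnorm_ge0. Qed.

Let hd j := derive1n j h.
Let gd i := derive1n i g.
Let t x := P x `^ k.+1%:R^-1.

Let hd_derive j y : (j.+1 < k.+1)%N -> is_derive y (1 : R) (hd j) (hd j.+1 y).
Proof. by move=> jk; exact: (Cb_is_derive hC y jk). Qed.
Let gd_derive i y : (i < k.+1)%N -> is_derive y (1 : R) (gd i) (gd i.+1 y).
Proof. by move=> ik; exact: (CP_is_derive gC y ik). Qed.
Let hd_lip j u v : (j < k.+1)%N -> `|hd j u - hd j v| <= L j.+1 * `|u - v|.
Proof. by move=> jk; rewrite /L /= jk; exact: (Cb_lipschitz hC u v jk). Qed.
Let hd_bound j u : (0 < j < k.+1)%N -> `|hd j u| <= L j.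
Proof.
move=> /andP[j0 jk]; rewrite /L j0 (ltnW jk); apply: (deriv_supnorm_ub hC); first by rewrite j0 ltnW.
by have [H _ _] := hC; apply: H; rewrite prednK.
Qed.

Definition test_derive j := comp_derive (fun j => derive1n j h) (fun i => derive1n i g) j.

Let hn := hnorm h k.+1.

Lemma hnorm_ge0 : 0 <= hn.
Proof. by apply: sumr_ge0 => i _; rewrite mulr_ge0//; exact: deriv_supnorm_ge0. Qed.

Lemma test_derive0 : test_derive 0 = fun x => h (g x).
Proof.
apply/funext => x; rewrite /test_derive /comp_derive big_ord_recl big_ord0 addr0 /bell_fun /=.
by rewrite big_cons big_nil addr0 /monomial big_nil mulr1.
Qed.

Lemma test_is_derive j x : (j < k)%N -> is_derive x (1 : R) (test_derive j) (test_derive j.+1 x).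
Proof. by move=> jk; exact: (@comp_derive_is_derive R k.+1 hd gd isT hd_derive gd_derive j x jk). Qed.

Lemma test_derivable x : derivable (derive1n k h) (g x) 1 -> derivable (test_derive k) x 1.
Proof. exact: (@comp_derive_derivable R k.+1 hd gd isT hd_derive gd_derive x). Qed.

Lemma test_plip x : plip (test_derive k) x (hn * P x).
Proof.
have := @comp_derive_plip R k.+1 hd gd L isT gd_derive L0 hd_lip hd_bound x (t x)
  (fun i ik => CP_bound gC P0 x ik).
apply: plip_le; rewrite (CP_root k P0) -big_distrl/= ler_wpM2r// /hn /hnorm.
rewrite !big_nat; apply: ler_sum => i /andP[i1 i2].
by rewrite /L i1 -ltnS i2.
Qed.

(** The root of order [k + 1] of [P x], raised to the power [j], is at most 1 or at most [P x],
    according to whether the root is below or above 1. *)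
Lemma test_bound : exists2 C : R, 0 <= C & forall j x, (0 < j < k.+1)%N ->
  `|test_derive j x| <= C * (1 + P x).
Proof.
pose C j : R := \sum_(i < j.+1) L i * (stirling2 j i)%:R.
have C0 j : 0 <= C j by apply: sumr_ge0 => i _; rewrite mulr_ge0.
exists (\sum_(j < k.+1) C j); first exact: sumr_ge0.
move=> j x jk; have /andP[j0 jk1] := jk.
have := @comp_derive_bound _ k.+1 hd gd L hd_bound x (t x)
  (fun i ik => CP_bound gC P0 x ik) j jk.
move=> /le_trans; apply; rewrite -big_distrl/=.
apply: ler_pM.
- by apply: sumr_ge0 => i _; rewrite mulr_ge0.
- by rewrite exprn_ge0// powR_ge0.
- by rewrite (bigD1 (Ordinal jk1))//= lerDl sumr_ge0.
have [t1|t1] := leP (t x) 1.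
  by rewrite (le_trans (exprn_ile1 _ (powR_ge0 _ _) t1))// lerDl.
rewrite ler_wpDl// -[leRHS](CP_root k P0) -/(t x).
by rewrite (ler_weXn2l (ltW t1))// ltnW.
Qed.

Lemma test_llip_top : llip (test_derive k).
Proof.
move=> a b ab; have [M M0 MP] := ray_bounded P0 P_mono (`|a| + `|b|).
exists (hn * M) => x y ax xy yb.
apply: plip_lipschitz => // [|z xz zy]; first by rewrite mulr_ge0// hnorm_ge0.
apply: plip_le (test_plip z); rewrite ler_wpM2l ?hnorm_ge0//; apply: MP.
have := ler_norm b; have := ler_norm (- a); have := normr_ge0 a; have := normr_ge0 b.
by rewrite normrN ler_norml => h1 h2 h3 h4; apply/andP; split; lra.
Qed.

Lemma test_llip j : (j <= k)%N -> llip (test_derive j).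
Proof.
rewrite leq_eqVlt => /predU1P[->|jk]; first exact: test_llip_top.
apply: (continuous_llip (fun x => test_is_derive x jk)).
move: jk; rewrite leq_eqVlt => /predU1P[->|jk]; first exact: llip_continuous test_llip_top.
exact: (is_derive_continuous (fun x => test_is_derive x jk)).
Qed.

Lemma test_derivative : exists psi : R -> R,
  [/\ measurable_fun setT psi, forall x, `|psi x| <= hn * P x &
      {ae mu, forall x : R, is_derive x (1 : R) (test_derive k) (psi x)}].
Proof.
apply: (llip_measurable_derivative test_llip_top (Q := fun x => hn * P x)).
- by apply: measurable_funM => //; exact: ray_measurable.
- by move=> x; rewrite mulr_ge0// hnorm_ge0.
- by move=> x d dx; exact: derive_le_plip dx (test_plip x).
Qed.

Lemma gint_normz : gint (fun z : R => `|z|).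
Proof.
have := @gint_exp_poly R 1 0; rewrite divr_gt0// => /(_ isT); apply: le_gint => // z.
by rewrite normr_id mul0r expR0 mulr1 expr1 lerDr.
Qed.

Let gint_dominant C : gint (fun z => (1 + `|z|) * (C * (1 + P z))).
Proof.
have -> : (fun z : R => (1 + `|z|) * (C * (1 + P z))) =
    (fun z => C * ((1 + `|z|) + (P z + `|z| * P z))) by apply/funext => z; ring.
by apply: gintZ; apply: gintD; apply: gintD => //; [exact: gint_cst|exact: gint_normz].
Qed.

Section derivatives.
Variable psi : R -> R.
Hypotheses (mpsi : measurable_fun setT psi) (psiP : forall x, `|psi x| <= hn * P x).
Hypothesis dpsi : {ae mu, forall x : R, is_derive x (1 : R) (test_derive k) (psi x)}.

Let dtest j := if (j < k)%N then test_derive j.+1 else psi.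

Let dtest_bound : exists2 C : R, 0 <= C & forall j x, (j <= k)%N ->
  `|dtest j x| <= C * (1 + P x) /\ plip (test_derive j) x (C * (1 + P x)).
Proof.
have [C C0 CP] := test_bound; exists (C + hn); first by rewrite addr_ge0// hnorm_ge0.
move=> j x jk; rewrite /dtest.
have H1 : C * (1 + P x) <= (C + hn) * (1 + P x).
  by rewrite ler_wpM2r ?addr_ge0// lerDl hnorm_ge0.
have H2 : hn * P x <= (C + hn) * (1 + P x).
  by apply: ler_pM; rewrite ?hnorm_ge0// ?lerDr// lerDl.
case: ltnP => [jk'|kj]; first split.
- by rewrite (le_trans _ H1)// CP.
- by apply: plip_le (plip_derive (test_is_derive x jk')); rewrite (le_trans _ H1)// CP.
have -> : j = k by apply/eqP; rewrite eqn_leq jk.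
by split; [exact: le_trans (psiP x) H2|exact: plip_le H2 (test_plip x)].
Qed.

Lemma dtest_measurable j : (j <= k)%N -> measurable_fun setT (dtest j).
Proof.
move=> jk; rewrite /dtest; case: ltnP => // {}jk.
by apply: continuous_measurable_fun; apply: llip_continuous; exact: test_llip.
Qed.

Lemma dtest_is_derive j : (j <= k)%N ->
  {ae mu, forall x : R, is_derive x (1 : R) (test_derive j) (dtest j x)}.
Proof.
move=> jk; rewrite /dtest; case: ltnP => [jk'|kj].
  by apply: aeW => x; exact: test_is_derive.
by have -> : j = k by apply/eqP; rewrite eqn_leq jk.
Qed.

Lemma dtest_growth j : (j <= k)%N -> growth (dtest j).
Proof.
move=> jk; have [C C0 H] := dtest_bound.
apply: (growth_le (g := fun x => C * (1 + P x))) => [x|]; first by have [] := H j x jk.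
by apply: growthZ; apply: growthD; [exact: growth_cst|exact: ray_growth].
Qed.

Lemma dtest_moment j : (j <= k)%N -> gint (fun z => (1 + `|z|) * dtest j z).
Proof.
move=> jk; have [C C0 H] := dtest_bound; apply: le_gint (gint_dominant C) => [|z].
  apply: measurable_funM; last exact: dtest_measurable.
  by apply: measurable_funD => //; exact: measurableT_comp.
have [Hz _] := H j z jk.
by rewrite normrM [`|1 + _|]ger0_norm ?addr_ge0// ler_wpM2l// addr_ge0.
Qed.

(** Growth does not give integrability, 1 / 2 being the critical exponent. Instead, the increment
    from 0 to [z] is at most [|z|] times a bound on the slope; between 0 and [z], [P] is at most
    [P 0 + P z] by monotonicity along rays, and [|z| * P z] is integrable. *)
Lemma test_gint j : (j <= k)%N -> gint (test_derive j).
Proof.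
move=> jk; have [C C0 H] := dtest_bound.
pose D z := C * (1 + P 0 + P z) * `|z|.
have iD : gint (fun z => `|test_derive j 0| + D z).
  apply: gintD; first exact: gint_cst.
  have -> : D = fun z => C * ((1 + P 0) * `|z| + `|z| * P z).
    by apply/funext => z; rewrite /D; ring.
  by apply: gintZ; apply: gintD => //; apply: gintZ; exact: gint_normz.
apply: le_gint iD; first by apply: continuous_measurable_fun; apply: llip_continuous; exact: test_llip.
move=> z; suff : `|test_derive j z - test_derive j 0| <= D z.
  by move=> Hz; rewrite -[X in `|X|](subrK (test_derive j 0)) (le_trans (ler_normD _ _))// addrC lerD2l.
have K0 : 0 <= C * (1 + P 0 + P z) by rewrite mulr_ge0// !addr_ge0.
have Hx x : P x <= P 0 + P z -> plip (test_derive j) x (C * (1 + P 0 + P z)).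
  by move=> Px; have [_] := H j x jk; apply: plip_le; rewrite ler_wpM2l// -addrA lerD2l.
have [z0|z0] := leP 0 z.
  rewrite /D [`|z|]ger0_norm// -[X in _ * X]subr0; apply: plip_lipschitz => // x x0 xz; apply: Hx.
  move: x0; rewrite le_eqVlt => /predU1P[<-|x0]; first by rewrite lerDl.
  by rewrite ler_wpDl// (ray_pos P_mono).
rewrite distrC /D [`|z|]ltr0_norm// -[X in _ * X]sub0r; apply: plip_lipschitz => // [|x xz x0]; first exact: ltW.
apply: Hx.
move: x0; rewrite le_eqVlt => /predU1P[->|x0]; first by rewrite lerDl.
by rewrite ler_wpDl// (ray_neg P_mono).
Qed.

Let c j := if j == 0%N then gE (test_derive 0) else 0.

Let test_decay j : (j <= k)%N -> forall y, exists C : R, forall s, 0 < s ->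
  `|rho s ^+ j * (ou (test_derive j) s y - c j)| <= C * rho s.
Proof.
case: j => [|j] jk y; rewrite /c.
  exact: (ou_decay0 (test_llip jk) (dtest_measurable jk) (dtest_is_derive jk) (dtest_growth jk)
    (dtest_moment jk) (test_gint jk)).
exact: (ou_decayS (test_llip jk) (dtest_measurable jk) (dtest_is_derive jk) (dtest_growth jk)
  (test_gint jk)).
Qed.

Lemma test_stein_is_derive j w : (j <= k)%N ->
  is_derive w (1 : R) (stein_w j (c j) (test_derive j)) (stein_u j (dtest j) w).
Proof.
move=> jk; exact: (is_derive_stein_w (test_llip jk) (dtest_measurable jk) (dtest_is_derive jk)
  (dtest_growth jk) (dtest_moment jk) (test_decay jk)).
Qed.

Let dtest_top : dtest k = psi. Proof. by rewrite /dtest ltnn. Qed.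

Lemma test_stein_r_is_derive w : is_derive w (1 : R)
  (fun w => stein_v k psi w - test_derive k w) (k.+1%:R * stein_u k psi w + w * stein_v k psi w).
Proof.
have jk := leqnn k; rewrite -dtest_top.
exact: (is_derive_stein_r test_llip_top (dtest_measurable jk) (dtest_is_derive jk)
  (dtest_growth jk) (dtest_moment jk) (test_decay jk)).
Qed.

(** The successive derivatives of the Stein solution: [stein_w] up to order [k], then [stein_u] and
    [stein_v]. *)
Let F j := if (j <= k)%N then stein_w j (c j) (test_derive j)
  else if j == k.+1 then stein_u k psi else stein_v k psi.

Let F_is_derive j w : (j < k.+2)%N -> is_derive w (1 : R) (F j) (F j.+1 w).
Proof.
rewrite ltnS leq_eqVlt => /predU1P[->|jk].
  rewrite /F ltnn eqxx ltnNge leqW// gtn_eqF//=.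
  have jk := leqnn k; rewrite -dtest_top.
  exact: (is_derive_stein_u k test_llip_top (dtest_measurable jk) (dtest_is_derive jk)
    (dtest_growth jk) (dtest_moment jk)).
rewrite ltnS in jk; have := test_stein_is_derive w jk; rewrite /F jk /dtest.
have [jk'|kj] := ltnP j k; last first.
  by have -> : j = k by [apply/eqP; rewrite eqn_leq jk]; rewrite eqxx.
rewrite /c /= /stein_w /stein_u => H.
apply: is_derive_eq H _; congr (- _); apply: eq_Rintegral => s _.
by rewrite subr0.
Qed.

Lemma test_stein_derive1n j : (j <= k.+2)%N ->
  derive1n j (stein_w 0 (gE (test_derive 0)) (test_derive 0)) = F j.
Proof.
elim: j => [|j IH] jk; first by [].
rewrite derive1nS (IH (ltnW jk)); apply/funext => w.
by have [d e] := F_is_derive w jk; rewrite derive1E.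
Qed.

Lemma test_stein_derivable j w : (j < k.+2)%N ->
  derivable (derive1n j (stein_w 0 (gE (test_derive 0)) (test_derive 0))) w 1.
Proof. by move=> jk; rewrite test_stein_derive1n ?(ltnW jk)//; have [] := F_is_derive w jk. Qed.

Lemma test_stein_derive1n_top :
  derive1n k.+2 (stein_w 0 (gE (test_derive 0)) (test_derive 0)) = stein_v k psi.
Proof. by rewrite test_stein_derive1n// /F ltnNge leqW// gtn_eqF. Qed.

Lemma test_growth j : (j <= k)%N -> growth (test_derive j).
Proof.
move=> jk; exact: (growth_antiderivative (test_llip jk) (dtest_measurable jk)
  (dtest_is_derive jk) (dtest_growth jk)).
Qed.

Lemma top_derivative_growth : growth psi.
Proof. by rewrite -dtest_top; exact: dtest_growth. Qed.

Lemma top_derivative_moment : gint (fun z => (1 + `|z|) * psi z).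
Proof. by rewrite -dtest_top; exact: dtest_moment. Qed.

Let r w := stein_v k psi w - test_derive k w.

Let stein_vE : stein_v k psi = r + test_derive k.
Proof. by apply/funext => w; rewrite /r fctE subrK. Qed.

(** [r] is continuously differentiable and [test_derive k] is locally Lipschitz. Differentiability
    of [stein_v] almost everywhere will follow. *)
Lemma test_stein_v_llip : llip (stein_v k psi).
Proof.
rewrite stein_vE; apply: llipD; last exact: test_llip_top.
apply: (continuous_llip test_stein_r_is_derive).
have cu : continuous (stein_u k psi).
  apply: (@is_derive_continuous _ _ (stein_v k psi)) => x.
  have jk := leqnn k; rewrite -dtest_top.
  exact: (is_derive_stein_u k test_llip_top (dtest_measurable jk) (dtest_is_derive jk)
    (dtest_growth jk) (dtest_moment jk)).
have cv : continuous (stein_v k psi).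
  rewrite stein_vE => x; apply: cvgD; last exact: (llip_continuous test_llip_top).
  exact: (is_derive_continuous test_stein_r_is_derive).
move=> x; apply: cvgD; apply: cvgM; [exact: cvg_cst|exact: cu|exact: cvg_id|exact: cv].
Qed.

Lemma test_stein_v_derivable x : derivable (derive1n k h) (g x) 1 -> derivable (stein_v k psi) x 1.
Proof.
move=> dh; rewrite stein_vE; apply: derivableD; last exact: test_derivable.
by have [] := test_stein_r_is_derive x.
Qed.

Lemma test_stein_v_derive x : `|derive1 (stein_v k psi) x| <=
  `|k.+1%:R * stein_u k psi x + x * stein_v k psi x| + hn * P x.
Proof.
(* Where the derivative does not exist, [derive1] has the default value 0. *)
have [dv|dv] := pselect (derivable (stein_v k psi) x 1); last first.
  by rewrite derive1E /derive dvgP// normr0 addr_ge0// mulr_ge0// hnorm_ge0.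
set d := _ + x * _; have dr : is_derive x (1 : R) r d by exact: test_stein_r_is_derive.
have dd : is_derive x (1 : R) (stein_v k psi) (derive1 (stein_v k psi) x) by exact: derivable_is_derive.
(* Here [test_derive k] is a difference of two differentiable functions, so its derivative exists
   and obeys the pointwise Lipschitz bound. *)
have dchi : is_derive x (1 : R) (test_derive k) (derive1 (stein_v k psi) x - d).
  have -> : test_derive k = stein_v k psi - r.
    by apply/funext => y; rewrite !fctE /r opprB addrC subrK.
  exact: is_deriveB.
have := derive_le_plip dchi (test_plip x).
move=> hle; rewrite -[X in `|X| <= _](subrK d).
by rewrite (le_trans (ler_normD _ _))// addrC lerD2l.
Qed.

End derivatives.
End composite.
End test_function.

(** * Assembly of the final bound *)

Section remainder.
Context {R : realType}.
Implicit Types (w x y z s : R).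

(** Integration by parts gives E Z^2 = 1, and [|z| <= (1 + z ^ 2) / 2]. The bound replaces
    [|w| E|Z| P1(w)] by [|w| P1(w)] in the result. *)
Lemma gE_normz : gE (fun z : R => `|z|) <= 1.
Proof.
have e4 : (0 : R) < 1 / 4 by rewrite divr_gt0.
have H z : 1 + `|z| <= (2 + (1 / 4)^-1) * expR (1 / 4 * z ^+ 2) by exact: norm_le_exp.
have izz : gint (fun z : R => z * z).
  have := @gint_exp_poly R 2 0; rewrite divr_gt0// => /(_ isT); apply: le_gint.
    exact: measurable_funM.
  move=> z; rewrite mul0r expR0 mulr1 normrM -expr2 lerXn2r ?nnegrE ?addr_ge0//.
  by rewrite lerDr.
have zz : gE (fun z : R => z * z) = 1.
  rewrite -[RHS](@gE_cst R 1).
  apply: (@stein_ibp R id (cst 1) (1 / 4) (2 + (1 / 4)^-1)) => //.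
  - by lra.
  - exact: llip_id.
  - by apply: aeW => x; exact: is_derive_id.
  - by move=> z; apply: le_trans (H z); rewrite lerDr.
  - by move=> z; rewrite normr1; apply: le_trans (H z); rewrite lerDl.
have i1 : gint (fun z : R => 1 + z * z) by apply: gintD => //; exact: gint_cst.
have -> : (1 : R) = gE (fun z => 1 / 2 * (1 + z * z)).
  by rewrite gEZ// gED ?zz//; [rewrite (gE_cst (1 : R)); field|exact: gint_cst].
apply: le_gE; [exact: gint_normz|exact: gintZ|move=> z].
have -> : z * z = `|z| ^+ 2 by rewrite real_normK ?num_real// expr2.
by have := sqr_ge0 (`|z| - 1); rewrite sqrrB1; lra.
Qed.

Section bound.
Variables (k : nat) (chi psi : R -> R).
Hypotheses (lf : llip chi) (me : measurable_fun setT psi)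
  (de : {ae lebesgue_measure, forall x : R, is_derive x (1 : R) chi (psi x)})
  (ge : growth psi) (mom : gint (fun z => (1 + `|z|) * psi z)).
Variables (H alpha b c d : R) (P1 P2 : R -> R).
Hypotheses (H0 : 0 <= H) (alpha0 : 0 <= alpha) (b0 : 0 <= b) (c0 : 0 <= c).
Hypotheses (P1_ge0 : forall x, 0 <= P1 x) (P2_ge0 : forall x, 0 <= P2 x).
Hypotheses (P1_mono : forall w a, 1 < a -> P1 w <= P1 (a * w))
  (P2_mono : forall w a, 1 < a -> P2 w <= P2 (a * w)).
Hypotheses (P1_sum : forall x y, P1 (x + y) <= b * (P1 x + P1 y))
  (P2_sum : forall x y, P2 (x + y) <= c * (P2 (d * x) * P2 (d * y))).
Hypotheses (iP1 : gint P1) (izP1 : gint (fun z => `|z| * P1 z)).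
Hypothesis psi_le : forall x, `|psi x| <= H * (alpha + P1 x + P2 x).

Let Q x := H * (P1 x + P2 x).

Let Q_ge0 x : 0 <= Q x. Proof. by rewrite mulr_ge0// addr_ge0. Qed.

Let psi_leQ x : `|psi x| <= H * alpha + Q x.
Proof. by rewrite /Q -mulrDr addrA. Qed.

(** [p z] stands for [P2 (d * z)], except when the factor [H * (c * P2 (d * w))] is 0: then [p] can
    be 0, whether or not [P2 (d * z)] is integrable. *)
Variables (w : R) (p : R -> R).
Hypotheses (p_ge0 : forall z, 0 <= p z) (ip : gint p).
Hypothesis p_le : forall z, H * (c * P2 (d * w)) * P2 (d * z) <= H * (c * P2 (d * w)) * p z.

Let q z := H * b * P1 w + (H * b * P1 z + H * (c * P2 (d * w)) * p z).

(** Once the sum inequalities separate [w] from [z], monotonicity along rays removes [rho s] and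
    [sig s], which lie in []0, 1]]; the bound is thus uniform in [s]. *)
Let Q_le s z : 0 < s -> Q (rho s * w + sig s * z) <= q z.
Proof.
move=> s0; have r0 := rho_gt0 s; have r1 := ltW (rho_lt1 s0).
have g0 := sig_gt0 s0; have g1 := sig_le1 s0.
have k1 : P1 (rho s * w + sig s * z) <= b * (P1 w + P1 z).
  by rewrite (le_trans (P1_sum _ _))// ler_wpM2l// lerD// ray_scale.
have k2 : P2 (rho s * w + sig s * z) <= c * (P2 (d * w) * P2 (d * z)).
  rewrite (le_trans (P2_sum _ _))// ler_wpM2l//.
  by apply: ler_pM => //; rewrite mulrCA ray_scale.
rewrite /Q /q; apply: le_trans (ler_wpM2l H0 (lerD k1 k2)) _.
have := p_le z; rewrite -!mulrA => hz.
by rewrite mulrDr !mulrDr -!addrA !lerD2l.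
Qed.

Let iq : gint q.
Proof. by apply: gintD; [exact: gint_cst|apply: gintD; exact: gintZ]. Qed.

Let gEq : gE q = H * b * P1 w + (H * b * gE P1 + H * (c * P2 (d * w)) * gE p).
Proof.
rewrite /q gED; [|exact: gint_cst|by apply: gintD; exact: gintZ].
by rewrite (gE_cst (H * b * P1 w)) gED ?gEZ//; exact: gintZ.
Qed.

Lemma stein_remainder_bound0 : w = 0 -> `|k.+1%:R * stein_u k psi 0| <=
  H * (alpha + b * (P1 0 + gE P1) + c * (P2 (d * 0) * gE p)).
Proof.
move=> w0; have A0 : 0 <= H * alpha by rewrite mulr_ge0.
have Hq s z : 0 < s -> Q (rho s * 0 + sig s * z) <= q z by move=> s0; have := @Q_le s z s0; rewrite w0.
apply: le_trans (stein_bound0 k lf me de ge mom A0 psi_leQ Q_ge0 Hq iq) _.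
by rewrite gEq w0 le_eqVlt; apply/orP; left; apply/eqP; ring.
Qed.

Lemma stein_remainder_bound : gint (fun z => `|z| * p z) ->
  `|k.+1%:R * stein_u k psi w + w * stein_v k psi w| <=
  H * (alpha + b * (P1 w + gE P1) + `|w| * (b * (P1 w + gE (fun z => `|z| * P1 z)))
    + c * P2 (d * w) * (gE p + `|w| * gE (fun z => `|z| * p z))).
Proof.
move=> izp; have A0 : 0 <= H * alpha by rewrite mulr_ge0.
have zqE : (fun z => `|z| * q z) = fun z => H * b * P1 w * `|z| +
    (H * b * (`|z| * P1 z) + H * (c * P2 (d * w)) * (`|z| * p z)).
  by apply/funext => z; rewrite /q; ring.
have iz : gint (fun z => H * b * P1 w * `|z|) by apply: gintZ; exact: gint_normz.
have iz' : gint (fun z => H * b * (`|z| * P1 z) + H * (c * P2 (d * w)) * (`|z| * p z)).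
  by apply: gintD; exact: gintZ.
have izq : gint (fun z => `|z| * q z) by rewrite zqE; exact: gintD.
apply: le_trans (stein_bound k lf me de ge mom A0 psi_leQ Q_ge0 Q_le iq izq) _.
rewrite gEq zqE (gED iz iz') gED; [|exact: gintZ|exact: gintZ].
rewrite !gEZ//; last exact: gint_normz.
set E1 := gE P1; set E1' := gE (fun z => `|z| * P1 z); set e := gE p; set e' := gE _.
have : `|w| * (H * b * P1 w * gE (fun z => `|z|)) <= `|w| * (H * b * P1 w * 1).
  by rewrite ler_wpM2l// ler_wpM2l ?gE_normz// !mulr_ge0.
rewrite mulr1 => hE; rewrite [in leLHS]mulrDr.
apply: le_trans (lerD (lexx _) (lerD hE (lexx _))) _; rewrite le_eqVlt; apply/orP; left; apply/eqP; ring.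
Qed.

End bound.

(** The class F_* does not force E P2(delta_2 Z) or E |Z P2(delta_2 Z)| to be finite. An infinite
    one makes the right side infinite unless its coefficient is 0, and then the product is 0; three
    real inequalities therefore suffice: for a vanishing common factor, for [w = 0], and for two
    finite expectations. *)
Lemma ereal_bound (D H a b c E1 E1' p1 pd w : R) (e2 e2' : \bar R) :
  0 <= H -> 0 <= b -> 0 <= c -> 0 <= pd -> (0 <= e2)%E -> (0 <= e2')%E ->
  let X := a + b * (E1 + `|w| * E1' + (1 + `|w|) * p1) in
  (H * (c * pd) = 0 -> D <= H * X) ->
  (forall E2, e2 = E2%:E -> w = 0 -> D <= H * (X + c * (E2 * pd))) ->
  (forall E2 E2', e2 = E2%:E -> e2' = E2'%:E ->
    D <= H * (X + c * (E2 * pd + E2' * `|w * pd|))) ->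
  (D%:E <= H%:E * (a%:E + b%:E * (E1%:E + `|w|%:E * E1'%:E + ((1 + `|w|) * p1)%:E)
    + c%:E * (e2 * pd%:E + e2' * `|w * pd|%:E)))%E.
Proof.
move=> H0 b0 c0 pd0 e0 e0' X h0 h1 h2.
have XE : (a%:E + b%:E * (E1%:E + `|w|%:E * E1'%:E + ((1 + `|w|) * p1)%:E) = X%:E)%E by [].
rewrite XE.
have n0 : (0 <= e2 * pd%:E)%E by rewrite mule_ge0// lee_fin.
have n0' : (0 <= e2' * `|w * pd|%:E)%E by rewrite mule_ge0// lee_fin.
have [Hc|Hc] := eqVneq (H * (c * pd)) 0.
  apply: (@le_trans _ _ (H%:E * X%:E)%E); first by rewrite -EFinM lee_fin; exact: h0.
  rewrite lee_wpmul2l ?lee_fin//; apply: leeDl.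
  by rewrite mule_ge0 ?lee_fin// adde_ge0.
have [Hn cn pn] : [/\ H != 0, c != 0 & pd != 0].
  by move: Hc; rewrite !mulf_eq0 !negb_or => /and3P.
have Hp : (0 < H%:E)%E by rewrite lte_fin lt0r Hn.
have cp : (0 < c%:E)%E by rewrite lte_fin lt0r cn.
have pp : (0 < pd%:E)%E by rewrite lte_fin lt0r pn.
have top t : t = +oo%E -> (D%:E <= H%:E * (X%:E + c%:E * t))%E.
  by move=> ->; rewrite gt0_muley// addey// gt0_muley// leey.
case: e2 e0 n0 h1 h2 => [E2| |//] e0 n0 h1 h2; last first.
  by apply: top; rewrite gt0_mulye// addye// gt_eqF// (lt_le_trans _ n0').
have [w0|wn] := eqVneq w 0.
  have -> : (e2' * `|w * pd|%:E = 0)%E by rewrite w0 mul0r normr0 mule0.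
  by rewrite adde0; have := h1 E2 erefl w0; rewrite -lee_fin.
case: e2' e0' n0' h2 => [E2'| |//] e0' n0' h2; last first.
  apply: top; rewrite gt0_mulye ?addey//.
  by rewrite lte_fin normr_gt0 mulf_neq0.
by have := h2 E2 E2' erefl erefl; rewrite -lee_fin.
Qed.

Lemma gint_fin (f : R -> R) : measurable_fun setT f -> (forall z, 0 <= f z) ->
  (\int[normal_prob 0 1]_z (f z)%:E < +oo)%E -> gint f.
Proof.
move=> mf f0 fin; apply/integrableP; split; first exact/measurable_EFinP.
by under eq_integral => z _ do rewrite /= ger0_norm//.
Qed.

End remainder.

Local Open Scope classical_set_scope.

(** [alpha] occurs once in the bound for [r] and once in that for the remainder of [D]; the third
    [H * alpha] is slack, dropped as nonnegative. *)
Lemma derivative_bound (R : realType) (H alpha b c E1 E1' p1 p2 pd w r D K : R) :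
  0 <= H * alpha -> D <= r + H * (alpha + p1 + p2) ->
  r <= H * (alpha + b * (p1 + E1) + `|w| * (b * (p1 + E1')) + c * pd * K) ->
  D <= H * (3 * alpha + p1 + p2 + b * (E1 + `|w| * E1' + (1 + `|w|) * p1) + c * (pd * K)).
Proof.
move=> Ha HD Hr; apply: le_trans HD _.
have -> : H * (3 * alpha + p1 + p2 + b * (E1 + `|w| * E1' + (1 + `|w|) * p1) + c * (pd * K)) =
    H * (alpha + b * (p1 + E1) + `|w| * (b * (p1 + E1')) + c * pd * K) +
    H * (alpha + p1 + p2) + H * alpha by ring.
by rewrite ler_wpDr// lerD2r.
Qed.

Theorem proposition2p2 (R : realType) (d : measure_display)
    (T : measurableType d) (Pr : probability T R) (Z : {RV Pr >-> R})
    (Z_normal : forall A : set R, measurable A ->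
      distribution Pr Z A = normal_prob 0 1 A)
    (n : nat) (n_ge3 : (3 <= n)%N)
    (P : R -> R) (alpha : R) (P1 P2 : R -> R) (beta gamma delta : nat -> R)
    (P_Fstar : Fstar Z P alpha P1 P2 beta gamma delta)
    (h g : R -> R) (h_Cb : Cb (n - 2) h) (g_CP : CP P (n - 2) g) :
  let f := stein_solution Z (fun x => h (g x)) in
  [/\ forall (k : nat) (w : R), (k < n.-1)%N -> derivable (f^`(k)) w 1,
      forall w : R, derivable (h^`(n - 3)) (g w) 1 ->
        derivable (f^`(n.-1)) w 1,
      {ae lebesgue_measure, forall w : R, derivable (f^`(n.-1)) w 1} &
      forall w : R,
        ((`|derive1n n f w|)%:E <=
          (hnorm h (n - 2))%:E *
          ((3 * alpha + P1 w + P2 w)%:E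
           + (beta 2%N)%:E *
             ('E_Pr[fun x => P1 (Z x)]
              + (`|w|)%:E * 'E_Pr[fun x => `|Z x * P1 (Z x)|%R]
              + ((1 + `|w|) * P1 w)%:E)
           + (gamma 2%N)%:E *
             ('E_Pr[fun x => P2 (delta 2%N * Z x)%R] * (P2 (delta 2%N * w))%:E
              + 'E_Pr[fun x => `|Z x * P2 (delta 2%N * Z x)|%R]
                * (`|w * P2 (delta 2%N * w)|)%:E)))%E].
Proof.
(* From here on [n = k + 3], so the order of regularity n - 2 is [k + 1]. *)
case: n n_ge3 h_Cb g_CP => [//|[//|[//|k]]] _; rewrite !subSS !subn0 => hC gC.
have [PE a0 p10 p20 m1 m2 b0 c0 _ s1 s2 eP1 eP2 eZ1 eZ2] := P_Fstar.
have P0 x : 0 <= P x by rewrite PE !addr_ge0.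
have Pm w a : 1 < a -> P w <= P (a * w) by move=> a1; rewrite !PE !lerD ?m1 ?m2.
have mP1 := ray_measurable p10 m1; have mP2 := ray_measurable p20 m2.
have mz (F : R -> R) : measurable_fun setT F -> measurable_fun setT (fun z : R => `|z| * F z).
  by move=> mF; apply: measurable_funM => //; exact: measurableT_comp.
have normZ (F : R -> R) : (forall z, 0 <= F z) ->
    (fun t => `|Z t * F (Z t)|) = (fun t => (fun z => `|z| * F z) (Z t)).
  by move=> F0; apply/funext => t; rewrite normrM [`|F _|]ger0_norm.
have iP1 : gint P1 by exact: (gint_normal Z_normal mP1 p10 eP1).
have iP2 : gint P2 by exact: (gint_normal Z_normal mP2 p20 eP2).
have izP1 : gint (fun z => `|z| * P1 z).
  apply: (gint_normal Z_normal); [exact: mz|by move=> x; rewrite mulr_ge0|].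
  move: eZ1; congr (_.-integrable _ _); apply/funext => t; congr EFin.
  by have /(congr1 (fun F => F t)) := normZ P1 p10.
have izP2 : gint (fun z => `|z| * P2 z).
  apply: (gint_normal Z_normal); [exact: mz|by move=> x; rewrite mulr_ge0|].
  move: eZ2; congr (_.-integrable _ _); apply/funext => t; congr EFin.
  by have /(congr1 (fun F => F t)) := normZ P2 p20.
have iP : gint P.
  have -> : P = fun z => alpha + (P1 z + P2 z) by apply/funext => z; rewrite PE addrA.
  by apply: gintD; [exact: gint_cst|exact: gintD].
have izP : gint (fun z => `|z| * P z).
  have -> : (fun z => `|z| * P z) = fun z => alpha * `|z| + (`|z| * P1 z + `|z| * P2 z).
    by apply/funext => z; rewrite PE; ring.
  by apply: gintD; [apply: gintZ; exact: gint_normz|exact: gintD].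
have [psi [mpsi psiP dpsi]] := test_derivative hC gC P0 Pm.
(* Expectations under [Pr] become Gaussian integrals, and the solution is [stein_w] of order 0,
   where the power of [rho] is 1. *)
have fE : stein_solution Z (fun x => h (g x)) =
    stein_w 0 (gE (test_derive h g 0)) (test_derive h g 0).
  rewrite test_derive0; apply/funext => w; rewrite /stein_solution /stein_w; congr (- fine _).
  have i0 := test_gint hC gC P0 Pm izP psiP (leq0n k).
  have g0 := test_growth hC gC P0 Pm iP mpsi psiP dpsi (leq0n k).
  have l0 := test_llip hC gC P0 Pm (leq0n k).
  rewrite test_derive0 in i0 g0 l0.
  apply: eq_integral => s; rewrite inE/= in_itv/= andbT => s0.
  have m0 : measurable_fun setT (fun x => h (g x)).
    by apply: continuous_measurable_fun; exact: llip_continuous.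
  rewrite (expectation_normal Z_normal i0).
  by rewrite (expectation_normal Z_normal (gint_ou w m0 g0 s0)) expr0 mul1r.
have vE := test_stein_derive1n_top hC gC P0 Pm iP izP mpsi psiP dpsi.
have vl := test_stein_v_llip hC gC P0 Pm iP izP mpsi psiP dpsi.
rewrite fE; set f := stein_w _ _ _; rewrite -/f in vE.
have vE' : derive1n k.+3.-1 f = stein_v k psi by [].
split.
- by move=> j w jk; exact: (test_stein_derivable hC gC P0 Pm iP izP mpsi psiP dpsi jk).
- move=> w dh; rewrite vE'.
  exact: (test_stein_v_derivable hC gC P0 Pm iP izP mpsi psiP dpsi dh).
- by rewrite vE'; apply: abs_continuous_ae_derivable; exact: llip_ac.
move=> w; rewrite derive1nS vE.
have HD := test_stein_v_derive hC gC P0 Pm iP izP mpsi psiP dpsi w.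
have H0 := hnorm_ge0 k h; set H := hnorm h k.+1 in HD H0 psiP *.
have {}b0 := b0 2%N isT; have {}c0 := c0 2%N isT.
have {}s1 x y : P1 (x + y) <= beta 2%N * (P1 x + P1 y).
  have := s1 2%N (fun i => if i == ord0 then x else y) isT.
  by rewrite !big_ord_recl !big_ord0 /= !addr0.
have {}s2 x y : P2 (x + y) <= gamma 2%N * (P2 (delta 2%N * x) * P2 (delta 2%N * y)).
  have := s2 2%N (fun i => if i == ord0 then x else y) isT.
  by rewrite !big_ord_recl !big_ord0 /= addr0 mulr1.
set b := beta 2%N in b0 s1 *; set c := gamma 2%N in c0 s2 *; set dl := delta 2%N in s2 *.
have psile x : `|psi x| <= H * (alpha + P1 x + P2 x) by rewrite -PE.
have lf := test_llip_top hC gC P0 Pm.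
have ge := top_derivative_growth hC gC P0 Pm iP psiP.
have mom := top_derivative_moment hC gC P0 Pm iP izP mpsi psiP.
have RB := stein_remainder_bound k lf mpsi dpsi ge mom H0 a0 b0 c0 p10 p20 m1 m2 s1 s2 iP1 izP1 psile.
have RB0 := stein_remainder_bound0 k lf mpsi dpsi ge mom H0 a0 b0 c0 p10 p20 m1 m2 s1 s2 iP1 psile.
pose p z := P2 (dl * z).
have mp : measurable_fun setT p by apply: measurableT_comp => //; exact: measurable_funM.
have p_ge0 z : 0 <= p z by exact: p20.
have zp_ge0 z : 0 <= `|z| * p z by rewrite mulr_ge0.
have zP1_ge0 z : 0 <= `|z| * P1 z by rewrite mulr_ge0.
rewrite (expectation_normal Z_normal iP1) (normZ P1 p10) (expectation_normal Z_normal izP1).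
have -> : ('E_Pr[fun x => P2 (dl * Z x)%R] = \int[normal_prob 0 1]_z (p z)%:E)%E.
  exact: (ge0_expectation_normal Z_normal mp p_ge0).
have -> : ('E_Pr[fun x => `|Z x * P2 (dl * Z x)|%R] =
    \int[normal_prob 0 1]_z (`|z| * p z)%:E)%E.
  by rewrite (normZ p p_ge0) (ge0_expectation_normal Z_normal (mz _ mp) zp_ge0).
have ip E2 : (\int[normal_prob 0 1]_z (p z)%:E)%E = E2%:E -> gint p /\ gE p = E2.
  move=> e; have i : gint p by apply: gint_fin => //; rewrite e ltry.
  by split => //; move: e; rewrite (gE_EFin i) => -[].
have izp E2 : (\int[normal_prob 0 1]_z (`|z| * p z)%:E)%E = E2%:E ->
    gint (fun z => `|z| * p z) /\ gE (fun z => `|z| * p z) = E2.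
  move=> e; have i : gint (fun z => `|z| * p z).
    by apply: gint_fin => //; [exact: mz|rewrite e ltry].
  by split => //; move: e; rewrite (gE_EFin i) => -[].
have Ha : 0 <= H * alpha by rewrite mulr_ge0.
rewrite PE in HD; apply: ereal_bound => //.
- by apply: integral_ge0 => z _; rewrite lee_fin.
- by apply: integral_ge0 => z _; rewrite lee_fin.
(* Vanishing factor: 0 replaces [P2 (dl * z)], whose mean may be infinite here. *)
- move=> Hc; have iz0 : gint (fun z : R => `|z| * 0).
    by have := gintZ 0 (@gint_normz R); under [X in gint X -> _]eq_fun do rewrite mulrC.
  have Hle z : H * (c * P2 (dl * w)) * P2 (dl * z) <= H * (c * P2 (dl * w)) * 0.
    by rewrite Hc !mul0r.
  have := derivative_bound Ha HD (RB w (fun=> 0) (gint_cst 0) Hle iz0).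
  by rewrite mulrDr !mulrA -[H * c * _]mulrA Hc mul0r addr0.
(* At [w = 0] only the mean of [P2 (dl * z)] is known to be finite, hence the bound without a first
   moment. *)
- move=> E2 /ip[i2 e2] w0; have := RB0 w p i2 (fun=> lexx _) w0.
  have -> : k.+1%:R * stein_u k psi 0 = k.+1%:R * stein_u k psi w + w * stein_v k psi w.
    by rewrite w0 mul0r addr0.
  have -> : H * (alpha + b * (P1 0 + gE P1) + c * (P2 (dl * 0) * gE p)) =
      H * (alpha + b * (P1 w + gE P1) + `|w| * (b * (P1 w + gE (fun z => `|z| * P1 z)))
        + c * P2 (dl * w) * E2) by rewrite e2 w0 normr0 mul0r addr0 mulrA.
  by move=> /(derivative_bound Ha HD); rewrite [P2 _ * E2]mulrC.
- move=> E2 E2' /ip[i2 e2] /izp[iz2 ez2].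
  have := derivative_bound Ha HD (RB w p i2 (fun=> lexx _) iz2).
  rewrite e2 ez2 normrM [`|P2 _|]ger0_norm// => /le_trans; apply.
  by rewrite le_eqVlt; apply/orP; left; apply/eqP; ring.
Qed.
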